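(* Let $d,k\ge2$ be integers and let $F$ be a signature of arity $k$ all of whose values lie in the interval $\left[1,\frac{d(k-1)+1}{d(k-1)-1}\right)$. Then $\#\mathrm{CSP}^{\geq0}_{\leq d}(\{F\})$ has an FPRAS.
   Context: $\mathbb{R}_p$ is the set of non-negative reals $r$ such that some polynomial-time Turing machine, given $n$ in unary, outputs the first $n$ bits of $r$. A signature of arity $k$ is a function $F:\{0,1\}^k\to\mathbb{R}_p$. An instance of $\#\mathrm{CSP}^{\geq0}_{\leq d}(\{F\})$ consists of a finite variable set $V$, a weight $w(v)=(w(v)_0,w(v)_1)\in\mathbb{Q}_{\ge0}\times\mathbb{Q}_{\ge0}$ (given as binary fractions) for each $v\in V$, and a finite list of constraints, each a map $s:\{1,\dots,k\}\to V$ (repetitions allowed), such that every variable has degree (number of pairs (constraint, argument position) mapped to it) in $\{1,\dots,d\}$. The output is $Z=\sum_{x\in\{0,1\}^V}\prod_{v}w(v)_{x_v}\prod_{s}F(x_{s(1)},\dots,x_{s(k)})$. An FPRAS is a randomised algorithm that on input (instance $I$, $\epsilon\in(0,1)$) outputs $Y$ with $\Pr[e^{-\epsilon}Z\le Y\le e^{\epsilon}Z]\ge3/4$ in time $\mathrm{poly}(|I|,1/\epsilon)$. *)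

(* Defs.v *)
From Stdlib Require Export Reals List Arith ZArith.
Export ListNotations.
Open Scope R_scope.

(* Tape alphabet: nat, with 0 = blank, 1 = bit 0, 2 = bit 1, 3 = '#'.   *)
(* A machine is a finite transition table; the start state is 0; the   *)
(* machine halts when no table entry matches (state, scanned symbol).  *)

Inductive move := MvL | MvS | MvR.

Definition mv (m : move) : Z :=
  match m with MvL => (-1)%Z | MvS => 0%Z | MvR => 1%Z end.

(* entry (q, a, q', b, m): in state q reading a, write b, go to q', move m *)
Definition TM := list (nat * nat * nat * nat * move).

Record config := Cfg { st : nat; hd : Z; tp : Z -> nat }.

Fixpoint lookup (M : TM) (q a : nat) : option (nat * nat * move) :=
  match M with
  | [] => None
  | (q0, a0, q', b, m) :: M' =>
      if andb (Nat.eqb q q0) (Nat.eqb a a0) then Some (q', b, m)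
      else lookup M' q a
  end.

Definition step (M : TM) (c : config) : option config :=
  match lookup M (st c) (tp c (hd c)) with
  | None => None
  | Some (q', b, m) =>
      Some (Cfg q' (hd c + mv m)%Z
                (fun z => if Z.eqb z (hd c) then b else tp c z))
  end.

Fixpoint exec (M : TM) (n : nat) (c : config) : config :=
  match n with
  | O => c
  | S n' => match step M c with None => c | Some c' => exec M n' c' end
  end.

Definition halted (M : TM) (c : config) : Prop := step M c = None.

Definition sym (b : bool) : nat := if b then 2%nat else 1%nat.

Definition init (w : list nat) : config :=
  Cfg 0 0%Z (fun z => if Z.ltb z 0 then 0%nat else nth (Z.to_nat z) w 0%nat).

Fixpoint read_bits (t : Z -> nat) (i : Z) (fuel : nat) : list bool :=
  match fuel with
  | O => []
  | S f => match t i with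
           | 1%nat => false :: read_bits t (i + 1)%Z f
           | 2%nat => true :: read_bits t (i + 1)%Z f
           | _ => []
           end
  end.

(* output of a halted run started on a word of length len with time T:
   the bits from cell 0 onwards (fuel large enough to reach a blank) *)
Definition output (c : config) (len T : nat) : list bool :=
  read_bits (tp c) 0%Z (len + 2 * T + 2).

Fixpoint pos_bits (p : positive) : list bool :=
  match p with
  | xH => [true]
  | xO p' => false :: pos_bits p'
  | xI p' => true :: pos_bits p'
  end.

Definition nat_bits (n : nat) : list bool :=
  match N.of_nat n with N0 => [] | Npos p => pos_bits p end.

Definition enc_nat (n : nat) : list bool :=
  concat (map (fun b => [true; b]) (nat_bits n)) ++ [false; false].

Definition enc_list {A} (f : A -> list bool) (l : list A) : list bool :=
  concat (map (fun x => true :: f x) l) ++ [false].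

(* r in R_p: r >= 0 and a polynomial-time machine, given n in unary,
   outputs (in binary) floor(2^n r), i.e. the bits of r down to 2^-n. *)
Definition in_Rp (r : R) : Prop :=
  0 <= r /\
  exists (M : TM) (c : nat),
    forall n : nat,
      let w := map sym (repeat true n) in
      let T := (c * (n + 1) ^ c)%nat in
      let cf := exec M T (init w) in
      halted M cf /\
      exists a : nat, output cf (length w) T = enc_nat a /\
        INR a <= r * 2 ^ n < INR a + 1.

(* Variables are 0..nv-1; weight of v is ((a0,b0),(a1,b1)) meaning
   w(v)_0 = a0/b0, w(v)_1 = a1/b1; constraints are lists of variables
   (the scope s(1),...,s(k)). *)
Record instance := Inst {
  nv : nat;
  wts : list ((nat * nat) * (nat * nat));
  cstr : list (list nat) }.

Definition degree (I : instance) (v : nat) : nat :=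
  list_sum (map (fun s => count_occ Nat.eq_dec s v) (cstr I)).

Definition valid (k d : nat) (I : instance) : Prop :=
  length (wts I) = nv I /\
  (forall w, In w (wts I) -> (0 < snd (fst w))%nat /\ (0 < snd (snd w))%nat) /\
  (forall s, In s (cstr I) ->
     length s = k /\ forall v, In v s -> (v < nv I)%nat) /\
  (forall v, (v < nv I)%nat -> (1 <= degree I v <= d)%nat).

Definition frac (q : nat * nat) : R := INR (fst q) / INR (snd q).

Definition wt (w : (nat * nat) * (nat * nat)) (b : bool) : R :=
  if b then frac (snd w) else frac (fst w).

Fixpoint assignments (n : nat) : list (list bool) :=
  match n with
  | O => [[]]
  | S n' => map (cons false) (assignments n') ++ map (cons true) (assignments n')
  end.

Definition sumR (l : list R) : R := fold_right Rplus 0 l.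
Definition prodR (l : list R) : R := fold_right Rmult 1 l.

Definition Zfun (F : list bool -> R) (I : instance) : R :=
  sumR (map (fun x =>
      prodR (map (fun v => wt (nth v (wts I) ((0%nat, 1%nat), (0%nat, 1%nat))) (nth v x false))
                 (seq 0 (nv I))) *
      prodR (map (fun s => F (map (fun v => nth v x false) s)) (cstr I)))
    (assignments (nv I))).

Definition enc_inst (I : instance) : list bool :=
  enc_nat (nv I) ++
  enc_list (fun w => enc_nat (fst (fst w)) ++ enc_nat (snd (fst w)) ++
                     enc_nat (fst (snd w)) ++ enc_nat (snd (snd w))) (wts I) ++
  enc_list (enc_list enc_nat) (cstr I).

(* FPRAS.  A randomised machine is a deterministic machine whose tape   *)
(* initially holds  enc(I) enc(eps) # r  where r is a uniformly random  *)
(* bit string of length T = the time bound (it cannot read more bits).  *)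
(* eps = en/ed is a rational in (0,1); the time bound is polynomial in  *)
(* the input length and 1/eps; the output is a rational a/b in binary.  *)

Definition good_run (M : TM) (F : list bool -> R) (I : instance)
    (en ed : nat) (w : list nat) (T : nat) (r : list bool) : Prop :=
  let cf := exec M T (init (w ++ [3%nat] ++ map sym r)) in
  let eps := INR en / INR ed in
  exists a b : nat, (0 < b)%nat /\
    output cf (length w + 1 + length r) T = enc_nat a ++ enc_nat b /\
    exp (- eps) * Zfun F I <= INR a / INR b <= exp eps * Zfun F I.

Definition has_FPRAS (k d : nat) (F : list bool -> R) : Prop :=
  exists (M : TM) (c : nat),
    forall I : instance, valid k d I ->
    forall en ed : nat, (0 < en)%nat -> (en < ed)%nat ->
      let w := map sym (enc_inst I ++ enc_nat en ++ enc_nat ed) in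
      let T := (c * (length w + ed / en + 1) ^ c)%nat in
      (forall r, length r = T ->
         halted M (exec M T (init (w ++ [3%nat] ++ map sym r)))) /\
      exists S : list (list bool),
        NoDup S /\
        (forall r, In r S -> length r = T /\ good_run M F I en ed w T r) /\
        (4 * length S >= 3 * 2 ^ T)%nat.

(* Main.v *)
Require Import Defs.
From Stdlib Require Import Reals List Arith NArith ZArith Lia Lra Psatz Bool FunctionalExtensionality.

(* The algorithm is deterministic, so the random bits are ignored.  By the chain
   rule Z is the product of the total weights of the variables and of the
   expectations of F on each constraint under the Gibbs measure of the remaining
   ones.  Such an expectation is computed by pinning the variables of the
   constraint one after the other, given their marginals; the odds of a variable u
   are, by telescoping over the constraints around u (the earlier ones with u = 1,
   the later ones with u = 0), a product of ratios of expectations of the same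
   kind in smaller instances.  The recursion is cut off at logarithmic depth.
   Since the constraint has been removed, its variables have at most d - 1 other
   constraints, each with at most k - 1 other variables, and one step of the
   recursion multiplies the error of the marginals by at most
   (d - 1) (k - 1) (rho - 1) / 2 < 1, where rho = max F < 1 + 2 / (d (k - 1) - 1).
   All numbers are exact fractions of polynomial length; F itself is replaced by
   its first bits, which loses a factor 1 + 2^-n per constraint.

   For the time bound, programs over three stacks are compiled to one-tape
   machines, and a class of polynomial-time functions on trees, closed under
   bounded iteration, is built from such programs. *)

(** The weights may vanish or be arbitrarily skewed, so there is no uniform bound on odds or on
    their logarithms; errors are measured as absolute differences of marginals. The odds of [u] are
    [w u] times ratios A / B of expectations from one interval [lam, lam rho], and AM-GM makes the
    error bound independent of [w u]; it is also the origin of the 1/2 in the contraction factor. As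
    k >= 2, (d - 1) (k - 1) <= d (k - 1) - 1, so the interval assumed for F makes that factor less
    than 1, by a fixed amount because F has only finitely many values. One level of the recursion
    multiplies the cost by a constant K depending on d and k, so logarithmic depth l costs a
    polynomial K^l. The class of functions offers loops but no recursion, hence the recursion is run
    by a loop over an explicit stack of tasks. Fractions are never reduced: under combination the
    lengths of numerators and denominators merely add up, and polynomially many steps leave them
    polynomial. *)

Open Scope nat_scope.

(** * Stack programs and their timed semantics *)

Inductive sy := Lf | Nd | En.
Inductive stk := K0 | K1 | K2.
(** Input and output share the cells from 0 on: a program first reads, [c] counting the consumed
    cells, and cannot read any more once it has begun to write. *)
Inductive io := Reading (c : nat) (l : list sy) | Writing (o : list bool).
Record mst := Mst { d0 : list sy; d1 : list sy; d2 : list sy; port : io }.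

(** These are the tape symbols of the bits 0 and 1 and of [#], so an input word is itself a list of
    [sy]. *)
Definition code (a : sy) : nat := match a with Lf => 1 | Nd => 2 | En => 3 end.

Definition get (s : mst) (i : stk) : list sy :=
  match i with K0 => d0 s | K1 => d1 s | K2 => d2 s end.

Definition put (s : mst) (i : stk) (l : list sy) : mst :=
  match i with
  | K0 => Mst l (d1 s) (d2 s) (port s)
  | K1 => Mst (d0 s) l (d2 s) (port s)
  | K2 => Mst (d0 s) (d1 s) l (port s)
  end.

Inductive src := Stk (i : stk) | Inp.

Definition pop (x : src) (s : mst) : option (sy * mst) :=
  match x with
  | Stk i => match get s i with [] => None | a :: l => Some (a, put s i l) end
  | Inp => match port s with
           | Reading c (a :: l) => Some (a, Mst (d0 s) (d1 s) (d2 s) (Reading (S c) l))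
           | _ => None
           end
  end.

(** The first bit requires a consumed input cell, because writing begins by overwriting the marker
    in cell 0. *)
Definition emit (b : bool) (s : mst) : option mst :=
  match port s with
  | Reading (S _) _ => Some (Mst (d0 s) (d1 s) (d2 s) (Writing [b]))
  | Writing o => Some (Mst (d0 s) (d1 s) (d2 s) (Writing (o ++ [b])))
  | _ => None
  end.

Inductive prog :=
| Push (i : stk) (a : sy)
| Emit (b : bool)
| Seq (p q : prog)
| Case (x : src) (b : sy -> prog)
| Loop (x : src) (ex : sy -> bool) (b : sy -> prog).

(** By [run_slack] the number is only an upper bound on the time. Popping from an empty source has
    no rule, so a derivation also certifies that this never happens. *)
Inductive run : prog -> mst -> nat -> mst -> Prop :=
| run_push i a s : run (Push i a) s 1 (put s i (a :: get s i))
| run_emit b s s' : emit b s = Some s' -> run (Emit b) s 1 s'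
| run_seq p q s t s' t' s'' :
    run p s t s' -> run q s' t' s'' -> run (Seq p q) s (t + t') s''
| run_case x b s a s' t s'' :
    pop x s = Some (a, s') -> run (b a) s' t s'' -> run (Case x b) s (S t) s''
| run_exit x ex b s a s' :
    pop x s = Some (a, s') -> ex a = true -> run (Loop x ex b) s 1 s'
| run_loop x ex b s a s' t s'' t' s3 :
    pop x s = Some (a, s') -> ex a = false -> run (b a) s' t s'' ->
    run (Loop x ex b) s'' t' s3 -> run (Loop x ex b) s (S (t + t')) s3
| run_slack p s t t' s' : run p s t s' -> t <= t' -> run p s t' s'.

(** Up to a constant, the distance that one instruction may have to walk from the home cell. *)
Definition weight (s : mst) : nat :=
  length (d0 s) + length (d1 s) + length (d2 s) +
  match port s with Reading c _ => c | Writing o => length o end.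

Lemma weight_put s i l : weight (put s i l) + length (get s i) = weight s + length l.
Proof. destruct i; unfold weight; simpl; lia. Qed.

Lemma pop_weight x s a s' : pop x s = Some (a, s') -> weight s' <= S (weight s).
Proof.
  destruct x as [i|]; simpl.
  - destruct (get s i) eqn:E; [discriminate|]. intros [= <- <-].
    pose proof (weight_put s i l). rewrite E in H. simpl in H. lia.
  - unfold weight; destruct (port s) as [c [|b l]|]; try discriminate.
    intros [= <- <-]. simpl. lia.
Qed.

Lemma emit_weight b s s' : emit b s = Some s' -> weight s' <= S (weight s).
Proof.
  unfold emit, weight; destruct (port s) as [[|c] l|o]; try discriminate;
  intros [= <-]; simpl; rewrite ?length_app; simpl; lia.
Qed.

Lemma run_weight p s t s' : run p s t s' -> weight s' <= weight s + t.
Proof.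
  induction 1.
  - pose proof (weight_put s i (a :: get s i)). simpl in *. lia.
  - apply emit_weight in H. lia.
  - lia.
  - apply pop_weight in H. lia.
  - apply pop_weight in H. lia.
  - apply pop_weight in H. lia.
  - lia.
Qed.

(** * Compilation to Turing machines *)

(* Stack [i] is a track of the cells [-2, -3, ...] with its bottom at [-2]; the
   three tracks share a cell as base-4 digits, scaled by 6 so that no cell of
   the stacks is ever mistaken for the home marker 5 at cell [-1]. *)
Definition digit (l : list sy) (j : nat) : nat := nth j (map code (rev l)) 0.
Definition cell (s : mst) (j : nat) : nat :=
  digit (d0 s) j + 4 * digit (d1 s) j + 16 * digit (d2 s) j.
Definition dig (i : stk) (m : nat) : nat :=
  match i with K0 => m mod 4 | K1 => (m / 4) mod 4 | K2 => m / 16 end.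
Definition scale (i : stk) : nat := match i with K0 => 1 | K1 => 4 | K2 => 16 end.

(* Consumed input cells hold the marker 4; later the output overwrites the
   cells from 0 on and is terminated by a 4. *)
Definition repio (o : io) (t : Z -> nat) : Prop :=
  match o with
  | Reading c l =>
      (forall j, j < c -> t (Z.of_nat j) = 4) /\
      (forall j, t (Z.of_nat (c + j)) = nth j (map code l) 0)
  | Writing o =>
      (forall j, j < length o -> t (Z.of_nat j) = sym (nth j o false)) /\
      t (Z.of_nat (length o)) = 4 /\
      (forall j, t (Z.of_nat j) <= 4)
  end.

Definition rep (s : mst) (t : Z -> nat) : Prop :=
  t (-1)%Z = 5 /\ (forall j, t (-2 - Z.of_nat j)%Z = 6 * cell s j) /\ repio (port s) t.

Lemma digit_lt l j : digit l j < 4.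
Proof.
  unfold digit. generalize (rev l); intros m; revert j.
  induction m as [|a m IH]; intros [|j]; simpl; try lia; [destruct a; simpl; lia|apply IH].
Qed.

Lemma digit_pos l j : j < length l -> 0 < digit l j.
Proof.
  unfold digit. rewrite <- length_rev. generalize (rev l); intros m; revert j.
  induction m as [|a m IH]; intros [|j]; simpl; try lia.
  - destruct a; simpl; lia.
  - intros; apply IH; lia.
Qed.

Lemma digit_out l j : length l <= j -> digit l j = 0.
Proof. intros. unfold digit. apply nth_overflow. rewrite length_map, length_rev. lia. Qed.

Lemma digit_top a l : digit (a :: l) (length l) = code a.
Proof.
  unfold digit. simpl. rewrite map_app, app_nth2; rewrite length_map, length_rev; [|lia].
  now rewrite Nat.sub_diag.
Qed.

Lemma digit_below a l j : j <> length l -> digit (a :: l) j = digit l j.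
Proof.
  intros H. destruct (Nat.lt_ge_cases j (length l)).
  - unfold digit. simpl. rewrite map_app, app_nth1; [easy|]. rewrite length_map, length_rev. lia.
  - rewrite !digit_out; simpl; lia.
Qed.

Lemma dig_cell i s j : dig i (cell s j) = digit (get s i) j.
Proof.
  assert (H : forall x y z, x < 4 -> y < 4 -> z < 4 ->
    dig i (x + 4 * y + 16 * z) = match i with K0 => x | K1 => y | K2 => z end).
  { intros x y z Hx Hy Hz. destruct i; unfold dig.
    - symmetry. apply (Nat.mod_unique _ _ (y + 4 * z)); lia.
    - replace ((x + 4 * y + 16 * z) / 4) with (y + 4 * z) by (apply (Nat.div_unique _ _ _ x); lia).
      symmetry. apply (Nat.mod_unique _ _ z); lia.
    - symmetry. apply (Nat.div_unique _ _ _ (x + 4 * y)); lia. }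
  unfold cell. rewrite H by apply digit_lt. now destruct i.
Qed.

Lemma cell_lt s j : cell s j < 64.
Proof.
  unfold cell. pose proof (digit_lt (d0 s) j). pose proof (digit_lt (d1 s) j).
  pose proof (digit_lt (d2 s) j). lia.
Qed.

Lemma cell_put_other s i l j : digit l j = digit (get s i) j -> cell (put s i l) j = cell s j.
Proof. destruct i; unfold cell; simpl; lia. Qed.

Lemma cell_put s i l j :
  cell (put s i l) j + scale i * digit (get s i) j = cell s j + scale i * digit l j.
Proof. destruct i; unfold cell; simpl; lia. Qed.

Lemma nth_code_le l j : nth j (map code l) 0 <= 3.
Proof.
  revert j. induction l as [|a l IH]; intros [|j]; simpl; try lia; [destruct a; simpl; lia|apply IH].
Qed.

Lemma repio_le o t j : repio o t -> t (Z.of_nat j) <= 4.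
Proof.
  destruct o as [c l|o]; simpl.
  - intros [H1 H2]. destruct (Nat.lt_ge_cases j c); [rewrite H1; lia|].
    replace j with (c + (j - c)) by lia. rewrite H2. pose proof (nth_code_le l (j - c)). lia.
  - intros (_ & _ & H). apply H.
Qed.

Lemma rep_ext s t t' : (forall z, t' z = t z) -> rep s t -> rep s t'.
Proof.
  intros E (H1 & H2 & H3). split; [|split].
  - now rewrite E.
  - intros j. now rewrite E.
  - destruct (port s); simpl in *.
    + destruct H3 as [H3 H4]. split; intros; rewrite E; auto.
    + destruct H3 as (H3 & H4 & H5). repeat split; intros; rewrite E; auto.
Qed.

(** Makes a finite transition table possible: 384 = 6 * 64 is the alphabet size of [machine]. *)
Lemma rep_lt s t z : rep s t -> t z < 384.
Proof.
  intros (H1 & H2 & H3). destruct (Z.lt_ge_cases z 0).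
  - destruct (Z.eq_dec z (-1)) as [->|]; [lia|].
    replace z with (-2 - Z.of_nat (Z.to_nat (-2 - z)))%Z by lia. rewrite H2.
    pose proof (cell_lt s (Z.to_nat (-2 - z))). lia.
  - replace z with (Z.of_nat (Z.to_nat z)) by lia.
    pose proof (repio_le _ _ (Z.to_nat z) H3). lia.
Qed.

(* Every instruction is entered and left with the head at home. *)
Definition push_code (i : stk) (a : sy) (q n q' c : nat) : option (nat * nat * move) :=
  if q' =? q then
    if c =? 5 then Some (q, c, MvL)
    else if dig i (c / 6) =? 0 then Some (S q, c + 6 * (scale i * code a), MvR)
    else Some (q, c, MvL)
  else if c =? 5 then Some (n, c, MvS) else Some (S q, c, MvR).

(** The first 4 to the right of home marks the end of the output so far, and is cell 0 if nothing
    has been written. The bit replaces it and a new 4 follows. *)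
Definition emit_code (b : bool) (q n q' c : nat) : option (nat * nat * move) :=
  if q' =? q then
    if c =? 4 then Some (S q, sym b, MvR) else Some (q, c, MvR)
  else if q' =? S q then Some (S (S q), 4, MvL)
  else if c =? 5 then Some (n, c, MvS) else Some (S (S q), c, MvL).

(* States: [q] seeks the top of the source, [S q] sits on it, and
   [q + 1 + code a] carries the popped symbol [a] home. *)
Definition back_code (m : move) (q : nat) (tgt : sy -> nat) (q' c : nat) :
    option (nat * nat * move) :=
  if c =? 5 then
    Some (tgt (if q' =? q + 2 then Lf else if q' =? q + 3 then Nd else En), c, MvS)
  else Some (q', c, m).

Definition pop_code (x : src) (q : nat) (tgt : sy -> nat) (q' c : nat) :
    option (nat * nat * move) :=
  match x with
  | Stk i =>
      if q' =? q then
        if c =? 5 then Some (q, c, MvL)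
        else if dig i (c / 6) =? 0 then Some (S q, c, MvR) else Some (q, c, MvL)
      else if q' =? S q then
        if c =? 5 then None
        else Some (q + 1 + dig i (c / 6), c - 6 * (scale i * dig i (c / 6)), MvR)
      else back_code MvR q tgt q' c
  | Inp =>
      if q' =? q then
        if (c =? 5) || (c =? 4) then Some (q, c, MvR)
        else if c =? 0 then None else Some (q + 1 + c, 4, MvL)
      else back_code MvL q tgt q' c
  end.

Fixpoint states (p : prog) : nat :=
  match p with
  | Push _ _ => 2
  | Emit _ => 3
  | Seq p q => states p + states q
  | Case _ b | Loop _ _ b => 5 + states (b Lf) + states (b Nd) + states (b En)
  end.

Definition branch (b : sy -> prog) (q : nat) (a : sy) : nat :=
  match a with
  | Lf => q + 5
  | Nd => q + 5 + states (b Lf)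
  | En => q + 5 + states (b Lf) + states (b Nd)
  end.

(** [p] owns the [states p] states from [q] on and hands over to [n]; the branches of a loop hand
    over to [q], the start of the loop. *)
Fixpoint comp (p : prog) (q n q' c : nat) : option (nat * nat * move) :=
  match p with
  | Push i a => push_code i a q n q' c
  | Emit b => emit_code b q n q' c
  | Seq p1 p2 =>
      if q' <? q + states p1 then comp p1 q (q + states p1) q' c
      else comp p2 (q + states p1) n q' c
  | Case x b =>
      if q' <? branch b q Lf then pop_code x q (branch b q) q' c
      else if q' <? branch b q Nd then comp (b Lf) (branch b q Lf) n q' c
      else if q' <? branch b q En then comp (b Nd) (branch b q Nd) n q' c
      else comp (b En) (branch b q En) n q' c
  | Loop x ex b =>
      if q' <? branch b q Lf then
        pop_code x q (fun a => if ex a then n else branch b q a) q' c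
      else if q' <? branch b q Nd then comp (b Lf) (branch b q Lf) q q' c
      else if q' <? branch b q En then comp (b Nd) (branch b q Nd) q q' c
      else comp (b En) (branch b q En) q q' c
  end.

Inductive steps (M : TM) : nat -> config -> config -> Prop :=
| steps_O c : steps M 0 c c
| steps_S m c c1 c2 : step M c = Some c1 -> steps M m c1 c2 -> steps M (S m) c c2.

Lemma steps_trans M m m' c c1 c2 :
  steps M m c c1 -> steps M m' c1 c2 -> steps M (m + m') c c2.
Proof. induction 1; simpl; eauto using steps. Qed.

Lemma exec_halted M m c : halted M c -> exec M m c = c.
Proof. unfold halted. intros H. destruct m; simpl; [easy|]. now rewrite H. Qed.

Lemma steps_exec_halted M m T c c' :
  steps M m c c' -> halted M c' -> m <= T -> exec M T c = c'.
Proof.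
  intros H Hh. revert T. induction H; intros T HT.
  - now apply exec_halted.
  - destruct T; [lia|]. simpl. rewrite H. apply IHsteps; [easy|lia].
Qed.

Definition upd (t : Z -> nat) (h : Z) (b : nat) : Z -> nat :=
  fun z => if Z.eqb z h then b else t z.

Lemma step_lookup M q h t q' b m :
  lookup M q (t h) = Some (q', b, m) ->
  step M (Cfg q h t) = Some (Cfg q' (h + mv m)%Z (upd t h b)).
Proof. intros H. unfold step. simpl. now rewrite H. Qed.

Lemma walk M q m k h t :
  (forall j, j < k -> lookup M q (t (h + Z.of_nat j * mv m)%Z) =
                      Some (q, t (h + Z.of_nat j * mv m)%Z, m)) ->
  exists t', steps M k (Cfg q h t) (Cfg q (h + Z.of_nat k * mv m)%Z t') /\
             forall z, t' z = t z.
Proof.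
  revert h t. induction k as [|k IH]; intros h t H.
  - exists t. split; [|easy]. simpl. rewrite Z.add_0_r. constructor.
  - pose proof (H 0 ltac:(lia)) as H0. simpl in H0. rewrite Z.add_0_r in H0.
    assert (E : forall z, upd t h (t h) z = t z).
    { intros z. unfold upd. destruct (Z.eqb_spec z h); congruence. }
    destruct (IH (h + mv m)%Z (upd t h (t h))) as (t' & Hs & Ht).
    + intros j Hj. rewrite E. specialize (H (S j) ltac:(lia)).
      replace (h + mv m + Z.of_nat j * mv m)%Z with (h + Z.of_nat (S j) * mv m)%Z by lia.
      exact H.
    + exists t'. split.
      * replace (h + Z.of_nat (S k) * mv m)%Z with (h + mv m + Z.of_nat k * mv m)%Z by lia.
        econstructor; [|exact Hs]. now apply step_lookup.
      * intros z. now rewrite Ht.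
Qed.

Lemma mul6_div c : 6 * c / 6 = c.
Proof. rewrite Nat.mul_comm. now apply Nat.div_mul. Qed.

Lemma mul6_ne5 c : (6 * c =? 5) = false.
Proof. apply Nat.eqb_neq. lia. Qed.

Lemma upd_same t h b : upd t h b h = b.
Proof. unfold upd. now rewrite Z.eqb_refl. Qed.

Lemma upd_other t h b z : z <> h -> upd t h b z = t z.
Proof. intros. unfold upd. now destruct (Z.eqb_spec z h). Qed.

Lemma rep_home s t : rep s t -> t (-1)%Z = 5.
Proof. now intros []. Qed.

Lemma rep_cell s t j : rep s t -> t (-2 - Z.of_nat j)%Z = 6 * cell s j.
Proof. intros (_ & H & _). apply H. Qed.

Lemma repio_local o t t' : (forall j, t' (Z.of_nat j) = t (Z.of_nat j)) -> repio o t -> repio o t'.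
Proof.
  intros E. destruct o; simpl; intros H; decompose [and] H; repeat split; intros; rewrite E; auto.
Qed.

(** The head walks left to the first zero digit of track [i], just beyond the top of the stack,
    writes there and returns: 2 h + 3 moves for height h. *)
Lemma push_sim M i a q n s t :
  (forall q' c, q <= q' < q + 2 -> c < 384 -> lookup M q' c = push_code i a q n q' c) ->
  rep s t ->
  exists t', steps M (2 * length (get s i) + 3) (Cfg q (-1) t) (Cfg n (-1) t') /\
             rep (put s i (a :: get s i)) t'.
Proof.
  intros HM Hr. set (h := length (get s i)).
  destruct (walk M q MvL (S h) (-1) t) as (t1 & W1 & E1).
  { intros j Hj. rewrite HM by (try lia; eapply rep_lt; eauto). unfold push_code.
    rewrite Nat.eqb_refl. simpl mv. destruct j as [|j].
    - simpl. now rewrite (rep_home _ _ Hr).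
    - replace (-1 + Z.of_nat (S j) * -1)%Z with (-2 - Z.of_nat j)%Z by lia.
      rewrite (rep_cell _ _ _ Hr), mul6_ne5, mul6_div, dig_cell.
      pose proof (digit_pos (get s i) j ltac:(lia)).
      now destruct (Nat.eqb_spec (digit (get s i) j) 0); [lia|]. }
  simpl mv in W1. replace (-1 + Z.of_nat (S h) * -1)%Z with (-2 - Z.of_nat h)%Z in W1 by lia.
  set (v := 6 * cell s h + 6 * (scale i * code a)).
  set (t2 := upd t1 (-2 - Z.of_nat h) v).
  assert (S2 : step M (Cfg q (-2 - Z.of_nat h) t1) = Some (Cfg (S q) (-1 - Z.of_nat h) t2)).
  { replace (-1 - Z.of_nat h)%Z with (-2 - Z.of_nat h + mv MvR)%Z by (simpl mv; lia).
    apply step_lookup. rewrite E1. rewrite HM by (try lia; eapply rep_lt; eauto).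
    unfold push_code. rewrite Nat.eqb_refl, (rep_cell _ _ _ Hr), mul6_ne5, mul6_div, dig_cell.
    rewrite digit_out by (unfold h; lia). reflexivity. }
  assert (H2 : rep (put s i (a :: get s i)) t2).
  { destruct Hr as (R1 & R2 & R3). split; [|split].
    - unfold t2. rewrite upd_other by lia. now rewrite E1.
    - intros j. unfold t2. destruct (Nat.eq_dec j h) as [->|Hj].
      + rewrite upd_same. unfold v.
        pose proof (cell_put s i (a :: get s i) h) as C. unfold h in C at 2 4.
        rewrite digit_top, digit_out in C by lia. lia.
      + rewrite upd_other by lia. rewrite E1, R2. f_equal. symmetry. apply cell_put_other.
        now apply digit_below.
    - replace (port (put s i (a :: get s i))) with (port s) by now destruct i.
      eapply repio_local; [|exact R3]. intros j. unfold t2. rewrite upd_other by lia. apply E1. }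
  destruct (walk M (S q) MvR h (-1 - Z.of_nat h) t2) as (t3 & W3 & E3).
  { intros j Hj. rewrite HM by (try lia; eapply rep_lt; eauto). unfold push_code.
    destruct (Nat.eqb_spec (S q) q); [lia|]. simpl mv.
    replace (-1 - Z.of_nat h + Z.of_nat j * 1)%Z with (-2 - Z.of_nat (h - j - 1))%Z by lia.
    now rewrite (rep_cell _ _ _ H2), mul6_ne5. }
  simpl mv in W3. replace (-1 - Z.of_nat h + Z.of_nat h * 1)%Z with (-1)%Z in W3 by lia.
  set (t4 := upd t3 (-1) 5).
  assert (S4 : step M (Cfg (S q) (-1) t3) = Some (Cfg n (-1) t4)).
  { change (-1)%Z with (-1 + mv MvS)%Z at 2. apply step_lookup.
    rewrite E3, (rep_home _ _ H2). rewrite HM by lia. unfold push_code.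
    now destruct (Nat.eqb_spec (S q) q); [lia|]. }
  exists t4. split.
  - replace (2 * h + 3) with (S h + (1 + (h + 1))) by lia.
    eapply steps_trans; [exact W1|]. simpl. econstructor; [exact S2|].
    eapply steps_trans; [exact W3|]. econstructor; [exact S4|constructor].
  - eapply rep_ext; [|exact H2]. intros z. unfold t4, upd.
    destruct (Z.eqb_spec z (-1)); [subst; symmetry; eapply rep_home; eauto|apply E3].
Qed.

Lemma back_code_home m q tgt a :
  back_code m q tgt (q + 1 + code a) 5 = Some (tgt a, 5, MvS).
Proof.
  unfold back_code. simpl. destruct a; simpl; repeat f_equal.
  - now replace (q + 1 + 1) with (q + 2) by lia; rewrite Nat.eqb_refl.
  - replace (q + 1 + 2) with (q + 3) by lia. rewrite Nat.eqb_refl.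
    now destruct (Nat.eqb_spec (q + 3) (q + 2)); [lia|].
  - destruct (Nat.eqb_spec (q + 1 + 3) (q + 2)); [lia|].
    now destruct (Nat.eqb_spec (q + 1 + 3) (q + 3)); [lia|].
Qed.

Lemma pop_code_back x q tgt a c :
  pop_code x q tgt (q + 1 + code a) c =
  back_code (match x with Stk _ => MvR | Inp => MvL end) q tgt (q + 1 + code a) c.
Proof.
  unfold pop_code. destruct (Nat.eqb_spec (q + 1 + code a) q); [lia|].
  destruct (Nat.eqb_spec (q + 1 + code a) (S q)); [destruct a; simpl in *; lia|].
  now destruct x.
Qed.

Lemma pop_back M x q tgt a h z t s :
  let m := match x with Stk _ => MvR | Inp => MvL end in
  (forall q' c, q <= q' < q + 5 -> c < 384 -> lookup M q' c = pop_code x q tgt q' c) ->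
  rep s t ->
  (z + Z.of_nat h * mv m = -1)%Z ->
  (forall j, j < h -> t (z + Z.of_nat j * mv m)%Z <> 5) ->
  exists t', steps M (h + 1) (Cfg (q + 1 + code a) z t) (Cfg (tgt a) (-1) t') /\ rep s t'.
Proof.
  intros m HM Hr Hz Hj.
  assert (Ha : code a <= 3) by (destruct a; simpl; lia).
  destruct (walk M (q + 1 + code a) m h z t) as (t3 & W3 & E3).
  { intros j Hj'. rewrite HM by (try lia; eapply rep_lt; eauto).
    rewrite pop_code_back. unfold back_code. specialize (Hj _ Hj').
    now destruct (Nat.eqb_spec (t (z + Z.of_nat j * mv m)%Z) 5). }
  rewrite Hz in W3.
  exists (upd t3 (-1) 5). split.
  - eapply steps_trans; [exact W3|]. econstructor; [|constructor].
    change (-1)%Z with (-1 + mv MvS)%Z at 2. apply step_lookup.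
    rewrite E3, (rep_home _ _ Hr). rewrite HM by lia.
    now rewrite pop_code_back, back_code_home.
  - eapply rep_ext; [|exact Hr]. intros y. unfold upd.
    destruct (Z.eqb_spec y (-1)); [subst; symmetry; eapply rep_home; eauto|apply E3].
Qed.

Lemma pop_sim M x q tgt s t a s' :
  (forall q' c, q <= q' < q + 5 -> c < 384 -> lookup M q' c = pop_code x q tgt q' c) ->
  rep s t -> pop x s = Some (a, s') ->
  exists m t', steps M m (Cfg q (-1) t) (Cfg (tgt a) (-1) t') /\ rep s' t' /\
               m <= 2 * weight s + 5.
Proof.
  intros HM Hr. destruct x as [i|]; simpl pop.
  - destruct (get s i) as [|a' l] eqn:G; [discriminate|]. intros [= -> <-].
    set (h := length l).
    destruct (walk M q MvL (S (S h)) (-1) t) as (t1 & W1 & E1).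
    { intros j Hj. rewrite HM by (try lia; eapply rep_lt; eauto). unfold pop_code.
      rewrite Nat.eqb_refl. simpl mv. destruct j as [|j].
      - simpl. now rewrite (rep_home _ _ Hr).
      - replace (-1 + Z.of_nat (S j) * -1)%Z with (-2 - Z.of_nat j)%Z by lia.
        rewrite (rep_cell _ _ _ Hr), mul6_ne5, mul6_div, dig_cell.
        pose proof (digit_pos (get s i) j ltac:(rewrite G; simpl; lia)).
        now destruct (Nat.eqb_spec (digit (get s i) j) 0); [lia|]. }
    simpl mv in W1.
    replace (-1 + Z.of_nat (S (S h)) * -1)%Z with (-2 - Z.of_nat (S h))%Z in W1 by lia.
    set (t2 := upd t1 (-2 - Z.of_nat (S h)) (t1 (-2 - Z.of_nat (S h))%Z)).
    assert (S2 : step M (Cfg q (-2 - Z.of_nat (S h)) t1) = Some (Cfg (S q) (-2 - Z.of_nat h) t2)).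
    { replace (-2 - Z.of_nat h)%Z with (-2 - Z.of_nat (S h) + mv MvR)%Z by (simpl mv; lia).
      apply step_lookup. rewrite E1. rewrite HM by (try lia; eapply rep_lt; eauto).
      unfold pop_code. rewrite Nat.eqb_refl, (rep_cell _ _ _ Hr), mul6_ne5, mul6_div, dig_cell.
      rewrite digit_out by (rewrite G; simpl; unfold h; lia). reflexivity. }
    assert (E2 : forall z, t2 z = t z).
    { intros z. unfold t2, upd. rewrite <- (E1 z).
      destruct (Z.eqb_spec z (-2 - Z.of_nat (S h))); congruence. }
    assert (C : cell (put s i l) h + scale i * code a = cell s h).
    { pose proof (cell_put s i l h) as C. rewrite G in C. unfold h in C at 2 4.
      rewrite digit_top, digit_out in C by lia. lia. }
    set (t3 := upd t2 (-2 - Z.of_nat h) (6 * cell s h - 6 * (scale i * code a))).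
    assert (S3 : step M (Cfg (S q) (-2 - Z.of_nat h) t2) =
                 Some (Cfg (q + 1 + code a) (-1 - Z.of_nat h) t3)).
    { replace (-1 - Z.of_nat h)%Z with (-2 - Z.of_nat h + mv MvR)%Z by (simpl mv; lia).
      apply step_lookup. rewrite E2. rewrite HM by (try lia; eapply rep_lt; eauto).
      unfold pop_code. destruct (Nat.eqb_spec (S q) q); [lia|].
      rewrite Nat.eqb_refl, (rep_cell _ _ _ Hr), mul6_ne5, mul6_div, dig_cell.
      rewrite G. replace (digit (a :: l) h) with (code a) by (symmetry; apply digit_top). reflexivity. }
    assert (H3 : rep (put s i l) t3).
    { destruct Hr as (R1 & R2 & R3). split; [|split].
      - unfold t3. rewrite upd_other by lia. now rewrite E2.
      - intros j. unfold t3. destruct (Nat.eq_dec j h) as [->|Hj].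
        + rewrite upd_same. lia.
        + rewrite upd_other by lia. rewrite E2, R2. f_equal. symmetry. apply cell_put_other.
          rewrite G. symmetry. now apply digit_below.
      - replace (port (put s i l)) with (port s) by now destruct i.
        eapply repio_local; [|exact R3]. intros j. unfold t3. rewrite upd_other by lia. apply E2. }
    destruct (pop_back M (Stk i) q tgt a h (-1 - Z.of_nat h) t3 (put s i l) HM H3) as (t4 & W4 & H4).
    { simpl mv. lia. }
    { intros j Hj. simpl mv.
      replace (-1 - Z.of_nat h + Z.of_nat j * 1)%Z with (-2 - Z.of_nat (h - j - 1))%Z by lia.
      rewrite (rep_cell _ _ _ H3). lia. }
    exists (S (S h) + (S (S (h + 1)))), t4. split; [|split; [easy|]].
    + eapply steps_trans; [exact W1|]. econstructor; [exact S2|]. econstructor; [exact S3|exact W4].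
    + pose proof (weight_put s i []) as Hw. rewrite G in Hw. simpl in Hw. fold h in Hw. lia.
  - destruct (port s) as [c [|a' l]|] eqn:P; try discriminate. intros [= -> <-].
    assert (R3 := proj2 (proj2 Hr)). rewrite P in R3. simpl in R3. destruct R3 as [R3 R4].
    assert (Ha : 1 <= code a <= 3) by (destruct a; simpl; lia).
    destruct (walk M q MvR (S c) (-1) t) as (t1 & W1 & E1).
    { intros j Hj. rewrite HM by (try lia; eapply rep_lt; eauto). unfold pop_code.
      rewrite Nat.eqb_refl. simpl mv. destruct j as [|j].
      - simpl. now rewrite (rep_home _ _ Hr).
      - replace (-1 + Z.of_nat (S j) * 1)%Z with (Z.of_nat j) by lia.
        rewrite R3 by lia. reflexivity. }
    simpl mv in W1. replace (-1 + Z.of_nat (S c) * 1)%Z with (Z.of_nat c) in W1 by lia.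
    set (t2 := upd t1 (Z.of_nat c) 4).
    assert (S2 : step M (Cfg q (Z.of_nat c) t1) =
                 Some (Cfg (q + 1 + code a) (Z.of_nat c - 1) t2)).
    { replace (Z.of_nat c - 1)%Z with (Z.of_nat c + mv MvL)%Z by (simpl mv; lia).
      apply step_lookup. rewrite E1. rewrite HM by (try lia; eapply rep_lt; eauto).
      unfold pop_code. rewrite Nat.eqb_refl. specialize (R4 0). rewrite Nat.add_0_r in R4.
      rewrite R4. simpl nth. destruct a; reflexivity. }
    set (s' := Mst (d0 s) (d1 s) (d2 s) (Reading (S c) l)).
    assert (H2 : rep s' t2).
    { destruct Hr as (Q1 & Q2 & _). split; [|split].
      - unfold t2. rewrite upd_other by lia. now rewrite E1.
      - intros j. unfold t2. rewrite upd_other by lia. rewrite E1. apply Q2.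
      - simpl. unfold t2. split; intros j.
        + intros Hj. destruct (Nat.eq_dec j c) as [->|]; [now rewrite upd_same|].
          rewrite upd_other by lia. rewrite E1. apply R3. lia.
        + rewrite upd_other by lia. rewrite E1. specialize (R4 (S j)).
          replace (c + S j) with (S (c + j)) in R4 by lia. exact R4. }
    destruct (pop_back M Inp q tgt a c (Z.of_nat c - 1) t2 s' HM H2) as (t4 & W4 & H4).
    { simpl mv. lia. }
    { intros j Hj. simpl mv.
      replace (Z.of_nat c - 1 + Z.of_nat j * -1)%Z with (Z.of_nat (c - 1 - j)) by lia.
      rewrite (proj1 (proj2 (proj2 H2))) by lia. lia. }
    exists (S c + S (c + 1)), t4. split; [|split; [easy|]].
    + eapply steps_trans; [exact W1|]. econstructor; [exact S2|exact W4].
    + unfold weight. rewrite P. lia.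
Qed.

Lemma emit_sim M b q n s t s' :
  (forall q' c, q <= q' < q + 3 -> c < 384 -> lookup M q' c = emit_code b q n q' c) ->
  rep s t -> emit b s = Some s' ->
  exists m t', steps M m (Cfg q (-1) t) (Cfg n (-1) t') /\ rep s' t' /\
               m <= 2 * weight s + 5.
Proof.
  intros HM Hr He.
  set (o := match port s with Reading _ _ => [] | Writing o => o end).
  assert (Hs' : s' = Mst (d0 s) (d1 s) (d2 s) (Writing (o ++ [b]))).
  { unfold emit in He. unfold o. destruct (port s) as [[|]|]; simpl in *; congruence. }
  assert (R : (forall j, j < length o -> t (Z.of_nat j) = sym (nth j o false)) /\
              t (Z.of_nat (length o)) = 4).
  { destruct Hr as (_ & _ & R). unfold emit in He. unfold o.
    destruct (port s) as [[|c] l|o']; simpl in *; try discriminate.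
    - split; [intros; lia|]. apply (proj1 R 0). lia.
    - tauto. }
  destruct R as [R3 R4].
  assert (Hle : forall j, t (Z.of_nat j) <= 4)
    by (intros j; eapply repio_le; exact (proj2 (proj2 Hr))).
  assert (Hw : length o <= weight s).
  { unfold o, weight. destruct (port s); simpl; lia. }
  set (h := length o) in *.
  destruct (walk M q MvR (S h) (-1) t) as (t1 & W1 & E1).
  { intros j Hj. rewrite HM by (try lia; eapply rep_lt; eauto). unfold emit_code.
    rewrite Nat.eqb_refl. simpl mv. destruct j as [|j].
    - simpl. now rewrite (rep_home _ _ Hr).
    - replace (-1 + Z.of_nat (S j) * 1)%Z with (Z.of_nat j) by lia.
      rewrite R3 by lia. now destruct (nth j o false). }
  simpl mv in W1. replace (-1 + Z.of_nat (S h) * 1)%Z with (Z.of_nat h) in W1 by lia.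
  set (t2 := upd t1 (Z.of_nat h) (sym b)).
  assert (S2 : step M (Cfg q (Z.of_nat h) t1) = Some (Cfg (S q) (Z.of_nat (S h)) t2)).
  { replace (Z.of_nat (S h)) with (Z.of_nat h + mv MvR)%Z by (simpl mv; lia).
    apply step_lookup. rewrite E1, R4, HM by lia. unfold emit_code. now rewrite Nat.eqb_refl. }
  set (t3 := upd t2 (Z.of_nat (S h)) 4).
  assert (S3 : step M (Cfg (S q) (Z.of_nat (S h)) t2) = Some (Cfg (S (S q)) (Z.of_nat h) t3)).
  { replace (Z.of_nat h) with (Z.of_nat (S h) + mv MvL)%Z by (simpl mv; lia).
    apply step_lookup. unfold t2. rewrite upd_other by lia. rewrite E1.
    rewrite HM by (try lia; eapply rep_lt; eauto). unfold emit_code.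
    destruct (Nat.eqb_spec (S q) q); [lia|]. now rewrite Nat.eqb_refl. }
  assert (H3 : rep s' t3).
  { rewrite Hs'. destruct Hr as (Q1 & Q2 & _). split; [|split].
    - unfold t3, t2. rewrite !upd_other by lia. now rewrite E1.
    - intros j. unfold t3, t2. rewrite !upd_other by lia. rewrite E1. apply Q2.
    - simpl. unfold t3, t2. rewrite length_app. simpl length. split; [|split].
      + intros j Hj. rewrite upd_other by lia. destruct (Nat.eq_dec j h) as [->|].
        * rewrite upd_same. rewrite app_nth2 by lia. now rewrite Nat.sub_diag.
        * rewrite upd_other by lia. rewrite E1, app_nth1 by lia. apply R3. lia.
      + replace (length o + 1) with (S h) by lia. now rewrite upd_same.
      + intros j. unfold upd. destruct (Z.eqb_spec (Z.of_nat j) (Z.of_nat (S h))); [lia|].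
        destruct (Z.eqb_spec (Z.of_nat j) (Z.of_nat h)); [destruct b; simpl; lia|].
        rewrite E1. apply Hle. }
  destruct (walk M (S (S q)) MvL (S h) (Z.of_nat h) t3) as (t4 & W4 & E4).
  { intros j Hj. rewrite HM by (try lia; eapply rep_lt; eauto). unfold emit_code.
    destruct (Nat.eqb_spec (S (S q)) q); [lia|].
    destruct (Nat.eqb_spec (S (S q)) (S q)); [lia|]. simpl mv.
    replace (Z.of_nat h + Z.of_nat j * -1)%Z with (Z.of_nat (h - j)) by lia.
    pose proof (repio_le _ _ (h - j) (proj2 (proj2 H3))).
    now destruct (Nat.eqb_spec (t3 (Z.of_nat (h - j))) 5); [lia|]. }
  simpl mv in W4. replace (Z.of_nat h + Z.of_nat (S h) * -1)%Z with (-1)%Z in W4 by lia.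
  set (t5 := upd t4 (-1) 5).
  assert (S5 : step M (Cfg (S (S q)) (-1) t4) = Some (Cfg n (-1) t5)).
  { change (-1)%Z with (-1 + mv MvS)%Z at 2. apply step_lookup.
    rewrite E4, (rep_home _ _ H3). rewrite HM by lia. unfold emit_code.
    destruct (Nat.eqb_spec (S (S q)) q); [lia|].
    now destruct (Nat.eqb_spec (S (S q)) (S q)); [lia|]. }
  exists (S h + S (S (S h + 1))), t5. split; [|split].
  - eapply steps_trans; [exact W1|]. econstructor; [exact S2|]. econstructor; [exact S3|].
    eapply steps_trans; [exact W4|]. econstructor; [exact S5|constructor].
  - eapply rep_ext; [|exact H3]. intros z. unfold t5, upd.
    destruct (Z.eqb_spec z (-1)); [subst; symmetry; eapply rep_home; eauto|apply E4].
  - lia.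
Qed.

(** [B] bounds the weight during the whole run, since a unit of time adds at most 1 to it; one
    instruction then takes at most 2 B + 5 moves. *)
Lemma run_sim p s t s' :
  run p s t s' ->
  forall M q n tape B,
  (forall q' c, q <= q' < q + states p -> c < 384 -> lookup M q' c = comp p q n q' c) ->
  rep s tape -> weight s + t <= B ->
  exists m tape', steps M m (Cfg q (-1) tape) (Cfg n (-1) tape') /\ rep s' tape' /\
                  m <= t * (2 * B + 5).
Proof.
  assert (Hbr : forall b q a, branch b q a + states (b a) <=
                 q + (5 + states (b Lf) + states (b Nd) + states (b En)))
    by (intros b q []; unfold branch; lia).
  (* On the states of one branch the table of the whole program is that of the branch. *)
  assert (Hsub : forall (b : sy -> prog) (q n : nat) a q' c (X : option (nat * nat * move)),
     branch b q a <= q' < branch b q a + states (b a) ->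
     (if q' <? branch b q Lf then X
      else if q' <? branch b q Nd then comp (b Lf) (branch b q Lf) n q' c
      else if q' <? branch b q En then comp (b Nd) (branch b q Nd) n q' c
      else comp (b En) (branch b q En) n q' c) = comp (b a) (branch b q a) n q' c).
  { intros b q n a q' c X Hq.
    destruct (Nat.ltb_spec q' (branch b q Lf)); [destruct a; simpl in *; lia|].
    destruct (Nat.ltb_spec q' (branch b q Nd)); [destruct a; simpl in *; try lia; reflexivity|].
    destruct (Nat.ltb_spec q' (branch b q En)); destruct a; simpl in *; try lia; reflexivity. }
  intros Hrun. induction Hrun; intros M q0 n tape B HM Hr HB; cbn [comp states] in HM.
  - destruct (push_sim M i a q0 n s tape HM Hr) as (t' & W & H).
    do 2 eexists; split; [exact W|]. split; [exact H|].
    pose proof (weight_put s i []). simpl in *. lia.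
  - destruct (emit_sim M b q0 n s tape s' HM Hr H) as (m & t' & W & H' & Hm).
    do 2 eexists; split; [exact W|]. split; [exact H'|]. lia.
  - destruct (IHHrun1 M q0 (q0 + states p) tape B) as (m1 & t1 & W1 & R1 & L1); [|easy|lia|].
    { intros q' c Hq Hc. rewrite HM by lia. now destruct (Nat.ltb_spec q' (q0 + states p)); [|lia]. }
    destruct (IHHrun2 M (q0 + states p) n t1 B) as (m2 & t2 & W2 & R2 & L2); [|easy| |].
    { intros q' c Hq Hc. rewrite HM by lia. now destruct (Nat.ltb_spec q' (q0 + states p)); [lia|]. }
    { apply run_weight in Hrun1. lia. }
    exists (m1 + m2), t2. split; [eapply steps_trans; eauto|]. split; [easy|]. nia.
  - destruct (pop_sim M x q0 (branch b q0) s tape a s') as (m1 & t1 & W1 & R1 & L1); try easy.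
    { intros q' c Hq Hc. rewrite HM by lia.
      destruct (Nat.ltb_spec q' (branch b q0 Lf)); [|simpl in *; lia]. reflexivity. }
    destruct (IHHrun M (branch b q0 a) n t1 B) as (m2 & t2 & W2 & R2 & L2); [|easy| |].
    { intros q' c Hq Hc. specialize (Hbr b q0 a). rewrite HM; [now apply Hsub| |easy].
      destruct a; simpl in *; lia. }
    { apply pop_weight in H. lia. }
    exists (m1 + m2), t2. split; [eapply steps_trans; eauto|]. split; [easy|]. nia.
  - destruct (pop_sim M x q0 (fun a => if ex a then n else branch b q0 a) s tape a s')
      as (m1 & t1 & W1 & R1 & L1); try easy.
    { intros q' c Hq Hc. rewrite HM by lia.
      now destruct (Nat.ltb_spec q' (branch b q0 Lf)); [|simpl in *; lia]. }
    rewrite H0 in W1. exists m1, t1. repeat split; try easy; try apply R1. nia.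
  - destruct (pop_sim M x q0 (fun a => if ex a then n else branch b q0 a) s tape a s')
      as (m1 & t1 & W1 & R1 & L1); try easy.
    { intros q' c Hq Hc. rewrite HM by lia.
      now destruct (Nat.ltb_spec q' (branch b q0 Lf)); [|simpl in *; lia]. }
    rewrite H0 in W1.
    destruct (IHHrun1 M (branch b q0 a) q0 t1 B) as (m2 & t2 & W2 & R2 & L2); [|easy| |].
    { intros q' c Hq Hc. specialize (Hbr b q0 a). rewrite HM; [now apply Hsub| |easy].
      destruct a; simpl in *; lia. }
    { apply pop_weight in H. lia. }
    destruct (IHHrun2 M q0 n t2 B HM R2) as (m3 & t3 & W3 & R3 & L3).
    { apply pop_weight in H. apply run_weight in Hrun1. lia. }
    exists (m1 + (m2 + m3)), t3. split; [|split; [easy|]].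
    + eapply steps_trans; [exact W1|]. eapply steps_trans; eauto.
    + nia.
  - destruct (IHHrun M q0 n tape B HM Hr ltac:(lia)) as (m1 & t1 & W1 & R1 & L1).
    exists m1, t1. repeat split; try easy; try apply R1. nia.
Qed.

Definition tabulate (Q A : nat) (f : nat -> nat -> option (nat * nat * move)) : TM :=
  flat_map (fun q => flat_map (fun a =>
    match f q a with Some (q', b, m) => [(q, a, q', b, m)] | None => [] end) (seq 0 A))
    (seq 0 Q).

Lemma lookup_app M M' q a :
  lookup (M ++ M') q a = match lookup M q a with Some r => Some r | None => lookup M' q a end.
Proof.
  induction M as [|[[[[q0 a0] q1] b] m] M IH]; simpl; [easy|].
  now destruct ((q =? q0) && (a =? a0))%bool.
Qed.

Lemma lookup_tabulate Q A f q a :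
  lookup (tabulate Q A f) q a = if (q <? Q) && (a <? A) then f q a else None.
Proof.
  assert (H1 : forall q' l, lookup (flat_map (fun a =>
    match f q' a with Some (q'', b, m) => [(q', a, q'', b, m)] | None => [] end) l) q a =
    if (q =? q') && existsb (Nat.eqb a) l then f q a else None).
  { intros q' l. induction l as [|a' l IH]; simpl; [now rewrite andb_false_r|].
    rewrite lookup_app, IH. destruct (Nat.eqb_spec q q') as [->|Hq]; simpl.
    - destruct (f q' a') as [[[q'' b] m]|] eqn:E; simpl.
      + rewrite Nat.eqb_refl. simpl. destruct (Nat.eqb_spec a a') as [->|]; simpl; congruence.
      + destruct (Nat.eqb_spec a a') as [->|]; simpl; [|easy].
        rewrite E. now destruct (existsb _ l).
    - destruct (f q' a') as [[[q'' b] m]|]; simpl; [|easy].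
      now destruct (Nat.eqb_spec q q'). }
  unfold tabulate.
  assert (H2 : forall l, lookup (flat_map (fun q => flat_map (fun a =>
    match f q a with Some (q', b, m) => [(q, a, q', b, m)] | None => [] end) (seq 0 A)) l) q a =
    if existsb (Nat.eqb q) l && existsb (Nat.eqb a) (seq 0 A) then f q a else None).
  { induction l as [|q' l IH]; simpl; [easy|]. rewrite lookup_app, H1, IH.
    destruct (q =? q'); simpl; [|easy]. destruct (existsb (Nat.eqb a) (seq 0 A)); simpl.
    - destruct (f q a); [easy|]. now destruct (existsb _ l).
    - now rewrite andb_false_r. }
  rewrite H2.
  assert (H3 : forall n x, existsb (Nat.eqb x) (seq 0 n) = (x <? n)).
  { intros n x. destruct (Nat.ltb_spec x n) as [H|H].
    - apply existsb_exists. exists x. rewrite in_seq. split; [lia|apply Nat.eqb_refl].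
    - destruct (existsb (Nat.eqb x) (seq 0 n)) eqn:E; [|easy].
      apply existsb_exists in E. destruct E as (y & Hy & E). apply in_seq in Hy.
      apply Nat.eqb_eq in E. lia. }
  now rewrite !H3.
Qed.

(* The first two states move the head off the input and plant the home marker. *)
Definition machine (p : prog) : TM :=
  tabulate (2 + states p) 384 (fun q c =>
    match q with
    | 0 => Some (1, c, MvL)
    | 1 => Some (2, 5, MvS)
    | _ => comp p 2 (2 + states p) q c
    end).

(** The stacks start empty, so B = t is possible in [run_sim]: t (2 t + 5) moves, and 2 more for
    planting the home marker. *)
Lemma machine_run p l t s0 s1 s2 o :
  run p (Mst [] [] [] (Reading 0 l)) t (Mst s0 s1 s2 (Writing o)) ->
  forall T len, 2 + t * (2 * t + 5) <= T ->
  halted (machine p) (exec (machine p) T (init (map code l))) /\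
  output (exec (machine p) T (init (map code l))) len T = o.
Proof.
  intros Hrun T len HT.
  set (t0 := tp (init (map code l))).
  set (t1 := upd t0 0 (t0 0%Z)).
  set (t2 := upd t1 (-1) 5).
  assert (E0 : forall j, t0 (Z.of_nat j) = nth j (map code l) 0).
  { intros j. unfold t0. simpl. destruct (Z.ltb_spec (Z.of_nat j) 0); [lia|].
    now rewrite Nat2Z.id. }
  assert (E1 : forall z, t1 z = t0 z).
  { intros z. unfold t1, upd. now destruct (Z.eqb_spec z 0); subst. }
  assert (Eneg : forall z, (z < 0)%Z -> t0 z = 0).
  { intros z Hz. unfold t0. simpl. now destruct (Z.ltb_spec z 0); [|lia]. }
  assert (S1 : step (machine p) (init (map code l)) = Some (Cfg 1 (-1) t1)).
  { unfold init. fold t0. change (-1)%Z with (0 + mv MvL)%Z. apply step_lookup.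
    unfold machine. rewrite lookup_tabulate. simpl.
    assert (H : nth 0 (map code l) 0 <= 3) by apply nth_code_le.
    change (t0 0%Z) with (t0 (Z.of_nat 0)). rewrite E0.
    now destruct (Nat.ltb_spec (nth 0 (map code l) 0) 384); [|lia]. }
  assert (S2 : step (machine p) (Cfg 1 (-1) t1) = Some (Cfg 2 (-1) t2)).
  { change (-1)%Z with (-1 + mv MvS)%Z at 2. apply step_lookup.
    unfold machine. rewrite lookup_tabulate. rewrite E1, Eneg by lia. reflexivity. }
  assert (R : rep (Mst [] [] [] (Reading 0 l)) t2).
  { split; [apply upd_same|]. split.
    - intros j. unfold t2. rewrite upd_other by lia. rewrite E1, Eneg by lia.
      unfold cell, digit. simpl. now destruct j.
    - simpl. split; [intros; lia|]. intros j. unfold t2. rewrite upd_other by lia.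
      now rewrite E1, E0. }
  destruct (run_sim _ _ _ _ Hrun (machine p) 2 (2 + states p) t2 t) as (m & t3 & W & R3 & Hm).
  { intros q' c Hq Hc. unfold machine. rewrite lookup_tabulate.
    destruct (Nat.ltb_spec q' (2 + states p)); [|lia].
    destruct (Nat.ltb_spec c 384); [|lia]. cbn [andb].
    destruct q' as [|[|q']]; [lia|lia|reflexivity]. }
  { exact R. }
  { unfold weight. simpl. lia. }
  (* The exit state lies beyond the table. *)
  assert (Hh : halted (machine p) (Cfg (2 + states p) (-1) t3)).
  { unfold halted, step, machine. cbn [st]. rewrite lookup_tabulate.
    destruct (Nat.ltb_spec (2 + states p) (2 + states p)); [lia|]. reflexivity. }
  assert (E : exec (machine p) T (init (map code l)) = Cfg (2 + states p) (-1) t3).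
  { eapply (steps_exec_halted _ (S (S m))); [|exact Hh|lia].
    econstructor; [exact S1|]. econstructor; [exact S2|exact W]. }
  rewrite E. split; [exact Hh|].
  unfold output. cbn [tp].
  destruct R3 as (_ & _ & R3). cbn [port repio] in R3. destruct R3 as (R3 & R4 & _).
  apply run_weight in Hrun. unfold weight in Hrun. simpl in Hrun.
  assert (Hf : length o < len + 2 * T + 2) by nia. revert Hf. generalize (len + 2 * T + 2) as f.
  (* [read_bits] stops at the 4 behind the last written bit. *)
  assert (G : forall o' i f, (forall j, j < length o' -> t3 (i + Z.of_nat j)%Z = sym (nth j o' false)) ->
     t3 (i + Z.of_nat (length o'))%Z = 4 -> length o' < f -> read_bits t3 i f = o').
  { induction o' as [|b o' IH]; intros i f H1 H2 Hf; (destruct f; [simpl in Hf; lia|]); simpl.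
    - simpl in H2. rewrite Z.add_0_r in H2. now rewrite H2.
    - pose proof (H1 0 ltac:(simpl; lia)) as H0. simpl in H0. rewrite Z.add_0_r in H0. rewrite H0.
      assert (IH' : read_bits t3 (i + 1) f = o').
      { apply IH; [| |simpl in Hf; lia].
        - intros j Hj. replace (i + 1 + Z.of_nat j)%Z with (i + Z.of_nat (S j))%Z by lia.
          apply (H1 (S j)). simpl. lia.
        - simpl in H2. rewrite <- H2. f_equal. lia. }
      rewrite IH'. now destruct b. }
  intros f Hf. apply G; simpl; auto.
Qed.

Open Scope nat_scope.

(** * Polynomial bounds *)

(** One constant serves as coefficient and as exponent, as in the time bounds of [in_Rp] and
    [has_FPRAS]. *)
Definition pb {X : Type} (a b : X -> nat) : Prop := exists c, forall x, a x <= c * (b x + 1) ^ c.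

Lemma pb_intro {X} (a b : X -> nat) A B : (forall x, a x <= A * (b x + 1) ^ B) -> pb a b.
Proof.
  intros H. exists (A + B). intros x. etransitivity; [apply H|].
  apply Nat.mul_le_mono; [lia|]. apply Nat.pow_le_mono_r; lia.
Qed.

Lemma pb_le {X} (a a' b : X -> nat) : (forall x, a x <= a' x) -> pb a' b -> pb a b.
Proof. intros H [c Hc]. exists c. intros x. etransitivity; [apply H|apply Hc]. Qed.

Lemma pb_refl {X} (a : X -> nat) : pb a a.
Proof. apply (pb_intro _ _ 1 1). intros x. rewrite Nat.pow_1_r. lia. Qed.

Lemma pb_const {X} n (b : X -> nat) : pb (fun _ => n) b.
Proof. apply (pb_intro _ _ n 0). intros x. simpl. lia. Qed.

Lemma pb_add {X} (a a' b : X -> nat) : pb a b -> pb a' b -> pb (fun x => a x + a' x) b.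
Proof.
  intros [c Hc] [c' Hc']. apply (pb_intro _ _ (c + c') (c + c')). intros x.
  specialize (Hc x). specialize (Hc' x).
  assert ((b x + 1) ^ c <= (b x + 1) ^ (c + c')) by (apply Nat.pow_le_mono_r; lia).
  assert ((b x + 1) ^ c' <= (b x + 1) ^ (c + c')) by (apply Nat.pow_le_mono_r; lia).
  nia.
Qed.

Lemma pb_mul {X} (a a' b : X -> nat) : pb a b -> pb a' b -> pb (fun x => a x * a' x) b.
Proof.
  intros [c Hc] [c' Hc']. apply (pb_intro _ _ (c * c') (c + c')). intros x.
  specialize (Hc x). specialize (Hc' x). rewrite Nat.pow_add_r.
  etransitivity; [apply Nat.mul_le_mono; eassumption|]. lia.
Qed.

Lemma pb_trans {X} (a b z : X -> nat) : pb a b -> pb b z -> pb a z.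
Proof.
  intros [c Hc] [e He]. apply (pb_intro _ _ (c * (e + 1) ^ c) (e * c)). intros x.
  etransitivity; [apply Hc|]. rewrite <- Nat.mul_assoc. apply Nat.mul_le_mono_l.
  rewrite Nat.pow_mul_r, <- Nat.pow_mul_l. apply Nat.pow_le_mono_l.
  specialize (He x). assert (1 <= (z x + 1) ^ e) by (pose proof (Nat.pow_nonzero (z x + 1) e); lia).
  lia.
Qed.

Lemma pb_comp {X Y} (a b : Y -> nat) (f : X -> Y) :
  pb a b -> pb (fun x => a (f x)) (fun x => b (f x)).
Proof. intros [c Hc]. exists c. intros x. apply Hc. Qed.

Lemma pb_pow {X} (a b : X -> nat) n : pb a b -> pb (fun x => a x ^ n) b.
Proof.
  intros H. induction n; simpl; [apply pb_const|]. now apply pb_mul.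
Qed.

Lemma pb_addl {X} (a b : X -> nat) : pb a (fun x => a x + b x).
Proof. eapply pb_le; [|apply pb_refl]. simpl. lia. Qed.

Lemma pb_addr {X} (a b : X -> nat) : pb b (fun x => a x + b x).
Proof. eapply pb_le; [|apply pb_refl]. simpl. lia. Qed.

Ltac pb :=
  repeat (cbv beta; first
    [ assumption
    | match goal with |- pb (fun _ => ?c) _ => apply pb_const end
    | lazymatch goal with
      | |- pb (fun x => @?a x + @?a' x) ?b => apply (pb_add a a' b)
      | |- pb (fun x => @?a x * @?a' x) ?b => apply (pb_mul a a' b)
      | |- pb (fun x => @?a x ^ ?n) ?b => apply (pb_pow a b n)
      | |- pb _ _ => first [apply pb_refl | apply pb_addl | apply pb_addr]
      end ]).

(** * Trees on the data stack *)

Inductive tree := Leaf | Node (a b : tree).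

(** Prefix order makes the code self-delimiting, so trees lie on a stack one above the other without
    separators. *)
Fixpoint ser (t : tree) : list sy :=
  match t with Leaf => [Lf] | Node a b => Nd :: ser a ++ ser b end.

Fixpoint tsize (t : tree) : nat :=
  match t with Leaf => 1 | Node a b => S (tsize a + tsize b) end.

Lemma length_ser t : length (ser t) = tsize t.
Proof. induction t; simpl; rewrite ?length_app; lia. Qed.

Lemma ser_no_En t : Forall (fun a => a <> En) (ser t).
Proof.
  induction t; simpl; repeat constructor; try discriminate. now apply Forall_app.
Qed.

Definition isEn (a : sy) : bool := match a with En => true | _ => false end.
Definition notNd (a : sy) : bool := match a with Nd => false | _ => true end.

Definition Pop (i : stk) : prog := Loop (Stk i) (fun _ => true) (fun _ => Push K0 Lf).
Definition Skip : prog := Seq (Push K2 Lf) (Pop K2).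

Lemma run_skip s0 s1 s2 o : run Skip (Mst s0 s1 s2 o) 2 (Mst s0 s1 s2 o).
Proof.
  apply (run_seq _ _ _ 1 (Mst s0 s1 (Lf :: s2) o) 1); [apply (run_push K2)|].
  eapply run_exit; reflexivity.
Qed.

Definition scan (out : sy -> prog) : prog :=
  Seq (Push K2 En) (Seq (Push K2 Nd)
    (Loop (Stk K2) isEn (fun _ => Case (Stk K0) (fun a =>
       match a with
       | Nd => Seq (out Nd) (Seq (Push K2 Nd) (Push K2 Nd))
       | _ => out a
       end)))).

Definition moveout : prog := Seq (Push K1 En) (scan (Push K1)).
Definition drop : prog := scan (fun _ => Skip).
Definition moveback : prog := Loop (Stk K1) isEn (Push K0).

(* Stack [K2] counts the subtrees still to be read. *)
Lemma run_scan out g t r0 r1 r2 o :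
  (forall a s0 s1 s2, run (out a) (Mst s0 s1 s2 o) 2 (Mst s0 (g a s1) s2 o)) ->
  run (scan out) (Mst (ser t ++ r0) r1 r2 o) (3 + 6 * tsize t)
      (Mst r0 (fold_left (fun l a => g a l) (ser t) r1) r2 o).
Proof.
  intros Hout.
  set (body := fun _ : sy => Case (Stk K0) (fun a =>
       match a with
       | Nd => Seq (out Nd) (Seq (Push K2 Nd) (Push K2 Nd))
       | _ => out a
       end)).
  assert (H : forall t r0 r1 r2 n s',
    run (Loop (Stk K2) isEn body)
        (Mst r0 (fold_left (fun l a => g a l) (ser t) r1) r2 o) n s' ->
    run (Loop (Stk K2) isEn body) (Mst (ser t ++ r0) r1 (Nd :: r2) o) (6 * tsize t + n) s').
  { clear t r0 r1 r2. induction t as [|a IHa b IHb]; intros r0 r1 r2 n s' Hn.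
    - eapply run_slack; [eapply run_loop; [reflexivity|reflexivity| |exact Hn]|].
      + eapply run_case; [reflexivity|]. apply Hout.
      + simpl. lia.
    - simpl in Hn. rewrite fold_left_app in Hn.
      change (ser (Node a b) ++ r0) with (Nd :: (ser a ++ ser b) ++ r0). rewrite <- app_assoc.
      eapply run_slack; [eapply run_loop; [reflexivity|reflexivity| |]|].
      + eapply run_case; [reflexivity|]. eapply run_seq; [apply Hout|].
        eapply run_seq; apply run_push.
      + simpl. apply IHa. apply IHb. exact Hn.
      + simpl. lia. }
  eapply run_slack.
  - eapply run_seq; [apply run_push|]. eapply run_seq; [apply run_push|]. simpl.
    apply H. eapply run_exit; reflexivity.
  - lia.
Qed.

Lemma run_moveout t r0 r1 r2 o :
  run moveout (Mst (ser t ++ r0) r1 r2 o) (4 + 6 * tsize t)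
      (Mst r0 (rev (ser t) ++ En :: r1) r2 o).
Proof.
  eapply run_slack; [eapply run_seq; [apply run_push|]|]. simpl.
  - replace (rev (ser t) ++ En :: r1) with (fold_left (fun l a => a :: l) (ser t) (En :: r1)).
    + apply (run_scan _ (fun a l => a :: l)). intros. eapply run_slack; [apply run_push|lia].
    + generalize (En :: r1). induction (ser t) as [|a l IH]; intros m; simpl; [easy|].
      rewrite IH. now rewrite <- app_assoc.
  - lia.
Qed.

Lemma run_drop t r0 r1 r2 o :
  run drop (Mst (ser t ++ r0) r1 r2 o) (3 + 6 * tsize t) (Mst r0 r1 r2 o).
Proof.
  replace r1 with (fold_left (fun l (a : sy) => l) (ser t) r1) at 2.
  - apply (run_scan _ (fun a l => l)). intros. apply run_skip.
  - induction (ser t); simpl; auto.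
Qed.

Lemma run_moveback l r0 r1 r2 o :
  Forall (fun a => a <> En) l ->
  run moveback (Mst r0 (rev l ++ En :: r1) r2 o) (1 + 2 * length l) (Mst (l ++ r0) r1 r2 o).
Proof.
  intros H. revert r0. induction l as [|a l IH] using rev_ind; intros r0.
  - eapply run_exit; reflexivity.
  - apply Forall_app in H. destruct H as [H1 H2]. inversion H2; subst.
    rewrite rev_app_distr. simpl. rewrite length_app. simpl.
    eapply run_slack; [eapply run_loop; [reflexivity| |apply run_push|]|].
    + now destruct a.
    + simpl. rewrite <- app_assoc. apply (IH H1 (a :: r0)).
    + lia.
Qed.

(** Runs [p] on what lies below the top tree, which waits on [K1] meanwhile. *)
Definition dip (p : prog) : prog := Seq moveout (Seq p moveback).

Lemma run_dip p t r0 r1 r2 r0' o n :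
  run p (Mst r0 (rev (ser t) ++ En :: r1) r2 o) n (Mst r0' (rev (ser t) ++ En :: r1) r2 o) ->
  run (dip p) (Mst (ser t ++ r0) r1 r2 o) (n + 5 + 8 * tsize t) (Mst (ser t ++ r0') r1 r2 o).
Proof.
  intros H. eapply run_slack.
  - eapply run_seq; [apply run_moveout|]. eapply run_seq; [exact H|].
    apply run_moveback, ser_no_En.
  - rewrite length_ser. lia.
Qed.

(** Emptying [K1] restores only one copy on [K0]; a second one is put on [K2] at the same time and
    returns by way of [K1]. *)
Definition dup : prog :=
  Seq moveout (Seq (Push K2 En) (Seq
    (Loop (Stk K1) isEn (fun a => Seq (Push K0 a) (Push K2 a)))
    (Seq (Push K1 En) (Seq (Loop (Stk K2) isEn (Push K1)) moveback)))).

Lemma run_dup t r0 r1 r2 o :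
  run dup (Mst (ser t ++ r0) r1 r2 o) (9 + 13 * tsize t) (Mst (ser t ++ ser t ++ r0) r1 r2 o).
Proof.
  assert (H1 : forall l s0 s2, Forall (fun a => a <> En) l ->
    run (Loop (Stk K1) isEn (fun a => Seq (Push K0 a) (Push K2 a)))
      (Mst s0 (rev l ++ En :: r1) s2 o) (1 + 3 * length l) (Mst (l ++ s0) r1 (l ++ s2) o)).
  { induction l as [|a l IH] using rev_ind; intros s0 s2 H.
    - eapply run_exit; reflexivity.
    - apply Forall_app in H. destruct H as [H1 H2]. inversion H2; subst.
      rewrite rev_app_distr. simpl. rewrite length_app. simpl.
      eapply run_slack;
        [eapply run_loop; [reflexivity| |eapply run_seq; apply run_push|]|].
      + now destruct a.
      + simpl. rewrite <- !app_assoc. apply (IH (a :: s0) (a :: s2) H1).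
      + lia. }
  assert (H2 : forall l s0 s1, Forall (fun a => a <> En) l ->
    run (Loop (Stk K2) isEn (Push K1))
      (Mst s0 s1 (l ++ En :: r2) o) (1 + 2 * length l) (Mst s0 (rev l ++ s1) r2 o)).
  { induction l as [|a l IH]; intros s0 s1 H.
    - eapply run_exit; reflexivity.
    - inversion H; subst. simpl.
      eapply run_slack; [eapply run_loop; [reflexivity| |apply run_push|]|].
      + now destruct a.
      + simpl. rewrite <- app_assoc. apply (IH s0 (a :: s1)). easy.
      + simpl. lia. }
  pose proof (ser_no_En t) as Ht.
  eapply run_slack.
  - eapply run_seq; [apply run_moveout|]. eapply run_seq; [apply run_push|]. simpl.
    eapply run_seq; [apply H1, Ht|]. eapply run_seq; [apply run_push|]. simpl.
    eapply run_seq; [apply H2, Ht|]. apply run_moveback, Ht.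
  - rewrite !length_ser. lia.
Qed.

(** * Polynomial-time functions *)

Class Enc (A : Type) := enc : A -> tree.
Definition sz {A : Type} {EA : Enc A} (a : A) : nat := tsize (enc a).
Arguments sz : simpl never.

Lemma sz_pos {A : Type} {EA : Enc A} (a : A) : 1 <= sz a.
Proof. unfold sz. destruct (enc a); simpl; lia. Qed.

#[export] Instance Enc_unit : Enc unit := fun _ => Leaf.
#[export] Instance Enc_bool : Enc bool := fun b => if b then Node Leaf Leaf else Leaf.
#[export] Instance Enc_pair {A B : Type} {EA : Enc A} {EB : Enc B} : Enc (A * B) :=
  fun x => Node (enc (fst x)) (enc (snd x)).
Fixpoint enc_seq {A : Type} (f : A -> tree) (l : list A) : tree :=
  match l with [] => Leaf | a :: l => Node (f a) (enc_seq f l) end.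
#[export] Instance Enc_list {A : Type} {EA : Enc A} : Enc (list A) := enc_seq enc.
(* [nat] is unary, as opposed to [N] below. *)
#[export] Instance Enc_nat : Enc nat := fun n => enc (repeat tt n).

(** The contents below the argument and the other stacks are arbitrary and preserved; this is what
    lets programs be composed. *)
Definition computes {X Y : Type} {EX : Enc X} {EY : Enc Y} (p : prog) (f : X -> Y) (t : X -> nat) :=
  forall x r0 r1 r2 o,
    run p (Mst (ser (enc x) ++ r0) r1 r2 o) (t x) (Mst (ser (enc (f x)) ++ r0) r1 r2 o).

(* The allowance [mu] is for 1/eps, which is not bounded by the size of the
   input, where eps is given in binary. *)
Definition PT {X Y : Type} {EX : Enc X} {EY : Enc Y} (mu : X -> nat) (f : X -> Y) : Prop :=
  exists p t, computes p f t /\ pb t (fun x => sz x + mu x).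

Notation PT0 := (PT (fun _ => 0)).

Section Combinators.
Context {X Y Z : Type} {EX : Enc X} {EY : Enc Y} {EZ : Enc Z}.

(** A result has to be pushed symbol by symbol, so its size is at most that of the argument plus the
    time. *)
Lemma PT_size (mu : X -> nat) (f : X -> Y) :
  PT mu f -> pb (fun x => sz (f x)) (fun x => sz x + mu x).
Proof.
  intros (p & t & Hp & Ht).
  apply (pb_le _ (fun x => sz x + t x)); [|pb].
  intros x. specialize (Hp x [] [] [] (Reading 0 [])). apply run_weight in Hp.
  unfold weight in Hp. simpl in Hp. rewrite !app_nil_r, !length_ser in Hp. unfold sz. lia.
Qed.

Lemma PT_id (mu : X -> nat) : PT mu (fun x => x).
Proof.
  exists Skip, (fun _ => 2). split; [|apply pb_const]. intros x r0 r1 r2 o. apply run_skip.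
Qed.

Lemma PT_comp (mu : X -> nat) (nu : Y -> nat) (f : X -> Y) (g : Y -> Z) :
  PT mu f -> PT nu g -> pb (fun x => nu (f x)) (fun x => sz x + mu x) ->
  PT mu (fun x => g (f x)).
Proof.
  intros Hf (q & u & Hq & Hu) Hnu. pose proof (PT_size _ _ Hf) as Hs.
  destruct Hf as (p & t & Hp & Ht).
  exists (Seq p q), (fun x => t x + u (f x)). split.
  - intros x r0 r1 r2 o. eapply run_seq; [apply Hp|apply Hq].
  - pb. eapply pb_trans; [apply (pb_comp _ _ f Hu)|]. pb.
Qed.

(** A program sees codes only, so passing between types with equal codes is free. Unary and binary
    numbers are turned into lists in this way. *)
Lemma PT_cast (mu : X -> nat) (f : X -> Y) (g : X -> Z) :
  (forall x, enc (f x) = enc (g x)) -> PT mu f -> PT mu g.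
Proof.
  intros E (p & t & Hp & Ht). exists p, t. split; [|easy].
  intros x r0 r1 r2 o. rewrite <- E. apply Hp.
Qed.

Lemma PT_ext (mu : X -> nat) (f g : X -> Y) : (forall x, f x = g x) -> PT mu f -> PT mu g.
Proof.
  intros E (p & t & Hp & Ht). exists p, t. split; [|easy].
  intros x r0 r1 r2 o. rewrite <- E. apply Hp.
Qed.

Lemma PT_pair (mu : X -> nat) (f : X -> Y) (g : X -> Z) :
  PT mu f -> PT mu g -> PT mu (fun x => (f x, g x)).
Proof.
  intros (p & t & Hp & Ht) (q & u & Hq & Hu).
  exists (Seq dup (Seq (dip q) (Seq p (Push K0 Nd)))),
    (fun x => 9 + 13 * sz x + (u x + 5 + 8 * sz x + (t x + 1))). split; [|pb].
  intros x r0 r1 r2 o. eapply run_seq; [apply run_dup|].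
  eapply run_seq; [apply run_dip, Hq|].
  eapply run_seq; [apply Hp|]. simpl. rewrite <- app_assoc. apply run_push.
Qed.

Lemma PT_const (mu : X -> nat) (y : Y) : PT mu (fun _ => y).
Proof.
  assert (H : exists p, forall r0 r1 r2 o,
    run p (Mst r0 r1 r2 o) (2 * S (tsize (enc y))) (Mst (ser (enc y) ++ r0) r1 r2 o)).
  { generalize (enc y) as t. intros t. rewrite <- length_ser.
    induction (ser t) as [|a l (p & IH)].
    - exists Skip. intros. apply run_skip.
    - exists (Seq p (Push K0 a)). intros. eapply run_slack.
      + eapply run_seq; [apply IH|apply run_push].
      + simpl. lia. }
  destruct H as [p Hp].
  exists (Seq drop p), (fun x => 3 + 6 * sz x + 2 * S (tsize (enc y))). split; [|pb].
  intros x r0 r1 r2 o. eapply run_seq; [apply run_drop|apply Hp].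
Qed.

End Combinators.

Lemma PT0_comp {X Y Z} {EX : Enc X} {EY : Enc Y} {EZ : Enc Z} (mu : X -> nat) (f : X -> Y) (g : Y -> Z) :
  PT0 g -> PT mu f -> PT mu (fun x => g (f x)).
Proof. intros Hg Hf. apply (PT_comp mu (fun _ => 0) f g Hf Hg). apply pb_const. Qed.

Section Basic.
Context {X A B : Type} {EX : Enc X} {EA : Enc A} {EB : Enc B}.
Variable mu : X -> nat.

Lemma PT_fst (f : X -> A * B) : PT mu f -> PT mu (fun x => fst (f x)).
Proof.
  apply (PT0_comp mu f (fun z => fst z)). exists (Seq (Pop K0) (dip drop)), (fun z => 1 + ((3 + 6 * sz z) + 5 + 8 * sz z)).
  split; [|pb]. intros [a b] r0 r1 r2 o. simpl. eapply run_slack.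
  - eapply run_seq; [eapply run_exit; reflexivity|]. simpl. rewrite <- app_assoc.
    apply run_dip, run_drop.
  - unfold sz. simpl. lia.
Qed.

Lemma PT_snd (f : X -> A * B) : PT mu f -> PT mu (fun x => snd (f x)).
Proof.
  apply (PT0_comp mu f (fun z => snd z)). exists (Seq (Pop K0) drop), (fun z => 1 + (3 + 6 * sz z)).
  split; [|pb]. intros [a b] r0 r1 r2 o. simpl. eapply run_slack.
  - eapply run_seq; [eapply run_exit; reflexivity|]. simpl. rewrite <- app_assoc.
    apply run_drop.
  - unfold sz. simpl. lia.
Qed.

Lemma PT_cons (f : X -> A) (g : X -> list A) :
  PT mu f -> PT mu g -> PT mu (fun x => f x :: g x).
Proof.
  intros Hf Hg. apply (PT_cast mu (fun x => (f x, g x))); [reflexivity|]. now apply PT_pair.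
Qed.

Lemma PT_if (b : X -> bool) (f g : X -> A) :
  PT mu b -> PT mu f -> PT mu g -> PT mu (fun x => if b x then f x else g x).
Proof.
  intros (p & t & Hp & Ht) (q & u & Hq & Hu) (q' & u' & Hq' & Hu').
  exists (Seq dup (Seq p (Case (Stk K0) (fun a =>
    match a with Nd => Seq (Pop K0) (Seq (Pop K0) q) | _ => q' end)))),
    (fun x => 9 + 13 * sz x + (t x + (3 + u x + u' x))). split; [|pb].
  intros x r0 r1 r2 o. eapply run_seq; [apply run_dup|]. eapply run_seq; [apply Hp|].
  destruct (b x); simpl.
  - eapply run_slack.
    + eapply run_case; [reflexivity|]. eapply run_seq; [eapply run_exit; reflexivity|].
      eapply run_seq; [eapply run_exit; reflexivity|]. apply Hq.
    + lia.
  - eapply run_slack; [eapply run_case; [reflexivity|apply Hq']|]. lia.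
Qed.

Lemma PT_list_case (l : X -> list A) (f : X -> B) (g : X -> A -> list A -> B) :
  PT mu l -> PT mu f ->
  PT (fun z => mu (fst z)) (fun z : X * (A * list A) => g (fst z) (fst (snd z)) (snd (snd z))) ->
  PT mu (fun x => match l x with [] => f x | a :: l' => g x a l' end).
Proof.
  intros Hl (q & u & Hq & Hu) (q' & u' & Hq' & Hu').
  pose proof (PT_size _ _ Hl) as Hs.
  assert (Hpl := PT_pair mu _ _ (PT_id mu) Hl).
  destruct Hl as (p0 & t0 & Hp0 & Ht0).
  destruct Hpl as (p & t & Hp & Ht).
  destruct Hu' as [c' Hc'].
  (* The pair [(x, l x)] is turned into [(x, (a, l'))] for free: both have the same code. *)
  exists (Seq dup (Seq p0 (Case (Stk K0) (fun a =>
    match a with Nd => Seq drop (Seq drop (Seq p q')) | _ => q end)))),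
    (fun x => 9 + 13 * sz x + (t0 x + (7 + 12 * sz (l x) + u x +
      (t x + c' * (1 + sz x + sz (l x) + mu x + 1) ^ c')))).
  split; [|pb].
  intros x r0 r1 r2 o. eapply run_seq; [apply run_dup|]. eapply run_seq; [apply Hp0|].
  specialize (Hp x). cbv beta in Hp.
  destruct (l x) as [|a l'] eqn:E; simpl.
  - eapply run_slack; [eapply run_case; [reflexivity|apply Hq]|]. lia.
  - eapply run_slack.
    + eapply run_case; [reflexivity|]. simpl. rewrite <- app_assoc.
      eapply run_seq; [apply run_drop|]. eapply run_seq; [apply run_drop|].
      eapply run_seq; [apply Hp|]. apply (Hq' (x, (a, l'))).
    + specialize (Hc' (x, (a, l'))). unfold sz in *. simpl in *.
      replace (S (tsize (enc x) + S (tsize (enc a) + tsize (enc_seq enc l'))) + mu x + 1)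
        with (S (tsize (enc x) + S (tsize (enc a) + tsize (enc_seq enc l')) + mu x + 1)) in Hc' by lia.
      change (@enc (list A) Enc_list l') with (enc_seq enc l') in *. lia.
Qed.

End Basic.

(** A left fold whose body also sees the rest of the list, as [occs] and [tasks0] require. *)
Fixpoint floop {A S : Type} (g : A -> list A -> S -> S) (l : list A) (s : S) : S :=
  match l with [] => s | a :: l' => floop g l' (g a l' s) end.

Lemma sz_cons {A} {EA : Enc A} (a : A) l : sz (a :: l) = S (sz a + sz l).
Proof. reflexivity. Qed.

Lemma sz_nil {A} {EA : Enc A} : sz (@nil A) = 1.
Proof. reflexivity. Qed.

Lemma sz_pair {A B} {EA : Enc A} {EB : Enc B} (a : A) (b : B) : sz (a, b) = S (sz a + sz b).
Proof. reflexivity. Qed.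

Lemma length_sz {A} {EA : Enc A} (l : list A) : length l <= sz l.
Proof. induction l; simpl; [lia|]. rewrite sz_cons. lia. Qed.

(** Bounded recursion in the manner of Cobham: iterating a polynomial body along a list stays
    polynomial once all intermediate states have polynomial size. [Inv] holds whatever proves that
    they do. *)
Lemma PT_floop {X A T} {EX : Enc X} {EA : Enc A} {ET : Enc T} (mu : X -> nat)
    (nu : (A * list A) * T -> nat)
    (l : X -> list A) (i : X -> T) (g : A -> list A -> T -> T)
    (Inv : X -> list A -> T -> Prop) (bd : X -> nat) :
  PT mu l -> PT mu i ->
  PT nu (fun z => g (fst (fst z)) (snd (fst z)) (snd z)) ->
  (forall x, Inv x (l x) (i x)) ->
  (forall x a l' s, Inv x (a :: l') s -> Inv x l' (g a l' s)) ->
  (forall x l' s, Inv x l' s -> sz l' + sz s <= bd x) ->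
  (forall x a l' s, Inv x (a :: l') s -> nu ((a, l'), s) <= bd x) ->
  pb bd (fun x => sz x + mu x) ->
  PT mu (fun x => floop g (l x) (i x)).
Proof.
  intros Hl Hi Hg H0 HS Hsz Hnu Hbd.
  pose proof (PT_size _ _ Hl) as Hls.
  destruct (PT_pair _ _ _ Hl Hi) as (p & t & Hp & Ht).
  destruct (PT_pair nu (fun z => snd (fst z)) _ (PT_snd nu _ (PT_fst nu _ (PT_id nu))) Hg)
    as (q & u & Hq & [c Hc]).
  (* A popped [Nd] opens a cons cell and leaves [a], [l'] and [s] on the stack. Two new [Nd] turn
     them into the pair [((a, l'), s)] for [q], and one more pop takes the resulting pair apart. *)
  exists (Seq p (Seq (Pop K0) (Loop (Stk K0) notNd
    (fun _ => Seq (Push K0 Nd) (Seq (Push K0 Nd) (Seq q (Pop K0))))))),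
    (fun x => t x + (1 + (sz (l x) * (4 + c * (bd x + bd x + 3) ^ c) + 1))).
  split.
  - intros x r0 r1 r2 o. eapply run_seq; [apply Hp|].
    apply (run_seq _ _ _ 1 (Mst ((ser (enc (l x)) ++ ser (enc (i x))) ++ r0) r1 r2 o));
      [eapply run_exit; reflexivity|]. rewrite <- app_assoc.
    eapply run_slack with
      (t := length (l x) * (4 + c * (bd x + bd x + 3) ^ c) + 1);
      [|apply Nat.add_le_mono_r, Nat.mul_le_mono_r, length_sz].
    specialize (H0 x). revert H0. generalize (i x) as s. generalize (l x) as l0.
    induction l0 as [|a l0 IH]; intros s HI.
    + eapply run_exit; reflexivity.
    + simpl. rewrite <- app_assoc. eapply run_slack.
      * eapply run_loop; [reflexivity|reflexivity| |].
        -- eapply run_seq; [apply run_push|]. eapply run_seq; [apply run_push|]. simpl.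
           eapply run_seq.
           ++ specialize (Hq ((a, l0), s) r0 r1 r2 o). simpl in Hq.
              rewrite <- !app_assoc in Hq. apply Hq.
           ++ apply (run_exit _ _ _ _ Nd
                (Mst (ser (enc l0) ++ ser (enc (g a l0 s)) ++ r0) r1 r2 o)); reflexivity.
        -- apply IH. now apply HS.
      * specialize (Hc ((a, l0), s)). rewrite !sz_pair in Hc.
        pose proof (Hnu x a l0 s HI). pose proof (Hsz x _ _ HI) as H1. rewrite sz_cons in H1.
        assert (c * (S (S (sz a + sz l0) + sz s) + nu (a, l0, s) + 1) ^ c <=
                c * (bd x + bd x + 3) ^ c).
        { apply Nat.mul_le_mono_l, Nat.pow_le_mono_l. lia. }
        nia.
  - pb.
Qed.

Lemma PT_loop {X A B} {EX : Enc X} {EA : Enc A} {EB : Enc B} (mu : X -> nat)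
    (l : X -> list A) (i : X -> B) (g : X -> A -> list A -> B -> B)
    (Inv : X -> list A -> B -> Prop) (bd : X -> nat) :
  PT mu l -> PT mu i ->
  PT (fun z => mu (fst z)) (fun z : X * ((A * list A) * B) =>
        g (fst z) (fst (fst (snd z))) (snd (fst (snd z))) (snd (snd z))) ->
  (forall x, Inv x (l x) (i x)) ->
  (forall x a l' b, Inv x (a :: l') b -> Inv x l' (g x a l' b)) ->
  (forall x l' b, Inv x l' b -> sz l' + sz b <= bd x) ->
  pb bd (fun x => sz x + mu x) ->
  PT mu (fun x => floop (g x) (l x) (i x)).
Proof.
  intros Hl Hi Hg H0 HS Hsz Hbd.
  (* The body of a loop sees nothing but its state, so the parameter [x] travels in the state. *)
  set (nu := fun z : (A * list A) * (X * B) => mu (fst (snd z))).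
  apply (PT_ext mu (fun x => snd (floop (fun a l' (s : X * B) => (fst s, g (fst s) a l' (snd s)))
                                        (l x) (x, i x)))).
  { intros x. generalize (i x). induction (l x); intros b; simpl; auto. }
  apply (PT_snd mu).
  apply (PT_floop mu nu l (fun x => (x, i x)) _
           (fun x l' s => fst s = x /\ Inv x l' (snd s)) (fun x => S (bd x + sz x + mu x))).
  - easy.
  - apply PT_pair; [apply PT_id|easy].
  - assert (Hx : PT nu (fun z : (A * list A) * (X * B) => fst (snd z)))
      by apply (PT_fst nu), (PT_snd nu), PT_id.
    apply PT_pair; [exact Hx|].
    apply (PT_comp nu (fun z => mu (fst z))
       (fun z : (A * list A) * (X * B) => (fst (snd z), (fst z, snd (snd z))))
       (fun z => g (fst z) (fst (fst (snd z))) (snd (fst (snd z))) (snd (snd z)))).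
    + apply PT_pair; [exact Hx|]. apply PT_pair; [apply (PT_fst nu), PT_id|].
      apply (PT_snd nu), (PT_snd nu), PT_id.
    + exact Hg.
    + cbn [fst snd]. apply (pb_addr sz nu).
  - intros x. simpl. auto.
  - intros x a l' [x' b] [E HI]. simpl in *. subst. auto.
  - intros x l' [x' b] [E HI]. simpl in *. subst. apply Hsz in HI. rewrite sz_pair. lia.
  - intros x a l' [x' b] [E HI]. simpl in *. subst. unfold nu; simpl; lia.
  - change (fun x => S (bd x + sz x + mu x)) with (fun x => 1 + (bd x + sz x + mu x)). pb.
Qed.

Lemma PT_fold {X A B} {EX : Enc X} {EA : Enc A} {EB : Enc B} (mu : X -> nat)
    (l : X -> list A) (i : X -> B) (g : X -> B -> A -> B) (bd : X -> nat) :
  PT mu l -> PT mu i ->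
  PT (fun z => mu (fst z)) (fun z : X * (B * A) => g (fst z) (fst (snd z)) (snd (snd z))) ->
  (forall x l1 l2, l x = l1 ++ l2 -> sz (fold_left (g x) l1 (i x)) <= bd x) ->
  pb bd (fun x => sz x + mu x) ->
  PT mu (fun x => fold_left (g x) (l x) (i x)).
Proof.
  intros Hl Hi Hg Hsz Hbd.
  pose proof (PT_size _ _ Hl) as Hls.
  apply (PT_ext mu (fun x => floop (fun a l' b => g x b a) (l x) (i x))).
  { intros x. generalize (i x). induction (l x); intros b; simpl; auto. }
  apply (PT_loop mu l i (fun x a l' b => g x b a)
    (fun x l' b => exists l1, l x = l1 ++ l' /\ b = fold_left (g x) l1 (i x))
    (fun x => sz (l x) + bd x)); try easy.
  - set (nu := fun z : X * ((A * list A) * B) => mu (fst z)).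
    apply (PT_comp nu (fun z => mu (fst z))
       (fun z : X * ((A * list A) * B) => (fst z, (snd (snd z), fst (fst (snd z)))))
       (fun z => g (fst z) (fst (snd z)) (snd (snd z)))).
    + apply PT_pair; [apply (PT_fst nu), PT_id|].
      apply PT_pair; [apply (PT_snd nu), (PT_snd nu), PT_id|].
      apply (PT_fst nu), (PT_fst nu), (PT_snd nu), PT_id.
    + exact Hg.
    + cbn [fst snd]. apply (pb_addr sz nu).
  - intros x. now exists [].
  - intros x a l' b (l1 & E & ->). exists (l1 ++ [a]). rewrite <- app_assoc, fold_left_app. auto.
  - intros x l' b (l1 & E & ->). pose proof (Hsz x l1 l' E). rewrite E.
    enough (forall l1, sz l' <= sz (l1 ++ l')) by (specialize (H0 l1); lia).
    induction l0; simpl; [lia|]. rewrite sz_cons. lia.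
  - pb.
Qed.

Lemma in_sz {A} {EA : Enc A} (a : A) l : In a l -> sz a < sz l.
Proof.
  induction l as [|b l IH]; [easy|]. rewrite sz_cons. intros [->|H]; [lia|]. apply IH in H. lia.
Qed.

Lemma sz_app {A} {EA : Enc A} (l1 l2 : list A) : S (sz (l1 ++ l2)) = sz l1 + sz l2.
Proof.
  induction l1; cbn [app]; [reflexivity|]. rewrite !sz_cons. lia.
Qed.

(** Growth by an amount independent of the accumulator cannot compound, so no invariant has to be
    supplied. *)
Lemma PT_fold_additive {X A B} {EX : Enc X} {EA : Enc A} {EB : Enc B} (mu : X -> nat)
    (l : X -> list A) (i : X -> B) (g : X -> B -> A -> B) (h : X * A -> nat) :
  PT mu l -> PT mu i ->
  PT (fun z => mu (fst z)) (fun z : X * (B * A) => g (fst z) (fst (snd z)) (snd (snd z))) ->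
  (forall x b a, sz (g x b a) <= sz b + h (x, a)) ->
  pb h (fun z => sz z + mu (fst z)) ->
  PT mu (fun x => fold_left (g x) (l x) (i x)).
Proof.
  intros Hl Hi Hg Hh [c Hc].
  pose proof (PT_size _ _ Hl) as Hls. pose proof (PT_size _ _ Hi) as His.
  apply (PT_fold mu l i g
    (fun x => sz (i x) + sz (l x) * (c * (1 + sz x + sz (l x) + mu x + 1) ^ c))); try easy; [|pb].
  intros x l1 l2 E. set (C := c * _).
  assert (Ha : forall a, In a (l x) -> h (x, a) <= C).
  { intros a Ha. etransitivity; [apply Hc|]. unfold C.
    apply Nat.mul_le_mono_l, Nat.pow_le_mono_l. rewrite sz_pair. apply in_sz in Ha. simpl. lia. }
  assert (H : forall b, sz (fold_left (g x) l1 b) <= sz b + length l1 * C).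
  { assert (Hl1 : forall a, In a l1 -> h (x, a) <= C).
    { intros a H. apply Ha. rewrite E. apply in_or_app. auto. }
    clear E. revert Hl1. induction l1 as [|a l1 IH]; intros Hl1 b; simpl; [lia|].
    etransitivity; [apply IH; intros; apply Hl1; now right|].
    pose proof (Hh x b a). pose proof (Hl1 a ltac:(now left)). lia. }
  etransitivity; [apply H|].
  assert (length l1 <= sz (l x)).
  { rewrite E. pose proof (length_sz (l1 ++ l2)). rewrite length_app in *. lia. }
  nia.
Qed.

Lemma sz_enc {A} {EA : Enc A} (a : A) : sz a = tsize (enc a).
Proof. reflexivity. Qed.

#[global] Opaque sz.

Open Scope nat_scope.

(** * A library of polynomial-time functions *)

(** Hooks of [pt], filled in by [::=] as the closure properties become available. *)
Ltac pt_list := fail.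
Ltac pt_arith := fail.
Ltac pt_binary := fail.
Ltac pt_base :=
  lazymatch goal with
  | |- PT _ (fun x => x) => apply PT_id
  | |- PT _ (fun x => fst (@?f x)) => apply (PT_fst _ f)
  | |- PT _ (fun x => snd (@?f x)) => apply (PT_snd _ f)
  | |- PT _ (fun x => pair (@?f x) (@?g x)) => apply (PT_pair _ f g)
  | |- PT _ (fun x => cons (@?f x) (@?g x)) => apply (PT_cons _ f g)
  | |- PT _ (fun x => if (@?b x) then (@?f x) else (@?g x)) => apply (PT_if _ b f g)
  end.
Ltac pt_const := match goal with |- PT _ (fun x => ?c) => apply PT_const end.
Ltac pt_eta :=
  match goal with
  | |- PT ?m (@fst ?A ?B) => change (PT m (fun x : A * B => fst x))
  | |- PT ?m (@snd ?A ?B) => change (PT m (fun x : A * B => snd x))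
  end.
Ltac pt := repeat (cbv beta; first [assumption | pt_const | pt_base | pt_list | pt_arith | pt_binary | pt_eta]).

Lemma PT_tt {X} {EX : Enc X} (mu : X -> nat) (f : X -> unit) : PT mu f.
Proof. apply (PT_ext mu (fun _ => tt)); [intros x; now destruct (f x)|apply PT_const]. Qed.

Section Append.
Context {X A : Type} {EX : Enc X} {EA : Enc A}.
Variable mu : X -> nat.

Lemma PT_rev_append (f g : X -> list A) :
  PT mu f -> PT mu g -> PT mu (fun x => rev_append (f x) (g x)).
Proof.
  intros Hf Hg. apply (PT_ext mu (fun x => fold_left (fun b a => a :: b) (f x) (g x))).
  { intros x. generalize (g x). induction (f x); intros; simpl; auto. }
  apply (PT_fold_additive mu f g (fun _ b a => a :: b) (fun z => S (sz (snd z)))); try easy.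
  - pt.
  - intros. rewrite sz_cons. simpl. lia.
  - apply (pb_le _ (fun z => sz z)); [|apply pb_addl]. intros [x a]. rewrite sz_pair.
    pose proof (sz_pos x). simpl. lia.
Qed.

Lemma PT_rev (f : X -> list A) : PT mu f -> PT mu (fun x => rev (f x)).
Proof.
  intros Hf. apply (PT_ext mu (fun x => rev_append (f x) [])); [intros; now rewrite <- rev_alt|].
  apply PT_rev_append; pt.
Qed.

Lemma PT_app (f g : X -> list A) : PT mu f -> PT mu g -> PT mu (fun x => f x ++ g x).
Proof.
  intros Hf Hg. apply (PT_ext mu (fun x => rev_append (rev (f x)) (g x))).
  { intros. now rewrite rev_append_rev, rev_involutive. }
  apply PT_rev_append; [now apply PT_rev|easy].
Qed.

End Append.

Section Lists.
Context {X A B : Type} {EX : Enc X} {EA : Enc A} {EB : Enc B}.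
Variable mu : X -> nat.

Lemma PT_map (f : X -> A -> B) (l : X -> list A) :
  PT mu l -> PT (fun z => mu (fst z)) (fun z => f (fst z) (snd z)) ->
  PT mu (fun x => map (f x) (l x)).
Proof.
  intros Hl Hf.
  apply (PT_ext mu (fun x => rev (fold_left (fun b a => f x a :: b) (l x) []))).
  { intros x. rewrite <- (rev_involutive (map _ _)). f_equal.
    rewrite <- (app_nil_r (rev _)). generalize (@nil B) as b.
    induction (l x); intros b; simpl; [easy|]. rewrite IHl0. now rewrite <- app_assoc. }
  apply PT_rev.
  apply (PT_fold_additive mu l (fun _ => []) (fun x b a => f x a :: b)
           (fun z => S (sz (f (fst z) (snd z))))); try easy.
  - apply PT_const.
  - apply PT_cons; [|pt].
    apply (PT_comp _ (fun z : X * A => mu (fst z)) (fun z : X * (list B * A) => (fst z, snd (snd z)))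
       (fun z => f (fst z) (snd z))); [pt|easy|].
    apply (pb_addr sz (fun z : X * (list B * A) => mu (fst z))).
  - intros. rewrite sz_cons. simpl. lia.
  - change (pb (fun z => 1 + sz (f (fst z) (snd z))) (fun z : X * A => sz z + mu (fst z))).
    apply pb_add; [apply pb_const|]. exact (PT_size _ _ Hf).
Qed.

Lemma PT_concat (f : X -> list (list A)) : PT mu f -> PT mu (fun x => concat (f x)).
Proof.
  intros Hf. apply (PT_ext mu (fun x => fold_left (fun b a => b ++ a) (f x) [])).
  { intros x. change (concat (f x)) with ([] ++ concat (f x)). generalize (@nil A).
    induction (f x); intros m; simpl; [now rewrite app_nil_r|]. rewrite IHl. now rewrite app_assoc. }
  apply (PT_fold_additive mu f (fun _ => []) (fun _ b a => b ++ a) (fun z => sz (snd z))); try easy.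
  - apply PT_const.
  - apply PT_app; pt.
  - intros x b a. pose proof (sz_app b a). simpl. lia.
  - apply (pb_le _ (fun z => sz z)); [|apply pb_addl]. intros [x a]. rewrite sz_pair. simpl. lia.
Qed.

Lemma PT_tl (f : X -> list A) : PT mu f -> PT mu (fun x => tl (f x)).
Proof.
  intros Hf. unfold tl. apply (PT_list_case mu f (fun _ => []) (fun _ _ l => l)); pt.
Qed.

Lemma PT_hd (d : A) (f : X -> list A) : PT mu f -> PT mu (fun x => List.hd d (f x)).
Proof.
  intros Hf. unfold List.hd. apply (PT_list_case mu f (fun _ => d) (fun _ a _ => a)); pt.
Qed.

Lemma PT_S (f : X -> nat) : PT mu f -> PT mu (fun x => S (f x)).
Proof.
  intros Hf. apply (PT_cast mu (fun x => (tt, f x))); [reflexivity|]. pt.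
Qed.

End Lists.

Lemma PT_length {X A : Type} {EX : Enc X} {EA : Enc A} (mu : X -> nat) (f : X -> list A) : PT mu f -> PT mu (fun x => length (f x)).
Proof.
  intros Hf. apply (PT_cast mu (fun x => map (fun _ => tt) (f x))).
  - intros x. change (enc (length (f x))) with (enc (repeat tt (length (f x)))). f_equal.
    induction (f x); simpl; congruence.
  - apply PT_map; [easy|]. apply PT_tt.
Qed.

Ltac pt_list ::=
  lazymatch goal with
  | |- PT _ (fun x => rev (@?f x)) => apply (PT_rev _ f)
  | |- PT _ (fun x => (@?f x) ++ (@?g x)) => apply (PT_app _ f g)
  | |- PT _ (fun x => concat (@?f x)) => apply (PT_concat _ f)
  | |- PT _ (fun x => tl (@?f x)) => apply (PT_tl _ f)
  | |- PT _ (fun x => List.hd ?d (@?f x)) => apply (PT_hd _ d f)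
  | |- PT _ (fun x => S (@?f x)) => apply (PT_S _ f)
  | |- PT _ (fun x => length (@?f x)) => apply (PT_length _ f)
  end.

Lemma sz_nat n : sz n = 2 * n + 1.
Proof.
  induction n as [|n IH]; [now rewrite sz_enc|].
  rewrite sz_enc. change (tsize (enc (S n))) with (S (1 + tsize (enc n))).
  rewrite <- sz_enc, IH. lia.
Qed.

Section Nats.
Context {X A : Type} {EX : Enc X} {EA : Enc A}.
Variable mu : X -> nat.

Lemma PT_repeat_tt (f : X -> nat) : PT mu f -> PT mu (fun x => repeat tt (f x)).
Proof. intros Hf. now apply (PT_cast mu f). Qed.

Lemma PT_add (f g : X -> nat) : PT mu f -> PT mu g -> PT mu (fun x => f x + g x).
Proof.
  intros Hf Hg. apply (PT_cast mu (fun x => repeat tt (f x) ++ repeat tt (g x))).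
  - intros x. now rewrite <- repeat_app.
  - apply PT_app; now apply PT_repeat_tt.
Qed.

Lemma PT_nat_case (n : X -> nat) (f : X -> A) (g : X -> nat -> A) :
  PT mu n -> PT mu f -> PT (fun z => mu (fst z)) (fun z => g (fst z) (snd z)) ->
  PT mu (fun x => match n x with O => f x | S m => g x m end).
Proof.
  intros Hn Hf Hg.
  apply (PT_ext mu (fun x => match repeat tt (n x) with [] => f x | _ :: l => g x (length l) end)).
  { intros x. destruct (n x); simpl; [easy|]. now rewrite repeat_length. }
  apply (PT_list_case mu (fun x => repeat tt (n x)) f (fun x _ l => g x (length l))).
  - now apply PT_repeat_tt.
  - easy.
  - apply (PT_comp _ (fun z : X * nat => mu (fst z))
      (fun z : X * (unit * list unit) => (fst z, length (snd (snd z))))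
      (fun z => g (fst z) (snd z))); [pt|easy|].
    apply (pb_addr sz (fun z : X * (unit * list unit) => mu (fst z))).
Qed.

Lemma PT_iter (n : X -> nat) (i : X -> A) (g : X -> A -> A) (bd : X -> nat) :
  PT mu n -> PT mu i ->
  PT (fun z => mu (fst z)) (fun z => g (fst z) (snd z)) ->
  (forall x m, m <= n x -> sz (Nat.iter m (g x) (i x)) <= bd x) ->
  pb bd (fun x => sz x + mu x) ->
  PT mu (fun x => Nat.iter (n x) (g x) (i x)).
Proof.
  intros Hn Hi Hg Hsz Hbd.
  assert (E : forall x l, fold_left (fun b (_ : unit) => g x b) l (i x) =
                          Nat.iter (length l) (g x) (i x)).
  { intros x l. generalize (i x). induction l; intros b; simpl; [easy|].
    now rewrite IHl, <- Nat.iter_succ_r. }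
  apply (PT_ext mu (fun x => fold_left (fun b _ => g x b) (repeat tt (n x)) (i x))).
  { intros x. now rewrite E, repeat_length. }
  apply (PT_fold mu (fun x => repeat tt (n x)) i (fun x b _ => g x b) bd); try easy.
  - apply (PT_comp _ (fun z : X * A => mu (fst z))
      (fun z : X * (A * unit) => (fst z, fst (snd z)))
      (fun z => g (fst z) (snd z))); [pt|easy|].
    apply (pb_addr sz (fun z : X * (A * unit) => mu (fst z))).
  - intros x l1 l2 El. rewrite E. apply Hsz.
    rewrite <- (repeat_length tt (n x)), El, length_app. lia.
Qed.

End Nats.

Lemma PT_mul {X} {EX : Enc X} (mu : X -> nat) (f g : X -> nat) :
  PT mu f -> PT mu g -> PT mu (fun x => f x * g x).
Proof.
  intros Hf Hg.
  apply (PT_ext mu (fun x => length (concat (map (fun _ => repeat tt (g x)) (repeat tt (f x)))))).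
  { intros x. induction (f x); simpl; [easy|]. rewrite length_app, IHn, repeat_length. lia. }
  apply PT_length, PT_concat. apply PT_map.
  - now apply PT_repeat_tt.
  - apply (PT_comp _ mu (fun z : X * unit => fst z) (fun x => repeat tt (g x))); [pt| |].
    + now apply PT_repeat_tt.
    + apply (pb_addr sz (fun z : X * unit => mu (fst z))).
Qed.

Lemma PT_pred {X} {EX : Enc X} (mu : X -> nat) (f : X -> nat) :
  PT mu f -> PT mu (fun x => Nat.pred (f x)).
Proof.
  intros Hf. unfold Nat.pred. apply (PT_nat_case mu f f (fun x m => m)); pt.
Qed.

Lemma PT_sub {X} {EX : Enc X} (mu : X -> nat) (f g : X -> nat) :
  PT mu f -> PT mu g -> PT mu (fun x => f x - g x).
Proof.
  intros Hf Hg. pose proof (PT_size _ _ Hf) as Hs.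
  apply (PT_ext mu (fun x => Nat.iter (g x) Nat.pred (f x))).
  { intros x. induction (g x); simpl; lia. }
  apply (PT_iter mu g f (fun _ => Nat.pred) (fun x => sz (f x))); try easy.
  - apply PT_pred. pt.
  - intros x m _. rewrite !sz_nat. induction m; simpl; lia.
Qed.

Lemma PT_pow {X} {EX : Enc X} (mu : X -> nat) (f : X -> nat) n :
  PT mu f -> PT mu (fun x => f x ^ n).
Proof.
  intros Hf. induction n; simpl; [apply PT_const|now apply PT_mul].
Qed.

Lemma PT_eqb_const {X} {EX : Enc X} n : forall (mu : X -> nat) (f : X -> nat),
  PT mu f -> PT mu (fun x => f x =? n).
Proof.
  assert (H : PT0 (fun m => m =? n)).
  { induction n as [|n IH].
    - apply (PT_ext _ (fun m => match m with 0 => true | S _ => false end)); [now intros []|].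
      apply (PT_nat_case _ (fun m => m) (fun _ => true) (fun _ _ => false)); pt.
    - apply (PT_ext _ (fun m => match m with 0 => false | S m => m =? n end)); [now intros []|].
      apply (PT_nat_case _ (fun m => m) (fun _ => false) (fun _ m => m =? n)); pt.
      apply (PT0_comp _ (fun z => snd z) (fun m => m =? n)); [exact IH|pt]. }
  intros mu f Hf. now apply (PT0_comp mu f (fun m => m =? n)).
Qed.

Lemma PT_andb {X} {EX : Enc X} (mu : X -> nat) (f g : X -> bool) :
  PT mu f -> PT mu g -> PT mu (fun x => f x && g x).
Proof. intros. change (PT mu (fun x => if f x then g x else false)). pt. Qed.

Lemma PT_negb {X} {EX : Enc X} (mu : X -> nat) (f : X -> bool) :
  PT mu f -> PT mu (fun x => negb (f x)).
Proof. intros. change (PT mu (fun x => if f x then false else true)). pt. Qed.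

Lemma PT_orb {X} {EX : Enc X} (mu : X -> nat) (f g : X -> bool) :
  PT mu f -> PT mu g -> PT mu (fun x => f x || g x).
Proof. intros. change (PT mu (fun x => if f x then true else g x)). pt. Qed.

Lemma PT_xorb {X} {EX : Enc X} (mu : X -> nat) (f g : X -> bool) :
  PT mu f -> PT mu g -> PT mu (fun x => xorb (f x) (g x)).
Proof.
  intros. apply (PT_ext mu (fun x => if f x then (if g x then false else true) else g x)).
  { intros x. now destruct (f x), (g x). }
  pt.
Qed.

Ltac pt_arith ::=
  lazymatch goal with
  | |- PT _ (fun x => repeat tt (@?f x)) => apply (PT_repeat_tt _ f)
  | |- PT _ (fun x => (@?f x) + (@?g x)) => apply (PT_add _ f g)
  | |- PT _ (fun x => (@?f x) * (@?g x)) => apply (PT_mul _ f g)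
  | |- PT _ (fun x => (@?f x) - (@?g x)) => apply (PT_sub _ f g)
  | |- PT _ (fun x => Nat.pred (@?f x)) => apply (PT_pred _ f)
  | |- PT _ (fun x => (@?f x) ^ ?n) => apply (PT_pow _ f n)
  | |- PT _ (fun x => (@?f x) =? ?n) => apply (PT_eqb_const n _ f)
  | |- PT _ (fun x => (@?f x) && (@?g x)) => apply (PT_andb _ f g)
  | |- PT _ (fun x => (@?f x) || (@?g x)) => apply (PT_orb _ f g)
  | |- PT _ (fun x => xorb (@?f x) (@?g x)) => apply (PT_xorb _ f g)
  | |- PT _ (fun x => negb (@?f x)) => apply (PT_negb _ f)
  end.

Lemma sz_true : sz true = 3.
Proof. now rewrite sz_enc. Qed.

Lemma sz_false : sz false = 1.
Proof. now rewrite sz_enc. Qed.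

Lemma sz_bool_le (b : bool) : sz b <= 3.
Proof. destruct b; rewrite ?sz_true, ?sz_false; lia. Qed.

Fixpoint eqbl (l m : list bool) : bool :=
  match l, m with
  | [], [] => true
  | a :: l, b :: m => Bool.eqb a b && eqbl l m
  | _, _ => false
  end.

Lemma eqbl_spec l m : eqbl l m = true <-> l = m.
Proof.
  revert m. induction l as [|a l IH]; intros [|b m]; simpl; split; try easy.
  - intros H. apply andb_prop in H. destruct H as [H1 H2].
    apply eqb_prop in H1. apply IH in H2. congruence.
  - intros [= <- <-]. rewrite eqb_reflx. simpl. now apply IH.
Qed.

Definition isnil {A} (l : list A) : bool := match l with [] => true | _ => false end.

Lemma PT_isnil {X A} {EX : Enc X} {EA : Enc A} (mu : X -> nat) (f : X -> list A) :
  PT mu f -> PT mu (fun x => isnil (f x)).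
Proof. intros. apply (PT_list_case mu f (fun _ => true) (fun _ _ _ => false)); pt. Qed.

Lemma PT_eqbl {X} {EX : Enc X} (mu : X -> nat) (f g : X -> list bool) :
  PT mu f -> PT mu g -> PT mu (fun x => eqbl (f x) (g x)).
Proof.
  intros Hf Hg. pose proof (PT_size _ _ Hg) as Hs.
  (* The state tells whether the lists agree so far and holds the unread part of the second one. *)
  set (step := fun (s : bool * list bool) (a : bool) =>
    (fst s && negb (isnil (snd s)) &&
       negb (xorb a (List.hd false (snd s))), tl (snd s))).
  apply (PT_ext mu (fun x => let s := fold_left step (f x) (true, g x) in
                      fst s && isnil (snd s))).
  { intros x. cbv zeta. generalize (g x).
    assert (Hff : forall l m, fst (fold_left step l (false, m)) = false).
    { induction l as [|a l IH]; intros m; [easy|]. apply (IH (tl m)). }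
    induction (f x) as [|a l IH]; intros [|b m]; try easy.
    - change (fold_left step (a :: l) (true, [])) with (fold_left step l (false, [])).
      now rewrite Hff.
    - change (fold_left step (a :: l) (true, b :: m)) with
        (fold_left step l (true && negb (xorb a b), m)).
      destruct a, b; simpl negb; simpl eqbl; try apply IH; now rewrite Hff. }
  assert (Hfold : PT mu (fun x => fold_left step (f x) (true, g x))).
  { apply (PT_fold_additive mu f (fun x => (true, g x)) (fun _ => step) (fun _ => 2)).
    - pt.
    - pt.
    - unfold step. pt. apply PT_isnil. pt.
    - intros x [c m] a. unfold step. simpl fst; simpl snd. rewrite !sz_pair.
      pose proof sz_bool_le as H.
      assert (sz (tl m) <= sz m) by (destruct m; simpl tl; rewrite ?sz_cons; lia).
      specialize (H (c && negb (isnil m) && negb (xorb a (List.hd false m)))).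
      pose proof (sz_pos c). lia.
    - apply pb_const. }
  cbv zeta. apply PT_andb; [now apply PT_fst|]. apply PT_isnil. now apply PT_snd.
Qed.

(** * Binary arithmetic *)

Definition bits (n : N) : list bool := match n with N0 => [] | Npos p => pos_bits p end.
#[export] Instance Enc_N : Enc N := fun n => enc (bits n).
(** Least significant bit first. Padding with zeros at the far end, which [bits] never produces, is
    accepted; the adder relies on it. *)
Definition ofbits (l : list bool) : N :=
  fold_right (fun (b : bool) n => if b then N.succ_double n else N.double n) 0%N l.

Lemma ofbits_bits n : ofbits (bits n) = n.
Proof.
  destruct n as [|p]; [easy|]. simpl.
  induction p as [p IH|p IH|]; simpl; [| |easy]; now rewrite IH.
Qed.

Lemma bits_inj m n : bits m = bits n -> m = n.
Proof. intros H. rewrite <- (ofbits_bits m), H. apply ofbits_bits. Qed.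

Lemma bits_double n : bits (N.double n) = match bits n with [] => [] | _ => false :: bits n end.
Proof. destruct n as [|[]]; reflexivity. Qed.

Lemma bits_succ_double n : bits (N.succ_double n) = true :: bits n.
Proof. now destruct n. Qed.

Section Binary.
Context {X : Type} {EX : Enc X}.
Variable mu : X -> nat.

Lemma PT_bits (f : X -> N) : PT mu f -> PT mu (fun x => bits (f x)).
Proof. intros Hf. now apply (PT_cast mu f). Qed.

Lemma PT_succ_double (f : X -> N) : PT mu f -> PT mu (fun x => N.succ_double (f x)).
Proof.
  intros Hf. apply (PT_cast mu (fun x => true :: bits (f x))).
  - intros x. change (enc (N.succ_double (f x))) with (enc (bits (N.succ_double (f x)))).
    now rewrite bits_succ_double.
  - apply PT_cons; [apply PT_const|now apply PT_bits].
Qed.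

Lemma PT_double (f : X -> N) : PT mu f -> PT mu (fun x => N.double (f x)).
Proof.
  intros Hf. apply PT_bits in Hf.
  apply (PT_cast mu (fun x => if isnil (bits (f x))
                              then [] else false :: bits (f x))).
  - intros x. change (enc (N.double (f x))) with (enc (bits (N.double (f x)))).
    rewrite bits_double. now destruct (bits (f x)).
  - pt. now apply PT_isnil.
Qed.

Lemma PT_Neqb (f g : X -> N) : PT mu f -> PT mu g -> PT mu (fun x => N.eqb (f x) (g x)).
Proof.
  intros Hf Hg. apply (PT_ext mu (fun x => eqbl (bits (f x)) (bits (g x)))).
  - intros x. destruct (N.eqb_spec (f x) (g x)) as [->|H].
    + now apply eqbl_spec.
    + destruct (eqbl _ _) eqn:E; [|easy]. apply eqbl_spec, bits_inj in E. congruence.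
  - apply PT_eqbl; now apply PT_bits.
Qed.
End Binary.

Lemma sz_N n : sz n = sz (bits n).
Proof. reflexivity. Qed.

Definition blen (n : N) : nat := length (bits n).

Lemma sz_bits (l : list bool) : 2 * length l + 1 <= sz l <= 4 * length l + 1.
Proof.
  induction l as [|b l IH]; [rewrite (@sz_nil bool); cbn; lia|]. rewrite sz_cons. cbn [length].
  destruct b; rewrite ?sz_true, ?sz_false; lia.
Qed.

Lemma sz_blen n : 2 * blen n + 1 <= sz n <= 4 * blen n + 1.
Proof. rewrite sz_N. apply sz_bits. Qed.

Lemma ofbits_lt l : (ofbits l < 2 ^ N.of_nat (length l))%N.
Proof.
  induction l as [|b l IH]; simpl length; [simpl; lia|].
  rewrite Nat2N.inj_succ, N.pow_succ_r'.
  change (ofbits (b :: l)) with (if b then N.succ_double (ofbits l) else N.double (ofbits l)).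
  destruct b.
  - rewrite N.succ_double_spec. lia.
  - rewrite N.double_spec. lia.
Qed.

Lemma lt_pow_blen n : (n < 2 ^ N.of_nat (blen n))%N.
Proof. rewrite <- (ofbits_bits n) at 1. apply ofbits_lt. Qed.

Lemma blen_le_pow n : n <> 0%N -> (2 ^ N.of_nat (blen n) <= 2 * n)%N.
Proof.
  destruct n as [|p]; [easy|]. intros _. unfold blen. simpl bits.
  induction p as [p IH|p IH|]; simpl length; [| |simpl; lia];
    rewrite Nat2N.inj_succ, N.pow_succ_r'; lia.
Qed.

Lemma blen_lt n k : (n < 2 ^ N.of_nat k)%N -> blen n <= k.
Proof.
  intros H. destruct (N.eq_dec n 0) as [->|Hn]; [unfold blen; simpl; lia|].
  apply blen_le_pow in Hn.
  assert (H' : (2 ^ N.of_nat (blen n) < 2 ^ N.of_nat (S k))%N).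
  { rewrite Nat2N.inj_succ, N.pow_succ_r'. lia. }
  apply N.pow_lt_mono_r_iff in H'; lia.
Qed.

Lemma blen_add m n : blen (m + n) <= S (Nat.max (blen m) (blen n)).
Proof.
  apply blen_lt. pose proof (lt_pow_blen m). pose proof (lt_pow_blen n).
  rewrite Nat2N.inj_succ, N.pow_succ_r'.
  assert (2 ^ N.of_nat (blen m) <= 2 ^ N.of_nat (Nat.max (blen m) (blen n)))%N
    by (apply N.pow_le_mono_r; lia).
  assert (2 ^ N.of_nat (blen n) <= 2 ^ N.of_nat (Nat.max (blen m) (blen n)))%N
    by (apply N.pow_le_mono_r; lia).
  lia.
Qed.

Lemma blen_mul m n : blen (m * n) <= blen m + blen n.
Proof.
  apply blen_lt. rewrite Nat2N.inj_add, N.pow_add_r.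
  apply N.mul_lt_mono; apply lt_pow_blen.
Qed.

Section Binary2.
Context {X : Type} {EX : Enc X}.
Variable mu : X -> nat.

Lemma PT_ofbits (f : X -> list bool) : PT mu f -> PT mu (fun x => ofbits (f x)).
Proof.
  intros Hf.
  apply (PT_ext mu (fun x => fold_left (fun n (b : bool) => if b then N.succ_double n else N.double n)
                               (rev (f x)) 0%N)).
  { intros x. unfold ofbits. rewrite <- (rev_involutive (f x)) at 2. now rewrite fold_left_rev_right. }
  apply (PT_fold_additive mu (fun x => rev (f x)) (fun _ => 0%N)
    (fun _ n (b : bool) => if b then N.succ_double n else N.double n) (fun _ => 4)).
  - pt.
  - pt.
  - apply PT_if; [pt|apply PT_succ_double; pt|apply PT_double; pt].
  - intros x n b. rewrite !sz_N. destruct b.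
    + rewrite bits_succ_double, sz_cons, sz_true. lia.
    + rewrite bits_double. destruct (bits n) as [|b l]; [lia|].
      rewrite sz_cons, sz_false. lia.
  - apply pb_const.
Qed.

(** Ripple-carry addition. The state consists of the rest of the second operand, the carry, and the
    output so far with its latest bit first. *)
Definition add_step (s : list bool * (bool * list bool)) (a : bool) :=
  let b := List.hd false (fst s) in let c := fst (snd s) in
  (tl (fst s), ((a && b) || (c && (a || b)), xorb (xorb a b) c :: snd (snd s))).

Lemma add_step_spec l : forall m c acc, length m <= length l ->
  let s := fold_left add_step l (m, (c, acc)) in
  ofbits (rev (fst (snd s) :: snd (snd s))) =
  (ofbits (rev acc ++ bits (ofbits l + ofbits m + (if c then 1 else 0))))%N.
Proof.
  assert (Happ : forall l m, ofbits (l ++ bits (ofbits m)) = ofbits (l ++ m)).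
  { induction l0 as [|b l0 IH]; intros m; simpl; [apply ofbits_bits|]. now rewrite IH. }
  induction l as [|a l IH]; intros m c acc Hm; cbv zeta in *.
  - destruct m; [|simpl in Hm; lia]. simpl. destruct c; [easy|].
    rewrite app_nil_r. induction (rev acc) as [|b k IHk]; simpl; [easy|]. now rewrite IHk.
  - set (b := List.hd false m).
    set (c' := ((a && b) || (c && (a || b)))%bool). set (o := xorb (xorb a b) c).
    change (fold_left add_step (a :: l) (m, (c, acc))) with
      (fold_left add_step l (tl m, (c', o :: acc))).
    rewrite IH by (destruct m; simpl in *; lia). simpl rev.
    rewrite <- app_assoc. simpl app.
    rewrite <- (Happ _ (o :: _)). f_equal. f_equal. f_equal. simpl ofbits. rewrite ofbits_bits.
    assert (Em : ofbits m = (2 * ofbits (tl m) + (if b then 1 else 0))%N).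
    { unfold b. destruct m as [|[] m]; simpl tl; simpl List.hd; simpl ofbits;
        rewrite ?N.succ_double_spec, ?N.double_spec; simpl; lia. }
    rewrite Em. unfold o, c'. clear.
    destruct a, b, c; cbn [andb orb xorb ofbits fold_right]; fold (ofbits l); rewrite ?N.succ_double_spec, ?N.double_spec; lia.
Qed.

Lemma PT_Nadd (f g : X -> N) : PT mu f -> PT mu g -> PT mu (fun x => (f x + g x)%N).
Proof.
  intros Hf Hg. apply PT_bits in Hf, Hg.
  (* Zeros are appended to the first operand so that the loop outlasts the second one. *)
  set (s := fun x => fold_left add_step (bits (f x) ++ map (fun _ => false) (bits (g x)))
                       (bits (g x), (false, []))).
  apply (PT_ext mu (fun x => ofbits (rev (fst (snd (s x)) :: snd (snd (s x)))))).
  { intros x. unfold s. rewrite add_step_spec by (rewrite length_app, length_map; lia).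
    simpl rev. simpl app. rewrite ofbits_bits, ofbits_bits.
    assert (E : forall l m : list bool, ofbits (l ++ map (fun _ => false) m) = ofbits l).
    { induction l as [|b l IH]; intros m; simpl; [|now rewrite IH].
      induction m; simpl; [easy|]. now rewrite IHm. }
    rewrite E, ofbits_bits. lia. }
  apply PT_ofbits.
  assert (Hs : PT mu s).
  { unfold s. apply (PT_fold_additive mu _ _ (fun _ => add_step) (fun _ => 6)).
    - pt. apply PT_map; [easy|]. pt.
    - pt.
    - unfold add_step. pt.
    - intros x [m [c acc]] a. unfold add_step. simpl fst. simpl snd. rewrite !sz_pair, sz_cons.
      pose proof sz_bool_le as Hb.
      assert (sz (tl m) <= sz m) by (destruct m; simpl tl; rewrite ?sz_cons; lia).
      pose proof (Hb ((a && List.hd false m) || (c && (a || List.hd false m)))%bool).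
      pose proof (Hb (xorb (xorb a (List.hd false m)) c)). pose proof (sz_pos c). lia.
    - apply pb_const. }
  pt.
Qed.
End Binary2.

(** Horner's rule from the top bit down. Every intermediate value is a leading part of the first
    factor times the second, so it is never longer than both factors together. *)
Lemma PT_Nmul {X} {EX : Enc X} (mu : X -> nat) (f g : X -> N) :
  PT mu f -> PT mu g -> PT mu (fun x => (f x * g x)%N).
Proof.
  intros Hf Hg.
  enough (H : PT0 (fun z : N * N => (fst z * snd z)%N))
    by (apply (PT0_comp mu (fun x => (f x, g x)) _ H); pt).
  clear f g Hf Hg.
  set (step := fun (z : N * N) n (b : bool) => if b then (N.double n + snd z)%N else N.double n).
  assert (E : forall z l, fold_left (step z) l 0%N = (ofbits (rev l) * snd z)%N).
  { intros z l. unfold ofbits. rewrite fold_left_rev_right.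
    assert (G : forall m, fold_left (step z) l (m * snd z)%N =
     (fold_left (fun x (y : bool) => if y then N.succ_double x else N.double x) l m * snd z)%N).
    { induction l as [|b l IH]; intros m; simpl; [easy|]. rewrite <- IH. f_equal.
      unfold step. destruct b; rewrite ?N.succ_double_spec, !N.double_spec; lia. }
    apply (G 0%N). }
  apply (PT_ext _ (fun z => fold_left (step z) (rev (bits (fst z))) 0%N)).
  { intros z. now rewrite E, rev_involutive, ofbits_bits. }
  apply (PT_fold _ (fun z => rev (bits (fst z))) (fun _ => 0%N) step (fun z => 4 * sz z + 1)).
  - apply PT_rev, PT_bits. pt.
  - pt.
  - unfold step. apply PT_if; [pt|apply PT_Nadd; [apply PT_double|]; pt|apply PT_double; pt].
  - intros [a b] l1 l2 El. rewrite E. simpl snd. simpl fst in El.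
    pose proof (sz_blen (ofbits (rev l1) * b)).
    pose proof (blen_mul (ofbits (rev l1)) b).
    assert (H1 : blen (ofbits (rev l1)) <= blen a).
    { etransitivity; [apply blen_lt, ofbits_lt|]. rewrite length_rev.
      unfold blen. rewrite <- (length_rev (bits a)), El, length_app. lia. }
    pose proof (sz_blen a). pose proof (sz_blen b). rewrite sz_pair. lia.
  - pb.
Qed.

Ltac pt_binary ::=
  lazymatch goal with
  | |- PT _ (fun x => isnil (@?f x)) => apply (PT_isnil _ f)
  | |- PT _ (fun x => eqbl (@?f x) (@?g x)) => apply (PT_eqbl _ f g)
  | |- PT _ (fun x => bits (@?f x)) => apply (PT_bits _ f)
  | |- PT _ (fun x => ofbits (@?f x)) => apply (PT_ofbits _ f)
  | |- PT _ (fun x => N.eqb (@?f x) (@?g x)) => apply (PT_Neqb _ f g)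
  | |- PT _ (fun x => N.add (@?f x) (@?g x)) => apply (PT_Nadd _ f g)
  | |- PT _ (fun x => N.mul (@?f x) (@?g x)) => apply (PT_Nmul _ f g)
  end.

Lemma sz_tl {A} {EA : Enc A} (l : list A) : sz (tl l) <= sz l.
Proof. destruct l; simpl tl; rewrite ?sz_cons; lia. Qed.

Lemma sz_hd_tl {A} {EA : Enc A} (d : A) l : sz (List.hd d l) + sz (tl l) <= sz l + sz d.
Proof. destruct l; simpl tl; simpl List.hd; rewrite ?sz_cons; lia. Qed.

Lemma sz_rev {A} {EA : Enc A} (l : list A) : sz (rev l) = sz l.
Proof.
  induction l as [|a l IH]; [easy|]. simpl rev. pose proof (sz_app (rev l) [a]) as H.
  rewrite (sz_cons a []), (@sz_nil A) in H. rewrite sz_cons. lia.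
Qed.

Lemma PT_Nof_nat {X} {EX : Enc X} (mu : X -> nat) (f : X -> nat) :
  PT mu f -> PT mu (fun x => N.of_nat (f x)).
Proof.
  intros Hf. pose proof (PT_size _ _ Hf) as Hs.
  assert (E : forall n, Nat.iter n (fun m => m + 1)%N 0%N = N.of_nat n)
    by (induction n as [|n IH]; [easy|]; rewrite Nat.iter_succ, IH; lia).
  apply (PT_ext mu (fun x => Nat.iter (f x) (fun m => m + 1)%N 0%N)); [intros; apply E|].
  apply (PT_iter mu f (fun _ => 0%N) (fun _ m => m + 1)%N (fun x => 4 * sz (f x) + 1)); try pt; [|pb].
  intros x m Hm. rewrite E. pose proof (sz_blen (N.of_nat m)). rewrite sz_nat.
  assert (blen (N.of_nat m) <= m).
  { apply blen_lt. change 2%N with (N.of_nat 2). rewrite <- Nat2N.inj_pow.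
    pose proof (Nat.pow_gt_lin_r 2 m). lia. }
  lia.
Qed.

(** The last match wins, which makes the search a plain fold. *)
Definition assoc {A} (k : list bool) (l : list (list bool * A)) (d : A) : A :=
  fold_left (fun r p => if eqbl (fst p) k then snd p else r) l d.

Lemma PT_assoc {X A} {EX : Enc X} {EA : Enc A} (mu : X -> nat) k (l : X -> list (list bool * A)) d :
  PT mu k -> PT mu l -> PT mu d -> PT mu (fun x => assoc (k x) (l x) (d x)).
Proof.
  intros Hk Hl Hd.
  apply (PT0_comp mu (fun x => (k x, (l x, d x)))
     (fun z => assoc (fst z) (fst (snd z)) (snd (snd z)))); [|pt].
  unfold assoc.
  apply (PT_fold_additive _ (fun z : list bool * (list (list bool * A) * A) => fst (snd z))
    (fun z => snd (snd z)) (fun z r p => if eqbl (fst p) (fst z) then snd p else r)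
    (fun z => sz (snd z))); try pt.
  - intros x b [a1 a2]. simpl fst; simpl snd. rewrite sz_pair. destruct (eqbl _ _); lia.
  - apply (pb_le _ (fun z => sz z)); [|apply pb_addl]. intros [x a]. rewrite sz_pair. simpl. lia.
Qed.

Lemma assoc_in {A} (l : list (list bool * A)) k a d :
  NoDup (map fst l) -> In (k, a) l -> assoc k l d = a.
Proof.
  unfold assoc. revert d. induction l as [|[k' a'] l IH]; intros d Hn Hin; [easy|].
  inversion Hn as [|? ? Hk Hn']; subst. destruct Hin as [[= -> ->]|Hin]; simpl.
  - rewrite (proj2 (eqbl_spec k k) eq_refl). simpl in Hk. clear - Hk.
    induction l as [|[k' a'] l IH]; simpl; [easy|]. simpl in Hk.
    destruct (eqbl k' k) eqn:E; [apply eqbl_spec in E; tauto|]. apply IH. tauto.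
  - now apply IH.
Qed.

Lemma assoc_prop {A} (P : A -> Prop) u (l : list (list bool * A)) a :
  P a -> (forall p, In p l -> P (snd p)) -> P (assoc u l a).
Proof.
  unfold assoc. revert a. induction l as [|p l IH]; intros a Ha Hl; simpl; [easy|].
  apply IH; [|intros; apply Hl; now right].
  destruct (eqbl (fst p) u); [apply Hl; now left|easy].
Qed.

(** * Parsing *)

(** One round of a total parser, which gets as many rounds as there are bits; the flag freezes it at
    the terminator. The state holds the bits read, latest first, the rest of the input and the
    flag. *)
Definition pn_step (s : list bool * (list bool * bool)) : list bool * (list bool * bool) :=
  let r := fst (snd s) in
  if snd (snd s) then s
  else if List.hd false r then (List.hd false (tl r) :: fst s, (tl (tl r), false))
  else (fst s, (tl (tl r), true)).

Definition pn_run (l : list bool) : list bool * (list bool * bool) :=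
  fold_left (fun s _ => pn_step s) l ([], (l, false)).

Definition parse_N (l : list bool) : N * list bool :=
  (ofbits (rev (fst (pn_run l))), fst (snd (pn_run l))).

(** Size only passes from the input to the value, up to [c]; this keeps the loop of [parse_list]
    polynomial. *)
Definition growth {A} {EA : Enc A} (p : list bool -> A * list bool) (c : nat) : Prop :=
  forall r, sz (fst (p r)) + sz (snd (p r)) <= sz r + c.

Lemma pn_step_sz s : sz (fst (pn_step s)) + sz (fst (snd (pn_step s))) <= sz (fst s) + sz (fst (snd s)).
Proof.
  destruct s as [acc [r c]]. unfold pn_step. simpl fst; simpl snd.
  destruct c; simpl fst; simpl snd; [lia|].
  destruct r as [|[] r]; simpl List.hd; simpl tl; simpl fst; simpl snd; rewrite ?sz_cons; [lia| |].
  - pose proof (sz_hd_tl false r). rewrite sz_true. rewrite sz_false in *. lia.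
  - pose proof (sz_tl r). lia.
Qed.

Lemma PT_parse_N : PT0 parse_N.
Proof.
  assert (H : PT0 pn_run).
  { unfold pn_run.
    apply (PT_fold_additive _ (fun l => l) (fun l => ([], (l, false))) (fun _ s _ => pn_step s)
             (fun _ => 2)); try pt.
    - apply (PT0_comp _ (fun z : list bool * (list bool * (list bool * bool) * bool) => fst (snd z)) pn_step); [|pt].
      unfold pn_step. pt.
    - intros _ s _. pose proof (pn_step_sz s) as H.
      destruct s as [acc [r c]], (pn_step (acc, (r, c))) as [acc' [r' c']].
      simpl fst in H. simpl snd in H. rewrite !sz_pair.
      pose proof (sz_bool_le c'). pose proof (sz_pos c). simpl in H. lia.
    - apply pb_const. }
  assert (H' : PT0 (fun l => pn_run l)) by exact H.
  change (PT0 (fun l => parse_N l)). unfold parse_N. pt.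
Qed.

Lemma sz_ofbits l : sz (ofbits l) <= sz l.
Proof.
  induction l as [|b l IH]; [easy|].
  change (ofbits (b :: l)) with (if b then N.succ_double (ofbits l) else N.double (ofbits l)).
  rewrite sz_N in *. rewrite sz_cons. destruct b.
  - rewrite bits_succ_double, sz_cons. lia.
  - rewrite bits_double. destruct (bits (ofbits l)) eqn:E; [rewrite sz_nil; lia|].
    rewrite <- E in *. rewrite sz_cons. lia.
Qed.

Lemma growth_parse_N : growth parse_N 1.
Proof.
  intros l. unfold parse_N. simpl fst. simpl snd.
  pose proof (sz_ofbits (rev (fst (pn_run l)))) as H. rewrite sz_rev in H.
  enough (sz (fst (pn_run l)) + sz (fst (snd (pn_run l))) <= sz l + 1) by lia.
  unfold pn_run.
  assert (G : forall k s, sz (fst s) + sz (fst (snd s)) <= sz l + 1 ->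
    sz (fst (fold_left (fun s (_ : bool) => pn_step s) k s)) +
    sz (fst (snd (fold_left (fun s (_ : bool) => pn_step s) k s))) <= sz l + 1).
  { induction k as [|b k IH]; intros s Hs; [exact Hs|]. simpl. apply IH.
    pose proof (pn_step_sz s). lia. }
  apply G. simpl fst. simpl snd. rewrite (@sz_nil bool). lia.
Qed.

Lemma parse_N_spec n rest : parse_N (enc_nat n ++ rest) = (N.of_nat n, rest).
Proof.
  assert (Hd : forall k acc r, fold_left (fun s (_ : bool) => pn_step s) k (acc, (r, true)) = (acc, (r, true))).
  { induction k as [|b k IH]; intros acc r; [easy|exact (IH acc r)]. }
  assert (G : forall l acc (k : list bool), length l < length k ->
    fold_left (fun s _ => pn_step s) k
      (acc, (concat (map (fun b => [true; b]) l) ++ false :: false :: rest, false)) =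
    (rev l ++ acc, (rest, true))).
  { induction l as [|b l IH]; intros acc [|a k] Hk; simpl in Hk; try lia.
    - simpl. change (pn_step (acc, (false :: false :: rest, false))) with (acc, (rest, true)).
      apply Hd.
    - simpl fold_left. unfold pn_step at 2. simpl. rewrite IH by lia. now rewrite <- app_assoc. }
  unfold parse_N.
  assert (E : pn_run (enc_nat n ++ rest) = (rev (nat_bits n), (rest, true))).
  { unfold pn_run, enc_nat. rewrite <- app_assoc. simpl app. rewrite G, app_nil_r; [easy|].
    rewrite length_app. generalize (nat_bits n) as l; induction l as [|b l IH]; simpl in *; [lia|]. lia. }
  rewrite E. simpl. rewrite rev_involutive. f_equal. apply ofbits_bits.
Qed.

Section ParseList.
Context {A : Type} {EA : Enc A}.
Variables (p : list bool -> A * list bool) (c : nat).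

Definition pl_step (s : list A * (list bool * bool)) : list A * (list bool * bool) :=
  let r := fst (snd s) in
  if snd (snd s) then s
  else if List.hd false r then (fst (p (tl r)) :: fst s, (snd (p (tl r)), false))
  else (fst s, (tl r, true)).

Definition pl_run (l : list bool) : list A * (list bool * bool) :=
  fold_left (fun s _ => pl_step s) l ([], (l, false)).

Definition parse_list (l : list bool) : list A * list bool :=
  (rev (fst (pl_run l)), fst (snd (pl_run l))).

Hypothesis Hg : growth p c.

Lemma pl_step_sz s :
  sz (fst (pl_step s)) + sz (fst (snd (pl_step s))) <= sz (fst s) + sz (fst (snd s)) + (c - 3).
Proof.
  destruct s as [acc [r d]]. unfold pl_step. simpl fst; simpl snd.
  destruct d; simpl fst; simpl snd; [lia|].
  destruct r as [|[] r]; simpl List.hd; simpl tl; simpl fst; simpl snd; rewrite ?sz_cons; [lia| |lia].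
  specialize (Hg r). rewrite sz_true. lia.
Qed.

Lemma PT_parse_list : PT0 p -> PT0 parse_list.
Proof.
  intros Hp.
  assert (H : PT0 pl_run).
  { unfold pl_run.
    apply (PT_fold_additive _ (fun l => l) (fun l => ([], (l, false))) (fun _ s _ => pl_step s)
             (fun _ => c + 2)); try pt.
    - apply (PT0_comp _ (fun z : list bool * (list A * (list bool * bool) * bool) => fst (snd z)) pl_step); [|pt].
      assert (Hp' : PT0 (fun s : list A * (list bool * bool) => p (tl (fst (snd s)))))
        by (apply (PT0_comp _ (fun s : list A * (list bool * bool) => tl (fst (snd s))) p Hp); pt).
      unfold pl_step. pt.
    - intros _ s _. pose proof (pl_step_sz s) as H.
      destruct s as [acc [r d]], (pl_step (acc, (r, d))) as [acc' [r' d']].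
      simpl fst in H. simpl snd in H. rewrite !sz_pair.
      pose proof (sz_bool_le d'). pose proof (sz_pos d). simpl in H. lia.
    - apply pb_const. }
  assert (H' : PT0 (fun l => pl_run l)) by exact H.
  change (PT0 (fun l => parse_list l)). unfold parse_list. pt.
Qed.

(** Reading an element frees 4, the size of its continuation bit with its cell, and spends 1 on a
    new cons cell; [c <= 3] therefore keeps the total from growing. *)
Lemma growth_parse_list : c <= 3 -> growth parse_list 1.
Proof.
  intros Hc l. unfold parse_list. simpl fst. simpl snd. rewrite sz_rev. unfold pl_run.
  assert (G : forall k s, sz (fst s) + sz (fst (snd s)) <= sz l + 1 ->
    sz (fst (fold_left (fun s (_ : bool) => pl_step s) k s)) +
    sz (fst (snd (fold_left (fun s (_ : bool) => pl_step s) k s))) <= sz l + 1).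
  { induction k as [|b k IH]; intros s Hs; [exact Hs|]. simpl. apply IH.
    pose proof (pl_step_sz s). lia. }
  apply G. simpl fst. simpl snd. rewrite (@sz_nil A). lia.
Qed.

Lemma parse_list_spec {B} (f : B -> list bool) (h : B -> A) l rest :
  (forall b rest, In b l -> p (f b ++ rest) = (h b, rest)) ->
  parse_list (enc_list f l ++ rest) = (map h l, rest).
Proof.
  intros Hp.
  assert (Hd : forall k acc r, fold_left (fun s (_ : bool) => pl_step s) k (acc, (r, true)) = (acc, (r, true))).
  { induction k as [|b k IH]; intros acc r; [easy|exact (IH acc r)]. }
  assert (G : forall m acc (k : list bool), (forall b, In b m -> In b l) -> length m < length k ->
    fold_left (fun s _ => pl_step s) k (acc, (enc_list f m ++ rest, false)) =
    (rev (map h m) ++ acc, (rest, true))).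
  { induction m as [|b m IH]; intros acc [|a k] Hin Hk; simpl in Hk; try lia.
    - unfold enc_list. simpl. change (pl_step (acc, (false :: rest, false))) with (acc, (rest, true)).
      apply Hd.
    - cbn [fold_left]. replace (enc_list f (b :: m) ++ rest) with (true :: f b ++ enc_list f m ++ rest)
        by (unfold enc_list; simpl; now rewrite !app_assoc).
      set (X := f b ++ enc_list f m ++ rest).
      change (pl_step (acc, (true :: X, false))) with (fst (p X) :: acc, (snd (p X), false)).
      unfold X. rewrite Hp by (apply Hin; now left). simpl fst. simpl snd. rewrite IH.
      + simpl. now rewrite <- app_assoc.
      + intros; apply Hin; now right.
      + lia. }
  unfold parse_list.
  assert (E : pl_run (enc_list f l ++ rest) = (rev (map h l), (rest, true))).
  { unfold pl_run. rewrite G, app_nil_r; [easy|auto|].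
    rewrite length_app. unfold enc_list. rewrite length_app. simpl. clear.
    induction l; simpl; rewrite ?length_app; lia. }
  rewrite E. simpl. now rewrite rev_involutive.
Qed.
End ParseList.

Open Scope nat_scope.

(** * Simulating a Turing machine *)

(* State, tape to the left and to the right of the head (the scanned symbol
   comes first on the right), numbers of right and of left moves made. *)
Notation zcfg := (nat * ((list nat * list nat) * (nat * nat)))%type.

Definition zapply (q b : nat) (m : move) (s : zcfg) : zcfg :=
  let l := fst (fst (snd s)) in let r := snd (fst (snd s)) in
  let i := fst (snd (snd s)) in let j := snd (snd (snd s)) in
  match m with
  | MvS => (q, ((l, b :: tl r), (i, j)))
  | MvR => (q, ((b :: l, tl r), (S i, j)))
  | MvL => (q, ((tl l, List.hd 0 l :: b :: tl r), (i, S j)))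
  end.

Fixpoint zstep (M : TM) (s : zcfg) : zcfg :=
  match M with
  | [] => s
  | (q0, a0, q', b, m) :: M' =>
      if (fst s =? q0) && (List.hd 0 (snd (fst (snd s))) =? a0) then zapply q' b m s
      else zstep M' s
  end.

(** Missing entries count as 0, the blank, so finite lists describe the whole tape. *)
Definition zrep (s : zcfg) (c : config) : Prop :=
  fst s = st c /\
  (forall j, nth j (snd (fst (snd s))) 0 = tp c (Defs.hd c + Z.of_nat j)%Z) /\
  (forall j, nth j (fst (fst (snd s))) 0 = tp c (Defs.hd c - 1 - Z.of_nat j)%Z) /\
  Defs.hd c = (Z.of_nat (fst (snd (snd s))) - Z.of_nat (snd (snd (snd s))))%Z.

Lemma nth_tl {A} (l : list A) j d : nth j (tl l) d = nth (S j) l d.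
Proof. destruct l; [now destruct j|easy]. Qed.

Lemma nth_0_hd {A} (l : list A) d : List.hd d l = nth 0 l d.
Proof. now destruct l. Qed.

Lemma zapply_rep q b m s c :
  zrep s c ->
  zrep (zapply q b m s) (Cfg q (Defs.hd c + mv m)%Z
         (fun z => if Z.eqb z (Defs.hd c) then b else tp c z)).
Proof.
  destruct s as [q0 [[l r] [i j]]], c as [q1 h t]. unfold zrep, zapply.
  cbn [fst snd st Defs.hd tp]. intros (_ & Hr & Hl & Hh).
  destruct m; cbn [fst snd mv]; (split; [easy|]); repeat split; try lia; intros n;
    match goal with |- context [Z.eqb ?a ?b] => destruct (Z.eqb_spec a b) as [E|E] end; try lia.
  - destruct n as [|[|n]]; try lia. reflexivity.
  - destruct n as [|[|n]]; cbn [nth]; try lia.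
    + rewrite nth_0_hd, Hl. f_equal; lia.
    + rewrite nth_tl, Hr. f_equal; lia.
  - rewrite nth_tl, Hl. f_equal; lia.
  - destruct n as [|n]; try lia. reflexivity.
  - destruct n as [|n]; try lia. cbn [nth]. rewrite nth_tl, Hr. f_equal; lia.
  - rewrite Hl. f_equal; lia.
  - rewrite nth_tl, Hr. f_equal; lia.
  - destruct n as [|n]; try lia. reflexivity.
  - destruct n as [|n]; try lia. cbn [nth]. rewrite Hl. f_equal; lia.
Qed.

Lemma zstep_rep M s c :
  zrep s c -> zrep (zstep M s) (match step M c with Some c' => c' | None => c end).
Proof.
  intros H. unfold step.
  assert (Ha : List.hd 0 (snd (fst (snd s))) = tp c (Defs.hd c)).
  { destruct H as (_ & Hr & _). rewrite nth_0_hd, Hr. f_equal; lia. }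
  assert (Hq : fst s = st c) by apply H.
  induction M as [|[[[[q0 a0] q'] b] m] M IH]; simpl; [easy|].
  rewrite Ha, Hq. destruct ((st c =? q0) && (tp c (Defs.hd c) =? a0)).
  - now apply zapply_rep.
  - exact IH.
Qed.

(** [zstep] leaves a halted configuration alone, as [exec] does, so rounds after the halt are
    harmless. *)
Lemma zsteps_rep M n : forall s c, zrep s c -> zrep (Nat.iter n (zstep M) s) (exec M n c).
Proof.
  induction n as [|n IH]; intros s c H; [easy|].
  rewrite Nat.iter_succ_r. simpl. pose proof (zstep_rep M s c H) as H'.
  destruct (step M c) as [c'|] eqn:E; [now apply IH|].
  specialize (IH _ _ H'). now rewrite exec_halted in IH.
Qed.

Definition zleft (t : list nat * list nat) : list nat * list nat :=
  (tl (fst t), List.hd 0 (fst t) :: snd t).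
Definition zright (t : list nat * list nat) : list nat * list nat :=
  (List.hd 0 (snd t) :: fst t, tl (snd t)).

(* Undoing all moves brings the head back to cell 0. *)
Definition zhome (s : zcfg) : list nat * list nat :=
  Nat.iter (snd (snd (snd s))) zright (Nat.iter (fst (snd (snd s))) zleft (fst (snd s))).

Lemma zhome_rep s c j : zrep s c -> nth j (snd (zhome s)) 0 = tp c (Z.of_nat j).
Proof.
  destruct s as [q [[l r] [i k]]], c as [q' h t]. unfold zrep, zhome.
  cbn [fst snd st Defs.hd tp]. intros (_ & Hr & Hl & Hh).
  set (P := fun h (u : list nat * list nat) =>
    (forall j, nth j (snd u) 0 = t (h + Z.of_nat j)%Z) /\
    (forall j, nth j (fst u) 0 = t (h - 1 - Z.of_nat j)%Z)).
  assert (H1 : forall n h u, P h u -> P (h - Z.of_nat n)%Z (Nat.iter n zleft u)).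
  { induction n as [|n IH]; intros h' u Hu; [simpl; now rewrite Z.sub_0_r|].
    rewrite Nat.iter_succ. destruct (IH _ _ Hu) as [I1 I2]. unfold zleft. split; intros m; cbn [fst snd].
    - destruct m; cbn [nth]; [rewrite nth_0_hd, I2|rewrite I1]; f_equal; lia.
    - rewrite nth_tl, I2. f_equal; lia. }
  assert (H2 : forall n h u, P h u -> P (h + Z.of_nat n)%Z (Nat.iter n zright u)).
  { induction n as [|n IH]; intros h' u Hu; [simpl; now rewrite Z.add_0_r|].
    rewrite Nat.iter_succ. destruct (IH _ _ Hu) as [I1 I2]. unfold zright. split; intros m; cbn [fst snd].
    - rewrite nth_tl, I1. f_equal; lia.
    - destruct m; cbn [nth]; [rewrite nth_0_hd, I1|rewrite I2]; f_equal; lia. }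
  destruct (H2 k _ _ (H1 i h (l, r) (conj Hr Hl))) as [H3 _]. rewrite H3. f_equal; lia.
Qed.

Lemma PT_zapply q b m : PT0 (zapply q b m).
Proof.
  change (PT0 (fun s => zapply q b m s)). unfold zapply. destruct m; pt.
Qed.

Lemma PT_zstep M : PT0 (zstep M).
Proof.
  induction M as [|[[[[q0 a0] q'] b] m] M IH]; simpl; [pt|].
  pt. apply (PT0_comp _ (fun s => s) _ (PT_zapply q' b m)). pt.
Qed.

Lemma zstep_sz M : exists c, forall s, sz (zstep M s) <= sz s + c.
Proof.
  induction M as [|[[[[q0 a0] q'] b] m] M [c IH]]; simpl.
  - exists 0. intros. lia.
  - exists (c + 2 * q' + 2 * b + 10). intros s.
    destruct ((fst s =? q0) && (List.hd 0 (snd (fst (snd s))) =? a0)).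
    + destruct s as [q1 [[l r] [i j]]]. unfold zapply. cbn [fst snd].
      pose proof (sz_tl r). pose proof (sz_hd_tl 0 l).
      destruct m; rewrite !sz_pair, ?sz_cons; rewrite !sz_nat in *; lia.
    + specialize (IH s). lia.
Qed.

Lemma sz_iter {A} {EA : Enc A} (g : A -> A) c :
  (forall s, sz (g s) <= sz s + c) -> forall n s, sz (Nat.iter n g s) <= sz s + n * c.
Proof.
  intros H n s. induction n as [|n IH]; [simpl; lia|]. rewrite Nat.iter_succ.
  specialize (H (Nat.iter n g s)). lia.
Qed.

Lemma PT_iter_additive {X A} {EX : Enc X} {EA : Enc A} (mu : X -> nat)
    (n : X -> nat) (i : X -> A) (g : A -> A) c :
  PT mu n -> PT mu i -> PT0 g -> (forall s, sz (g s) <= sz s + c) ->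
  PT mu (fun x => Nat.iter (n x) g (i x)).
Proof.
  intros Hn Hi Hg Hc. pose proof (PT_size _ _ Hn) as Sn. pose proof (PT_size _ _ Hi) as Si.
  apply (PT_iter mu n i (fun _ => g) (fun x => sz (i x) + sz (n x) * c)); [pt|pt| | |pb].
  - apply (PT0_comp _ (fun z => snd z) g Hg). pt.
  - intros x m Hm. pose proof (sz_iter g c Hc m (i x)). rewrite sz_nat. nia.
Qed.

Lemma PT_zhome : PT0 zhome.
Proof.
  change (PT0 (fun s => zhome s)). unfold zhome.
  apply (PT_iter_additive _ (fun s : zcfg => snd (snd (snd s)))
    (fun s : zcfg => Nat.iter (fst (snd (snd s))) zleft (fst (snd s))) zright 3).
  - pt.
  - apply (PT_iter_additive _ (fun s : zcfg => fst (snd (snd s)))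
      (fun s : zcfg => fst (snd s)) zleft 3); [pt|pt| |].
    + change (PT0 (fun s => zleft s)). unfold zleft. pt.
    + intros [l r]. unfold zleft. cbn [fst snd]. rewrite !sz_pair, sz_cons.
      pose proof (sz_hd_tl 0 l). rewrite !sz_nat in *. lia.
  - change (PT0 (fun s => zright s)). unfold zright. pt.
  - intros [l r]. unfold zright. cbn [fst snd]. rewrite !sz_pair, sz_cons.
    pose proof (sz_hd_tl 0 r). rewrite !sz_nat in *. lia.
Qed.

Lemma read_bits_nth t f : forall i j, j < length (read_bits t i f) ->
  t (i + Z.of_nat j)%Z = sym (nth j (read_bits t i f) false).
Proof.
  induction f as [|f IH]; intros i j; simpl; [lia|].
  destruct (t i) as [|[|[|n]]] eqn:E; simpl; try lia; intros Hj;
    (destruct j as [|j]; [rewrite Z.add_0_r, E; reflexivity|]);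
    (replace (i + Z.of_nat (S j))%Z with (i + 1 + Z.of_nat j)%Z by lia; apply IH; lia).
Qed.

(** The machine for [r] is simulated within the class: its time bound is polynomial in the unary [n]
    and can serve as the number of rounds of a loop. *)
Lemma in_Rp_PT r :
  in_Rp r -> exists f : nat -> N, PT0 f /\
    forall n, (INR (N.to_nat (f n)) <= r * 2 ^ n < INR (N.to_nat (f n)) + 1)%R.
Proof.
  intros (_ & M & c & H).
  set (z := fun n => Nat.iter (c * (n + 1) ^ c) (zstep M)
                       (0, (([], map (fun _ => 2) (repeat tt n)), (0, 0)))).
  exists (fun n => fst (parse_N (map (fun a => a =? 2) (snd (zhome (z n)))))).
  destruct (zstep_sz M) as [e He]. split.
  - apply PT_fst.
    apply (PT0_comp _ (fun n => map (fun a => a =? 2) (snd (zhome (z n)))) _ PT_parse_N).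
    apply PT_map; [|pt]. apply PT_snd. apply (PT0_comp _ z _ PT_zhome).
    apply (PT_iter_additive _ _ _ (zstep M) e); [pt| |apply PT_zstep|exact He].
    pt. apply PT_map; pt. exact (PT_repeat_tt _ (fun n => n) (PT_id _)).
  - intros n. specialize (H n). cbv zeta in H. destruct H as (_ & a & Ho & Ha).
    set (cf := exec M (c * (n + 1) ^ c) (init (map sym (repeat true n)))) in *.
    assert (Hz : zrep (z n) cf).
    { apply zsteps_rep. unfold zrep, init. cbn [fst snd st Defs.hd tp]. repeat split.
      - intros j. destruct (Z.ltb_spec (0 + Z.of_nat j) 0); [lia|].
        replace (Z.to_nat (0 + Z.of_nat j)) with j by lia. f_equal.
        clear. induction n; simpl; congruence.
      - intros j. destruct (Z.ltb_spec (0 - 1 - Z.of_nat j) 0); [|lia]. now destruct j. }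
    set (R := snd (zhome (z n))).
    assert (HR : forall j, nth j R 0 = tp cf (Z.of_nat j)).
    { intros j. now apply zhome_rep. }
    (* The simulated tape goes on behind the output; the code of a number is self-delimiting, so the
       parser stops in time. *)
    assert (Hp : exists rest, map (fun a => a =? 2) R = enc_nat a ++ rest).
    { unfold output in Ho. rewrite <- Ho.
      pose proof (read_bits_nth (tp cf) (length (map sym (repeat true n)) + 2 * (c * (n + 1) ^ c) + 2) 0) as Hn.
      set (o := read_bits _ _ _) in *. clearbody o R. clear - HR Hn.
      assert (Hn' : forall j, j < length o -> nth j R 0 = sym (nth j o false))
        by (intros j Hj; rewrite HR; now apply Hn).
      clear - Hn'. revert R Hn'. induction o as [|b o IH]; intros R Hn; [now exists (map (fun a => a =? 2) R)|].
      destruct R as [|x R].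
      - specialize (Hn 0 ltac:(simpl; lia)). now destruct b.
      - destruct (IH R) as [rest Hr].
        { intros j Hj. apply (Hn (S j)). simpl. lia. }
        exists rest. simpl. rewrite Hr. f_equal.
        specialize (Hn 0 ltac:(simpl; lia)). simpl in Hn. subst x. now destruct b. }
    destruct Hp as [rest Hp]. rewrite Hp, parse_N_spec. cbn [fst]. now rewrite Nat2N.id.
Qed.

Open Scope nat_scope.

(** * The algorithm *)

(* A constraint argument is a variable [(true, key)] or, once pinned, a constant
   [cst b]; this coding makes pinning never increase the size. *)
Notation key := (list bool).
Notation atom := (bool * list bool)%type.
Notation clause := (list (bool * list bool)).

Definition cst (b : bool) : atom := (false, if b then [false] else []).
Definition aval (x : key -> bool) (a : atom) : bool :=
  if fst a then x (snd a) else negb (isnil (snd a)).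
Definition is_var (u : key) (a : atom) : bool := fst a && eqbl (snd a) u.
Definition pin (u : key) (b : bool) (s : clause) : clause :=
  map (fun a => if is_var u a then cst b else a) s.
Definition vars (s : clause) : clause := filter fst s.
Definition occ (u : key) (s : clause) : bool := negb (isnil (filter (is_var u) s)).

Definition occ_step (u : key) (s : clause) (C : list clause)
    (st : list clause * list (list clause * (clause * clause))) :=
  if occ u s
  then (pin u true s :: fst st,
        (fst st ++ map (pin u false) C, (pin u true s, pin u false s)) :: snd st)
  else (s :: fst st, snd st).

(* The clauses around [u], each with the rest of the instance: the clauses
   before it have [u] pinned to 1 and those after it have [u] pinned to 0. *)
Definition occs (u : key) (C : list clause) : list (list clause * (clause * clause)) :=
  snd (floop (occ_step u) C ([], [])).

(** [m] holds odds m1 : m0 for the values 1 and 0, while [e1] and [e0] are fractions. This is the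
    mean (m1 e1 + m0 e0) / (m1 + m0); [combine_marg] multiplies the odds by e1 / e0. *)
Definition combine_eval (m e1 e0 : N * N) : N * N :=
  ((fst m * fst e1 * snd e0 + snd m * fst e0 * snd e1)%N,
   ((fst m + snd m) * (snd e1 * snd e0))%N).
Definition combine_marg (m e1 e0 : N * N) : N * N :=
  ((fst m * fst e1 * snd e0)%N, (snd m * fst e0 * snd e1)%N).

Section Algorithm.
Variables (w : key -> N * N) (g : list bool -> N) (k : nat).

(* [evalc f mg C s] represents the expectation of [g] on clause [s] under the
   Gibbs measure of [C] as a fraction, given odds [mg C u] for the marginals. *)
Fixpoint evalc (f : nat) (mg : list clause -> key -> N * N) (C : list clause) (s : clause) : N * N :=
  match vars s with
  | [] => (g (map (aval (fun _ => false)) s), 1%N)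
  | a :: _ =>
      match f with
      (* Not reached as long as [f] is at least the number of variables of [s]. *)
      | O => (0%N, 1%N)
      | S f =>
          let u := snd a in
          combine_eval (mg C u) (evalc f mg (map (pin u true) C) (pin u true s))
                                (evalc f mg (map (pin u false) C) (pin u false s))
      end
  end.

(** [l] is the depth at which the recursion is cut off. The odds 1 : 1 answered there still define a
    probability, so they err by at most 1. *)
Fixpoint marg (l : nat) (C : list clause) (u : key) : N * N :=
  match l with
  | O => (1%N, 1%N)
  | S l =>
      fold_left (fun m o => combine_marg m (evalc k (marg l) (fst o) (fst (snd o)))
                                           (evalc k (marg l) (fst o) (snd (snd o))))
                (occs u C) (w u)
  end.
End Algorithm.

Lemma is_var_spec u a : is_var u a = true <-> a = (true, u).
Proof.
  unfold is_var. destruct a as [[] v]; simpl; split; try easy.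
  - intros H. apply eqbl_spec in H. congruence.
  - intros [= ->]. now apply eqbl_spec.
Qed.

Lemma occ_spec u s : occ u s = true <-> In (true, u) s.
Proof.
  unfold occ. split.
  - intros H. destruct (filter (is_var u) s) as [|a l] eqn:E; [easy|].
    assert (Ha : In a (filter (is_var u) s)) by (rewrite E; now left).
    apply filter_In in Ha. destruct Ha as [Ha Hv]. apply is_var_spec in Hv. congruence.
  - intros H. assert (Ha : In (true, u) (filter (is_var u) s)).
    { apply filter_In. split; [easy|]. now apply is_var_spec. }
    now destruct (filter (is_var u) s).
Qed.

Lemma pin_notin u b s : occ u s = false -> pin u b s = s.
Proof.
  intros H. unfold pin. rewrite <- (map_id s) at 2. apply map_ext_in. intros a Ha.
  destruct (is_var u a) eqn:E; [|easy]. apply is_var_spec in E. subst.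
  apply occ_spec in Ha. congruence.
Qed.

Lemma in_pin u b s v : In (true, v) (pin u b s) -> In (true, v) s /\ v <> u.
Proof.
  unfold pin. rewrite in_map_iff. intros (a & E & Ha). destruct (is_var u a) eqn:V.
  - destruct b; discriminate.
  - subst. split; [easy|]. intros ->. now rewrite (proj2 (is_var_spec u (true, u)) eq_refl) in V.
Qed.

Lemma length_pin u b s : length (pin u b s) = length s.
Proof. apply length_map. Qed.

Lemma vars_pin_lt u b s : In (true, u) s -> length (vars (pin u b s)) < length (vars s).
Proof.
  assert (Hle : forall s, length (vars (pin u b s)) <= length (vars s)).
  { induction s0 as [|a s0 IH]; simpl; [lia|]. destruct (is_var u a) eqn:V.
    - simpl. destruct (fst a); simpl; unfold vars, pin in *; lia.
    - destruct (fst a); simpl; unfold vars, pin in *; lia. }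
  induction s as [|a s IH]; [easy|]. intros [->|H]; simpl.
  - rewrite (proj2 (is_var_spec u (true, u)) eq_refl). simpl. specialize (Hle s).
    unfold vars, pin in *. lia.
  - specialize (IH H). destruct (is_var u a); simpl; destruct (fst a); simpl; unfold vars, pin in *; lia.
Qed.

Lemma vars_in s a l : vars s = a :: l -> In (true, snd a) s.
Proof.
  intros E. assert (H : In a (vars s)) by (rewrite E; now left).
  apply filter_In in H. destruct H as [H Hv]. destruct a as [[] v]; [easy|discriminate].
Qed.

Lemma vars_nil s x y : vars s = [] -> map (aval x) s = map (aval y) s.
Proof.
  intros E. apply map_ext_in. intros [[] v] Ha; [|easy].
  assert (H : In (true, v) (vars s)) by (now apply filter_In). now rewrite E in H.
Qed.

Lemma vars_length s : length (vars s) <= length s.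
Proof. induction s as [|a s IH]; simpl; [lia|]. destruct (fst a); simpl; unfold vars in *; lia. Qed.

(** Structural counterpart of [occs] for use in inductions; [P] contains the clauses already passed,
    with [u] pinned to 1. *)
Fixpoint occs_rec (u : key) (P C : list clause) : list (list clause * (clause * clause)) :=
  match C with
  | [] => []
  | s :: C =>
      if occ u s
      then (P ++ map (pin u false) C, (pin u true s, pin u false s)) :: occs_rec u (pin u true s :: P) C
      else occs_rec u (s :: P) C
  end.

Lemma occs_rev u C : occs u C = rev (occs_rec u [] C).
Proof.
  unfold occs. rewrite <- (app_nil_r (rev _)). generalize (@nil (list clause * (clause * clause))) as acc.
  generalize (@nil clause) as P. induction C as [|s C IH]; intros P acc; [easy|].
  cbn [floop]. unfold occ_step at 2. cbn [occs_rec]. destruct (occ u s); cbn [fst snd]; rewrite IH.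
  - simpl. now rewrite <- app_assoc.
  - easy.
Qed.

(** Counts clauses rather than positions, hence is at most the degree in the sense of [valid]. *)
Definition deg (C : list clause) (u : key) : nat := length (filter (occ u) C).

Lemma length_occs_rec u C : forall P, length (occs_rec u P C) = deg C u.
Proof.
  unfold deg. induction C as [|s C IH]; intros P; simpl; [easy|].
  destruct (occ u s); simpl; now rewrite IH.
Qed.

Lemma occ_pin u v b s : occ v (pin u b s) = true -> occ v s = true.
Proof. rewrite !occ_spec. now intros [H _]%in_pin. Qed.

Lemma deg_pin u v b C : deg (map (pin u b) C) v <= deg C v.
Proof.
  unfold deg. induction C as [|s C IH]; simpl; [lia|].
  pose proof (occ_pin u v b s). destruct (occ v (pin u b s)).
  - rewrite H by easy. simpl. lia.
  - destruct (occ v s); simpl; lia.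
Qed.

Lemma deg_app C C' u : deg (C ++ C') u = deg C u + deg C' u.
Proof. unfold deg. now rewrite filter_app, length_app. Qed.

Lemma deg_cons s C u : deg (s :: C) u = (if occ u s then 1 else 0) + deg C u.
Proof. unfold deg. simpl. now destruct (occ u s). Qed.

(** A clause is missing from its own environment, so each of its variables loses one unit of degree
    there; this is where d - 1 comes from. *)
Lemma occs_rec_deg u o : forall C P, In o (occs_rec u P C) ->
  forall v, deg (fst o) v + (if occ v (fst (snd o)) then 1 else 0) <= deg P v + deg C v.
Proof.
  induction C as [|s C IH]; intros P Ho v; [easy|]. cbn [occs_rec] in Ho. rewrite deg_cons.
  destruct (occ u s) eqn:E.
  - destruct Ho as [<-|Ho]; cbn [fst snd].
    + rewrite deg_app. pose proof (deg_pin u v false C). pose proof (occ_pin u v true s).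
      destruct (occ v (pin u true s)); [rewrite H0 by easy; lia|lia].
    + specialize (IH _ Ho v). rewrite deg_cons in IH. pose proof (occ_pin u v true s).
      destruct (occ v (pin u true s)); [rewrite H by easy; lia|lia].
  - specialize (IH _ Ho v). rewrite deg_cons in IH. lia.
Qed.

Lemma occs_rec_in u o : forall C P, In o (occs_rec u P C) ->
  (exists s, In s C /\ occ u s = true /\ fst (snd o) = pin u true s /\ snd (snd o) = pin u false s) /\
  forall t, In t (fst o) -> In t P \/ exists s b, In s C /\ (t = s \/ t = pin u b s).
Proof.
  induction C as [|s C IH]; intros P Ho; [easy|]. cbn [occs_rec] in Ho.
  destruct (occ u s) eqn:E.
  - destruct Ho as [<-|Ho]; cbn [fst snd].
    + split; [exists s; simpl; auto|]. intros t Ht. apply in_app_or in Ht.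
      destruct Ht as [Ht|Ht]; [now left|]. apply in_map_iff in Ht. destruct Ht as (s' & <- & Hs).
      right. exists s', false. simpl. auto.
    + destruct (IH _ Ho) as [(s' & H1 & H2) H3]. split; [exists s'; simpl; auto|].
      intros t Ht. destruct (H3 t Ht) as [[<-|H]|(s'' & b & H)].
      * right. exists s, true. simpl. auto.
      * now left.
      * right. exists s'', b. simpl. tauto.
  - destruct (IH _ Ho) as [(s' & H1 & H2) H3]. split; [exists s'; simpl; auto|].
    intros t Ht. destruct (H3 t Ht) as [[<-|H]|(s'' & b & H)].
    * right. exists s, true. simpl. auto.
    * now left.
    * right. exists s'', b. simpl. tauto.
Qed.

Open Scope R_scope.

(** * Correlation decay *)

Definition nr (n : N) : R := IZR (Z.of_N n).

Lemma nr_add m n : nr (m + n) = nr m + nr n.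
Proof. unfold nr. now rewrite N2Z.inj_add, plus_IZR. Qed.

Lemma nr_mul m n : nr (m * n) = nr m * nr n.
Proof. unfold nr. now rewrite N2Z.inj_mul, mult_IZR. Qed.

Lemma nr_ge0 n : 0 <= nr n.
Proof. unfold nr. apply IZR_le. lia. Qed.

Lemma nr_pos n : n <> 0%N -> 0 < nr n.
Proof. intros H. unfold nr. apply IZR_lt. lia. Qed.

Lemma nr_pos_inv n : 0 < nr n -> n <> 0%N.
Proof. intros H ->. unfold nr in H. simpl in H. lra. Qed.

Lemma nr_1 : nr 1 = 1.
Proof. reflexivity. Qed.

(** The value of a fraction; [rm] is the probability of the value 1 according to given odds. *)
Definition rv (e : N * N) : R := nr (fst e) / nr (snd e).
Definition rm (m : N * N) : R := nr (fst m) / (nr (fst m) + nr (snd m)).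

Definition prodf {A} (f : A -> R) (l : list A) : R := fold_right (fun o r => f o * r) 1 l.

Lemma prodf_app {A} (f : A -> R) l l' : prodf f (l ++ l') = prodf f l * prodf f l'.
Proof. induction l; simpl; [lra|]. rewrite IHl. lra. Qed.

Lemma prodf_rev {A} (f : A -> R) l : prodf f (rev l) = prodf f l.
Proof. induction l; simpl; [easy|]. rewrite prodf_app, IHl. simpl. lra. Qed.

Lemma prodf_pos {A} (f : A -> R) l : (forall o, In o l -> 0 < f o) -> 0 < prodf f l.
Proof.
  induction l as [|a l IH]; simpl; intros H; [lra|].
  apply Rmult_lt_0_compat; [apply H|apply IH; intros; apply H]; auto.
Qed.

Lemma wsum_pos c c' A B : 0 <= c -> 0 <= c' -> 0 < c + c' -> 0 < A -> 0 < B -> 0 < c * A + c' * B.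
Proof.
  intros Hc Hc' Hcc HA HB. destruct (Req_dec c 0) as [->|H].
  - assert (0 < c' * B) by (apply Rmult_lt_0_compat; lra). lra.
  - assert (0 < c * A) by (apply Rmult_lt_0_compat; lra).
    assert (0 <= c' * B) by (apply Rmult_le_pos; lra). lra.
Qed.

(* The product of the denominators is at least [4 c c' min (A B) (A' B')] by AM-GM. *)
Lemma ratio_step c c' A B A' B' lam tau :
  0 <= c -> 0 <= c' -> 0 < c + c' -> 0 < lam -> 0 <= tau ->
  lam <= A -> lam <= B -> lam <= A' -> lam <= B' ->
  Rabs (A * B' - A' * B) <= tau * lam * (A + B) ->
  Rabs (A * B' - A' * B) <= tau * lam * (A' + B') ->
  Rabs (c * A / (c * A + c' * B) - c * A' / (c * A' + c' * B')) <= tau / 2.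
Proof.
  intros Hc Hc' Hcc Hlam Htau HA HB HA' HB' H1 H2.
  assert (D1 : 0 < c * A + c' * B) by (apply wsum_pos; lra).
  assert (D2 : 0 < c * A' + c' * B') by (apply wsum_pos; lra).
  replace (c * A / (c * A + c' * B) - c * A' / (c * A' + c' * B'))
    with (c * c' * (A * B' - A' * B) / ((c * A + c' * B) * (c * A' + c' * B'))) by (field; lra).
  unfold Rdiv. rewrite Rabs_mult, Rabs_mult, (Rabs_pos_eq (c * c')) by nra.
  rewrite (Rabs_pos_eq (/ _)) by (left; apply Rinv_0_lt_compat; nra).
  apply Rmult_le_reg_r with ((c * A + c' * B) * (c * A' + c' * B')); [nra|].
  rewrite Rmult_assoc, Rinv_l, Rmult_1_r by nra.
  (* The squares of both sides are compared, so that AM-GM can be applied to each denominator by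
     itself. *)
  assert (Hmin : forall P P' Q Q' m, 0 < P -> 0 < P' -> 0 < Q -> 0 < Q' -> 0 < m -> m <= P * Q -> m <= P' * Q' ->
     4 * (c * c') * m <= (c * P + c' * Q) * (c * P' + c' * Q')).
  { intros P P' Q Q' m HP HP' HQ HQ' Hm Hm1 Hm2.
    assert (S1 : 4 * (c * c') * m <= (c * P + c' * Q) ^ 2).
    { assert (0 <= (c * P - c' * Q) ^ 2) by apply pow2_ge_0.
      assert (4 * (c * c') * m <= 4 * (c * c') * (P * Q)) by (apply Rmult_le_compat_l; [nra|easy]).
      lra. }
    assert (S2 : 4 * (c * c') * m <= (c * P' + c' * Q') ^ 2).
    { assert (0 <= (c * P' - c' * Q') ^ 2) by apply pow2_ge_0.
      assert (4 * (c * c') * m <= 4 * (c * c') * (P' * Q')) by (apply Rmult_le_compat_l; [nra|easy]).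
      lra. }
    apply Rsqr_incr_0_var;
      [|apply Rmult_le_pos; apply Rplus_le_le_0_compat; apply Rmult_le_pos; lra]. unfold Rsqr.
    set (x := 4 * (c * c') * m) in *. assert (0 <= x) by (unfold x; apply Rmult_le_pos; [|lra]; apply Rmult_le_pos; [lra|]; now apply Rmult_le_pos).
    replace ((c * P + c' * Q) * (c * P' + c' * Q') * ((c * P + c' * Q) * (c * P' + c' * Q')))
      with ((c * P + c' * Q) ^ 2 * (c * P' + c' * Q') ^ 2) by ring.
    apply Rmult_le_compat; lra. }
  assert (Hc2 : 0 <= c * c') by nra.
  destruct (Rle_dec (A * B) (A' * B')) as [Hm|Hm].
  - assert (K := Hmin A A' B B' (A * B) ltac:(lra) ltac:(lra) ltac:(lra) ltac:(lra) ltac:(nra) ltac:(lra) Hm).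
    (* Because 2 A B - lam (A + B) = A (B - lam) + B (A - lam). *)
    assert (G : lam * (A + B) <= 2 * (A * B)) by nra.
    assert (c * c' * Rabs (A * B' - A' * B) <= c * c' * (tau * (2 * (A * B)))).
    { apply Rmult_le_compat_l; [easy|]. etransitivity; [exact H1|]. rewrite Rmult_assoc.
      apply Rmult_le_compat_l; lra. }
    assert (tau * (4 * (c * c') * (A * B)) <= tau * ((c * A + c' * B) * (c * A' + c' * B')))
      by (apply Rmult_le_compat_l; lra).
    lra.
  - assert (K := Hmin A A' B B' (A' * B') ltac:(lra) ltac:(lra) ltac:(lra) ltac:(lra) ltac:(nra) ltac:(lra) ltac:(lra)).
    assert (G : lam * (A' + B') <= 2 * (A' * B')) by nra.
    assert (c * c' * Rabs (A * B' - A' * B) <= c * c' * (tau * (2 * (A' * B')))).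
    { apply Rmult_le_compat_l; [easy|]. etransitivity; [exact H2|]. rewrite Rmult_assoc.
      apply Rmult_le_compat_l; lra. }
    assert (tau * (4 * (c * c') * (A' * B')) <= tau * ((c * A + c' * B) * (c * A' + c' * B')))
      by (apply Rmult_le_compat_l; lra).
    lra.
Qed.

(** The factors are exchanged one at a time while all others are absorbed into [c] and [c']; as
    [ratio_step] is uniform in these, the errors just add up. *)
Lemma ratio_hybrid {O} (A B A' B' : O -> R) lam tau l :
  0 < lam -> 0 <= tau ->
  (forall o, In o l -> lam <= A o /\ lam <= B o /\ lam <= A' o /\ lam <= B' o /\
     Rabs (A o * B' o - A' o * B o) <= tau * lam * (A o + B o) /\
     Rabs (A o * B' o - A' o * B o) <= tau * lam * (A' o + B' o)) ->
  forall c c', 0 <= c -> 0 <= c' -> 0 < c + c' ->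
  Rabs (c * prodf A l / (c * prodf A l + c' * prodf B l) -
        c * prodf A' l / (c * prodf A' l + c' * prodf B' l)) <= INR (length l) * (tau / 2).
Proof.
  intros Hlam Htau. induction l as [|o l IH]; intros Ho c c' Hc Hc' Hcc.
  - simpl. rewrite Rminus_diag_eq, Rabs_R0 by easy. lra.
  - destruct (Ho o (or_introl eq_refl)) as (H1 & H2 & H3 & H4 & H5 & H6).
    assert (Ho' : forall o, In o l -> lam <= A o /\ lam <= B o /\ lam <= A' o /\ lam <= B' o /\
       Rabs (A o * B' o - A' o * B o) <= tau * lam * (A o + B o) /\
       Rabs (A o * B' o - A' o * B o) <= tau * lam * (A' o + B' o)) by (intros; apply Ho; now right).
    specialize (IH Ho' (c * A o) (c' * B o) ltac:(apply Rmult_le_pos; lra) ltac:(apply Rmult_le_pos; lra)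
      ltac:(apply wsum_pos; lra)).
    assert (P1 : 0 < prodf A' l) by (apply prodf_pos; intros o' Hi; destruct (Ho' o' Hi); lra).
    assert (P2 : 0 < prodf B' l) by (apply prodf_pos; intros o' Hi; destruct (Ho' o' Hi); lra).
    pose proof (ratio_step (c * prodf A' l) (c' * prodf B' l) (A o) (B o) (A' o) (B' o) lam tau
      ltac:(apply Rmult_le_pos; lra) ltac:(apply Rmult_le_pos; lra) ltac:(apply wsum_pos; lra) Hlam Htau H1 H2 H3 H4 H5 H6) as K.
    cbn [length]. rewrite S_INR. cbn [prodf fold_right].
    change (fold_right (fun o r => A o * r) 1 l) with (prodf A l).
    change (fold_right (fun o r => B o * r) 1 l) with (prodf B l).
    change (fold_right (fun o r => A' o * r) 1 l) with (prodf A' l).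
    change (fold_right (fun o r => B' o * r) 1 l) with (prodf B' l).
    replace (c * prodf A' l * A o) with (c * A o * prodf A' l) in K by ring.
    replace (c' * prodf B' l * B o) with (c' * B o * prodf B' l) in K by ring.
    replace (c * prodf A' l * A' o) with (c * (A' o * prodf A' l)) in K by ring.
    replace (c' * prodf B' l * B' o) with (c' * (B' o * prodf B' l)) in K by ring.
    rewrite <- !Rmult_assoc in *.
    eapply Rle_trans; [|eapply Rle_trans; [apply Rplus_le_compat; [exact IH|exact K]|lra]].
    eapply Rle_trans; [|apply Rabs_triang]. right. f_equal. ring.
Qed.

Definition setv (x : key -> bool) (u : key) (b : bool) : key -> bool :=
  fun v => if eqbl v u then b else x v.

Lemma setv_comm x u v b c : u <> v -> setv (setv x u b) v c = setv (setv x v c) u b.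
Proof.
  intros H. apply functional_extensionality. intros y. unfold setv.
  destruct (eqbl y v) eqn:E1, (eqbl y u) eqn:E2; try easy.
  apply eqbl_spec in E1, E2. congruence.
Qed.

Lemma setv_over x u b c : setv (setv x u b) u c = setv x u c.
Proof. apply functional_extensionality. intros y. unfold setv. now destruct (eqbl y u). Qed.

Section Gibbs.
Variables (w : key -> N * N) (g : list bool -> N) (k d : nat) (V : list key) (lam rho : R).
Hypothesis Hkpos : (1 <= k)%nat.
Hypothesis Hdpos : (1 <= d)%nat.
Hypothesis Hw : forall u, (fst (w u) + snd (w u) <> 0)%N.
Hypothesis Hlam : 0 < lam.
Hypothesis Hrho : 1 <= rho.
Hypothesis Hg : forall x, length x = k -> lam <= nr (g x) <= lam * rho.
Hypothesis HV : NoDup V.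

Definition q (u : key) (b : bool) : R :=
  (if b then nr (fst (w u)) else nr (snd (w u))) / (nr (fst (w u)) + nr (snd (w u))).

Lemma w_pos u : 0 < nr (fst (w u)) + nr (snd (w u)).
Proof. rewrite <- nr_add. apply nr_pos, Hw. Qed.

Lemma q_ge0 u b : 0 <= q u b.
Proof.
  pose proof (w_pos u). unfold q. apply Rmult_le_pos.
  - destruct b; apply nr_ge0.
  - left. now apply Rinv_0_lt_compat.
Qed.

Lemma q_sum u : q u true + q u false = 1.
Proof. pose proof (w_pos u). unfold q. field. lra. Qed.

(** The expectation of [phi] when the variables of [U] are drawn independently according to [q] and
    all others are read off [x]. *)
Fixpoint integ (U : list key) (phi : (key -> bool) -> R) (x : key -> bool) : R :=
  match U with
  | [] => phi x
  | v :: U => q v true * integ U phi (setv x v true) + q v false * integ U phi (setv x v false)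
  end.

Lemma integ_le U phi psi x : (forall y, phi y <= psi y) -> integ U phi x <= integ U psi x.
Proof.
  intros H. revert x. induction U as [|v U IH]; intros x; simpl; [apply H|].
  pose proof (IH (setv x v true)). pose proof (IH (setv x v false)).
  pose proof (q_ge0 v true). pose proof (q_ge0 v false). nra.
Qed.

Lemma integ_scal U c phi x : integ U (fun y => c * phi y) x = c * integ U phi x.
Proof. revert x. induction U as [|v U IH]; intros x; simpl; [easy|]. rewrite !IH. ring. Qed.

Lemma integ_const U c x : integ U (fun _ => c) x = c.
Proof.
  revert x. induction U as [|v U IH]; intros x; simpl; [easy|]. rewrite !IH.
  pose proof (q_sum v). nra.
Qed.

Lemma integ_setv U phi v b : ~ In v U -> forall x,
  integ U (fun y => phi (setv y v b)) x = integ U phi (setv x v b).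
Proof.
  induction U as [|u U IH]; intros Hv x; simpl; [easy|].
  rewrite !IH by (intros H; apply Hv; now right).
  rewrite !(setv_comm x v u) by (intros ->; apply Hv; now left). easy.
Qed.

(** Overriding [u] after all draws has the same effect as drawing that value, because [U] has no
    repetitions. *)
Lemma integ_split U phi u : NoDup U -> In u U -> forall x,
  integ U phi x = q u true * integ U (fun y => phi (setv y u true)) x +
                  q u false * integ U (fun y => phi (setv y u false)) x.
Proof.
  induction U as [|v U IH]; intros Hn Hu x; [easy|]. inversion Hn as [|? ? Hv Hn']; subst.
  destruct Hu as [->|Hu]; simpl.
  - rewrite !integ_setv, !setv_over by easy. pose proof (q_sum u).
    set (a := integ U phi (setv x u true)). set (b := integ U phi (setv x u false)). nra.
  - rewrite (IH Hn' Hu (setv x v true)), (IH Hn' Hu (setv x v false)). ring.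
Qed.

Definition Phi (C : list clause) (x : key -> bool) : R := prodf (fun s => nr (g (map (aval x) s))) C.

Lemma aval_pin x u b s : map (aval x) (pin u b s) = map (aval (setv x u b)) s.
Proof.
  unfold pin. rewrite map_map. apply map_ext. intros a. destruct (is_var u a) eqn:E.
  - apply is_var_spec in E. subst. unfold aval, cst, setv. simpl.
    rewrite (proj2 (eqbl_spec u u) eq_refl). now destruct b.
  - unfold aval, setv. destruct a as [[] v]; simpl; [|easy].
    unfold is_var in E. simpl in E. now rewrite E.
Qed.

Lemma Phi_pin u b C x : Phi (map (pin u b) C) x = Phi C (setv x u b).
Proof.
  unfold Phi. induction C as [|s C IH]; simpl; [easy|]. now rewrite IH, aval_pin.
Qed.

Definition x0 : key -> bool := fun _ => false.
(** The partition function divided by the total weights of the variables, so that the instance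
    without clauses has value 1. *)
Definition Zc (C : list clause) : R := integ V (Phi C) x0.

Definition wfc (C : list clause) : Prop :=
  forall s, In s C -> length s = k /\ forall u, In (true, u) s -> In u V.

Lemma wfc_pin u b C : wfc C -> wfc (map (pin u b) C).
Proof.
  intros H s Hs. apply in_map_iff in Hs. destruct Hs as (t & <- & Ht).
  destruct (H t Ht) as [H1 H2]. rewrite length_pin. split; [easy|].
  intros v Hv. apply in_pin in Hv. now apply H2.
Qed.

Lemma wfc_cons s C : wfc (s :: C) <-> wfc [s] /\ wfc C.
Proof.
  unfold wfc. simpl. split.
  - intros H. split; intros t Ht; apply H; tauto.
  - intros [H1 H2] t [<-|Ht]; auto.
Qed.

Lemma wfc_incl C C' : (forall s, In s C' -> In s C) -> wfc C -> wfc C'.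
Proof. intros Hi H s Hs. apply H, Hi, Hs. Qed.

Lemma Phi_pos C x : wfc C -> 0 < Phi C x.
Proof.
  intros H. apply prodf_pos. intros s Hs. destruct (H s Hs) as [Hl _].
  pose proof (Hg (map (aval x) s) ltac:(now rewrite length_map)). lra.
Qed.

Lemma Phi_lower C x : wfc C -> lam ^ length C <= Phi C x.
Proof.
  induction C as [|s C IH]; intros H; simpl; [unfold Phi; simpl; lra|].
  apply wfc_cons in H. destruct H as [H1 H2]. destruct (H1 s (or_introl eq_refl)) as [Hl _].
  pose proof (Hg (map (aval x) s) ltac:(now rewrite length_map)).
  specialize (IH H2). assert (0 < lam ^ length C) by now apply pow_lt.
  change (Phi (s :: C) x) with (nr (g (map (aval x) s)) * Phi C x). nra.
Qed.

Lemma Zc_pos C : wfc C -> 0 < Zc C.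
Proof.
  intros H. apply Rlt_le_trans with (lam ^ length C); [now apply pow_lt|].
  unfold Zc. rewrite <- (integ_const V (lam ^ length C) x0). apply integ_le.
  intros y. now apply Phi_lower.
Qed.

Lemma Zc_split C u : In u V ->
  Zc C = q u true * Zc (map (pin u true) C) + q u false * Zc (map (pin u false) C).
Proof.
  intros Hu. unfold Zc at 1. rewrite (integ_split V (Phi C) u HV Hu). unfold Zc.
  f_equal; f_equal; f_equal; apply functional_extensionality; intros y; now rewrite Phi_pin.
Qed.

Lemma Zc_nil : Zc [] = 1.
Proof. unfold Zc, Phi. simpl. apply integ_const. Qed.

Lemma Zc_middle P s C : Zc (P ++ s :: C) = Zc (s :: P ++ C).
Proof.
  unfold Zc. f_equal. apply functional_extensionality. intros x. unfold Phi.
  simpl. rewrite !prodf_app. simpl. ring.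
Qed.

(** The mean of the factor of [s] under the Gibbs measure of [C], as a ratio of partition functions;
    [Pm] is the Gibbs probability that [u] is 1. *)
Definition Ex (C : list clause) (s : clause) : R := Zc (s :: C) / Zc C.
Definition Pm (C : list clause) (u : key) : R := q u true * Zc (map (pin u true) C) / Zc C.

Lemma Ex_Zc C s : wfc C -> Zc (s :: C) = Ex C s * Zc C.
Proof. intros H. pose proof (Zc_pos C H). unfold Ex. field. lra. Qed.

Lemma Ex_bounds C s : wfc (s :: C) -> lam <= Ex C s <= lam * rho.
Proof.
  intros H. apply wfc_cons in H. destruct H as [H1 H2]. destruct (H1 s (or_introl eq_refl)) as [Hl _].
  pose proof (Zc_pos C H2) as Hz.
  assert (lam * Zc C <= Zc (s :: C) <= lam * rho * Zc C).
  { unfold Zc. rewrite <- !integ_scal. split; apply integ_le; intros y;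
    change (Phi (s :: C) y) with (nr (g (map (aval y) s)) * Phi C y);
    pose proof (Hg (map (aval y) s) ltac:(now rewrite length_map));
    pose proof (Phi_pos C y H2); nra. }
  unfold Ex. split.
  - apply Rmult_le_reg_r with (Zc C); [easy|]. unfold Rdiv. rewrite Rmult_assoc, Rinv_l by lra. lra.
  - apply Rmult_le_reg_r with (Zc C); [easy|]. unfold Rdiv. rewrite Rmult_assoc, Rinv_l by lra. lra.
Qed.

Lemma Pm_compl C u : wfc C -> In u V -> 1 - Pm C u = q u false * Zc (map (pin u false) C) / Zc C.
Proof.
  intros H Hu. pose proof (Zc_pos C H). pose proof (Zc_split C u Hu) as E. unfold Pm.
  apply Rmult_eq_reg_r with (Zc C); [|lra]. field_simplify; [|lra|lra]. lra.
Qed.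

Lemma Pm_bounds C u : wfc C -> In u V -> 0 <= Pm C u <= 1.
Proof.
  intros H Hu. pose proof (Pm_compl C u H Hu) as Hc. pose proof (Zc_pos C H).
  assert (forall b, 0 <= q u b * Zc (map (pin u b) C) / Zc C).
  { intros b. pose proof (q_ge0 u b). pose proof (Zc_pos _ (wfc_pin u b C H)).
    apply Rmult_le_pos; [nra|]. left. now apply Rinv_0_lt_compat. }
  pose proof (H1 true). pose proof (H1 false). unfold Pm in *. lra.
Qed.

(** The law of total expectation: conditioning the Gibbs measure on the value of [u] amounts to
    pinning [u] in all clauses. *)
Lemma Ex_split C s u : wfc (s :: C) -> In u V ->
  Ex C s = Pm C u * Ex (map (pin u true) C) (pin u true s) +
           (1 - Pm C u) * Ex (map (pin u false) C) (pin u false s).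
Proof.
  intros H Hu. assert (HC : wfc C) by now apply wfc_cons in H.
  rewrite (Pm_compl C u HC Hu). unfold Ex at 1. rewrite (Zc_split (s :: C) u Hu).
  cbn [map]. rewrite !Ex_Zc by now apply wfc_pin.
  unfold Pm. pose proof (Zc_pos C HC). field. lra.
Qed.

Lemma Ex_const C s : wfc (s :: C) -> vars s = [] -> Ex C s = nr (g (map (aval (fun _ => false)) s)).
Proof.
  intros H Hs. assert (HC : wfc C) by now apply wfc_cons in H.
  pose proof (Zc_pos C HC). unfold Ex.
  replace (Zc (s :: C)) with (nr (g (map (aval (fun _ => false)) s)) * Zc C); [field; lra|].
  unfold Zc. rewrite <- integ_scal. f_equal. apply functional_extensionality. intros y.
  unfold Phi. simpl. now rewrite (vars_nil s y (fun _ => false) Hs).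
Qed.

(** The strict degree bound is the invariant of the recursion: marginals are requested only for
    variables of a clause that has been removed. *)
Definition goodM (C : list clause) (u : key) : Prop :=
  wfc C /\ In u V /\ (forall v, (deg C v <= d)%nat) /\ (deg C u < d)%nat.
Definition goodE (C : list clause) (s : clause) : Prop :=
  wfc (s :: C) /\ (forall v, (deg C v <= d)%nat) /\ (forall v, In (true, v) s -> (deg C v < d)%nat).

Lemma goodE_pin u b C s : goodE C s -> goodE (map (pin u b) C) (pin u b s).
Proof.
  intros (H1 & H2 & H3). split; [|split].
  - apply (wfc_pin u b (s :: C) H1).
  - intros v. pose proof (deg_pin u v b C). specialize (H2 v). lia.
  - intros v Hv. apply in_pin in Hv. destruct Hv as [Hv _]. pose proof (deg_pin u v b C).
    specialize (H3 v Hv). lia.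
Qed.

Lemma goodE_M C s a l : goodE C s -> vars s = a :: l -> goodM C (snd a).
Proof.
  intros (H1 & H2 & H3) E. apply vars_in in E. split; [|split; [|split]].
  - now apply wfc_cons in H1.
  - apply (H1 s (or_introl eq_refl)), E.
  - exact H2.
  - now apply H3.
Qed.

Definition marg_ok (mg : list clause -> key -> N * N) (delta : R) : Prop :=
  forall C u, goodM C u ->
    0 < nr (fst (mg C u)) + nr (snd (mg C u)) /\ Rabs (rm (mg C u) - Pm C u) <= delta.

Lemma rm_bounds m : 0 < nr (fst m) + nr (snd m) -> 0 <= rm m <= 1.
Proof.
  intros H. pose proof (nr_ge0 (fst m)). pose proof (nr_ge0 (snd m)). unfold rm. split.
  - apply Rmult_le_pos; [easy|]. left. now apply Rinv_0_lt_compat.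
  - apply Rmult_le_reg_r with (nr (fst m) + nr (snd m)); [easy|].
    unfold Rdiv. rewrite Rmult_assoc, Rinv_l by lra. lra.
Qed.

Lemma rv_combine m e1 e0 :
  0 < nr (fst m) + nr (snd m) -> 0 < nr (snd e1) -> 0 < nr (snd e0) ->
  rv (combine_eval m e1 e0) = rm m * rv e1 + (1 - rm m) * rv e0.
Proof.
  intros H1 H2 H3. unfold rv, rm, combine_eval. cbn [fst snd].
  rewrite !nr_add, !nr_mul, !nr_add. field. lra.
Qed.

Section Eval.
Variables (mg : list clause -> key -> N * N) (delta : R).
Hypothesis Hmg : marg_ok mg delta.
Hypothesis Hdelta : 0 <= delta.

(** Whatever the approximate odds are, [evalc] forms convex combinations of values of [g]; even bad
    marginals cannot push it out of the range of [g]. *)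
Lemma evalc_bounds f : forall C s, goodE C s -> (length (vars s) <= f)%nat ->
  0 < nr (snd (evalc g f mg C s)) /\ lam <= rv (evalc g f mg C s) <= lam * rho.
Proof.
  induction f as [|f IH]; intros C s Hs Hf.
  - assert (E : vars s = []) by (destruct (vars s); [easy|simpl in Hf; lia]).
    simpl. rewrite E. unfold rv. cbn [fst snd]. rewrite nr_1. split; [lra|].
    unfold Rdiv. rewrite Rinv_1, Rmult_1_r. apply Hg. rewrite length_map.
    apply (proj1 Hs s (or_introl eq_refl)).
  - cbn [evalc]. destruct (vars s) as [|a l] eqn:E.
    + unfold rv. cbn [fst snd]. rewrite nr_1. split; [lra|].
      unfold Rdiv. rewrite Rinv_1, Rmult_1_r. apply Hg. rewrite length_map.
      apply (proj1 Hs s (or_introl eq_refl)).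
    + cbv zeta. destruct (Hmg C (snd a) (goodE_M C s a l Hs E)) as [M1 M2].
      pose proof (vars_in s a l E) as Ha.
      assert (Hl : forall b, (length (vars (pin (snd a) b s)) <= f)%nat).
      { intros b. pose proof (vars_pin_lt (snd a) b s Ha). rewrite E in H. simpl in *. lia. }
      destruct (IH _ _ (goodE_pin (snd a) true C s Hs) (Hl true)) as [A1 A2].
      destruct (IH _ _ (goodE_pin (snd a) false C s Hs) (Hl false)) as [B1 B2].
      rewrite rv_combine by easy. split.
      * unfold combine_eval. cbn [snd]. rewrite !nr_mul, nr_add.
        apply Rmult_lt_0_compat; [easy|]. now apply Rmult_lt_0_compat.
      * pose proof (rm_bounds _ M1). nra.
Qed.

(** Equality up to constants. The two pinned versions of a clause are related in this way, so
    [evalc] requests the same marginals for both. *)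
Definition shape (a b : atom) : Prop := a = b \/ fst a = false /\ fst b = false.

Lemma shape_vars s t : Forall2 shape s t -> vars s = vars t.
Proof.
  unfold vars. induction 1 as [|a b s t H _ IH]; simpl; [easy|].
  destruct H as [->|[-> ->]]; [|easy]. now rewrite IH.
Qed.

Lemma shape_pin u b s t : Forall2 shape s t -> Forall2 shape (pin u b s) (pin u b t).
Proof.
  unfold pin. induction 1 as [|a a' s t H _ IH]; simpl; constructor; [|easy].
  destruct H as [->|[H H']]; [now left|]. right. unfold is_var. rewrite H, H'. easy.
Qed.

(* The signed combination is what the odds depend on: it vanishes on one side
   when [alpha] and [beta] are the exact, or the approximate, values of [t] and [s]. *)
Lemma evalc_error f : forall C s t alpha beta,
  goodE C s -> goodE C t -> Forall2 shape s t -> (length (vars s) <= f)%nat ->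
  0 <= alpha -> 0 <= beta ->
  Rabs ((beta * rv (evalc g f mg C s) - alpha * rv (evalc g f mg C t)) -
        (beta * Ex C s - alpha * Ex C t)) <=
  INR (length (vars s)) * (delta * (lam * (rho - 1) * (alpha + beta))).
Proof.
  induction f as [|f IH]; intros C s t alpha beta Hs Ht Hsh Hf Ha Hb.
  - assert (E : vars s = []) by (destruct (vars s); [easy|simpl in Hf; lia]).
    pose proof (shape_vars s t Hsh) as E'. rewrite E in E'.
    rewrite (Ex_const C s), (Ex_const C t) by (easy || apply Hs || apply Ht).
    simpl. rewrite E, <- E'. unfold rv. cbn [fst snd]. rewrite nr_1. unfold Rdiv.
    rewrite Rinv_1, !Rmult_1_r, Rminus_diag_eq, Rabs_R0 by easy. simpl. lra.
  - pose proof (shape_vars s t Hsh) as E'. destruct (vars s) as [|a l] eqn:E.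
    + rewrite (Ex_const C s), (Ex_const C t) by (easy || apply Hs || apply Ht).
      simpl. rewrite E, <- E'. unfold rv. cbn [fst snd]. rewrite nr_1. unfold Rdiv.
      rewrite Rinv_1, !Rmult_1_r, Rminus_diag_eq, Rabs_R0 by easy. simpl. lra.
    + set (u := snd a). destruct (Hmg C u (goodE_M C s a l Hs E)) as [M1 M2].
      pose proof (vars_in s a l E) as Hsa. symmetry in E'. pose proof (vars_in t a l E') as Hta.
      assert (Hl : forall b, (length (vars (pin u b s)) <= length l)%nat).
      { intros b. pose proof (vars_pin_lt u b s Hsa). rewrite E in H. simpl in *. lia. }
      assert (Hl' : forall b, (length (vars (pin u b t)) <= length l)%nat).
      { intros b. pose proof (vars_pin_lt u b t Hta). rewrite E' in H. simpl in *. lia. }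
      simpl in Hf.
      set (e := fun b => evalc g f mg (map (pin u b) C) (pin u b s)).
      set (h := fun b => evalc g f mg (map (pin u b) C) (pin u b t)).
      assert (Es : evalc g (S f) mg C s = combine_eval (mg C u) (e true) (e false))
        by (cbn [evalc]; rewrite E; easy).
      assert (Et : evalc g (S f) mg C t = combine_eval (mg C u) (h true) (h false))
        by (cbn [evalc]; rewrite E'; easy).
      assert (Be : forall b, 0 < nr (snd (e b)) /\ lam <= rv (e b) <= lam * rho).
      { intros b. apply evalc_bounds; [now apply goodE_pin|]. specialize (Hl b). lia. }
      assert (Bh : forall b, 0 < nr (snd (h b)) /\ lam <= rv (h b) <= lam * rho).
      { intros b. apply evalc_bounds; [now apply goodE_pin|]. specialize (Hl' b). lia. }
      set (X := fun b => beta * rv (e b) - alpha * rv (h b)).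
      set (Y := fun b => beta * Ex (map (pin u b) C) (pin u b s) - alpha * Ex (map (pin u b) C) (pin u b t)).
      set (L := lam * (rho - 1) * (alpha + beta)).
      assert (HL : 0 <= L).
      { unfold L. apply Rmult_le_pos; [|lra]. apply Rmult_le_pos; lra. }
      assert (HXY : forall b, Rabs (X b - Y b) <= INR (length l) * (delta * L)).
      { intros b. eapply Rle_trans.
        - apply (IH (map (pin u b) C) (pin u b s) (pin u b t) alpha beta);
            [now apply goodE_pin|now apply goodE_pin|now apply shape_pin| |easy|easy].
          specialize (Hl b). lia.
        - apply Rmult_le_compat_r; [now apply Rmult_le_pos|]. apply le_INR, Hl. }
      (* Both values lie between beta lam - alpha lam rho and beta lam rho - alpha lam, an interval
         of length [L]. *)
      assert (HX : Rabs (X true - X false) <= L).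
      { unfold X, L. destruct (Be true) as [_ B1], (Be false) as [_ B2], (Bh true) as [_ B3], (Bh false) as [_ B4].
        apply Rabs_le. split; nra. }
      rewrite Es, Et.
      rewrite !rv_combine by (easy || apply Be || apply Bh).
      assert (Hu : In u V) by (apply (goodE_M C s a l Hs E)).
      rewrite (Ex_split C s u), (Ex_split C t u) by (easy || apply Hs || apply Ht).
      set (p := Pm C u) in *. set (m := rm (mg C u)) in *.
      assert (Hp : 0 <= p <= 1) by (apply Pm_bounds; [apply (goodE_M C s a l Hs E)|easy]).
      (* A wrong marginal costs its error times the spread of the branches; the exact marginal then
         averages the errors of the branches. *)
      match goal with |- Rabs ?T <= _ =>
        replace T with ((m - p) * (X true - X false) + (p * (X true - Y true) + (1 - p) * (X false - Y false)))
          by (unfold X, Y; ring) end.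
      eapply Rle_trans; [apply Rabs_triang|]. cbn [length]. rewrite S_INR.
      assert (T1 : Rabs ((m - p) * (X true - X false)) <= delta * L).
      { rewrite Rabs_mult. apply Rmult_le_compat; try apply Rabs_pos; easy. }
      assert (T2 : Rabs (p * (X true - Y true) + (1 - p) * (X false - Y false)) <= INR (length l) * (delta * L)).
      { eapply Rle_trans; [apply Rabs_triang|]. rewrite !Rabs_mult, (Rabs_pos_eq p), (Rabs_pos_eq (1 - p)) by lra.
        pose proof (HXY true). pose proof (HXY false). nra. }
      unfold L in *. lra.
Qed.

Lemma shape_pins u s : Forall2 shape (pin u true s) (pin u false s).
Proof.
  unfold pin. induction s as [|a s IH]; simpl; constructor; [|easy].
  destruct (is_var u a); [right|left]; easy.
Qed.

(** Pinning [u] takes a variable away from the clause, whence k - 1, and removing the clause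
    restores the strict degree bound for its remaining variables. *)
Lemma occs_good C u o : goodM C u -> In o (occs_rec u [] C) ->
  goodE (fst o) (fst (snd o)) /\ goodE (fst o) (snd (snd o)) /\
  Forall2 shape (fst (snd o)) (snd (snd o)) /\
  (length (vars (fst (snd o))) < k)%nat /\ (length (vars (snd (snd o))) < k)%nat.
Proof.
  intros (HC & Hu & Hd & _) Ho. pose proof (occs_rec_deg u o C [] Ho) as Hdeg.
  destruct (occs_rec_in u o C [] Ho) as [(s & Hs & Hocc & E1 & E2) Hin].
  assert (Hwf : wfc (fst o)).
  { intros t Ht. destruct (Hin t Ht) as [[]|(s' & b & Hs' & [->| ->])].
    - now apply HC.
    - apply (wfc_pin u b C HC). now apply in_map. }
  assert (Hd' : forall v, (deg (fst o) v <= d)%nat).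
  { intros v. specialize (Hdeg v). specialize (Hd v). simpl in Hdeg. unfold deg in *. simpl in *. lia. }
  assert (Hv : forall v, In (true, v) (pin u true s) -> (deg (fst o) v < d)%nat).
  { intros v Hv. specialize (Hdeg v). rewrite E1 in Hdeg. apply occ_spec in Hv. rewrite Hv in Hdeg.
    specialize (Hd v). unfold deg in *. simpl in *. lia. }
  destruct (HC s Hs) as [Hlen HsV]. apply occ_spec in Hocc.
  rewrite E1, E2. split; [|split; [|split; [|split]]].
  - split; [|split]; [|easy|easy]. apply wfc_cons. split; [|easy].
    apply (wfc_incl (map (pin u true) C)); [|now apply wfc_pin].
    intros t [<-|[]]. now apply in_map.
  - split; [|split]; [|easy|].
    + apply wfc_cons. split; [|easy].
      apply (wfc_incl (map (pin u false) C)); [|now apply wfc_pin].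
      intros t [<-|[]]. now apply in_map.
    + intros v Hv'. apply Hv.
      assert (Hx : In (true, v) (vars (pin u false s))) by (now apply filter_In).
      rewrite <- (shape_vars _ _ (shape_pins u s)) in Hx. now apply filter_In in Hx.
  - apply shape_pins.
  - pose proof (vars_pin_lt u true s Hocc). pose proof (vars_length s). lia.
  - pose proof (vars_pin_lt u false s Hocc). pose proof (vars_length s). lia.
Qed.

End Eval.

(** The clauses around [u] are switched from 0 to 1 one at a time, those in [P] being done. Each
    switch multiplies the partition function by a ratio of two expectations; the ratios are cleared
    of denominators. *)
Lemma telescope u : forall C P, wfc (P ++ C) ->
  Zc (P ++ map (pin u true) C) * prodf (fun o => Ex (fst o) (snd (snd o))) (occs_rec u P C) =
  Zc (P ++ map (pin u false) C) * prodf (fun o => Ex (fst o) (fst (snd o))) (occs_rec u P C).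
Proof.
  induction C as [|s C IH]; intros P H; [easy|].
  assert (HP : wfc (P ++ C)).
  { revert H. apply wfc_incl. intros t. rewrite !in_app_iff. simpl. tauto. }
  assert (Hs : wfc [s]).
  { revert H. apply wfc_incl. intros t. rewrite !in_app_iff. simpl. tauto. }
  assert (HP0 : wfc P) by (revert H; apply wfc_incl; intros t; rewrite !in_app_iff; tauto).
  assert (HC0 : wfc C) by (revert HP; apply wfc_incl; intros t; rewrite !in_app_iff; tauto).
  assert (Happ : forall A B, wfc A -> wfc B -> wfc (A ++ B)).
  { intros A B HA HB t Ht. apply in_app_iff in Ht. destruct Ht; [now apply HA|now apply HB]. }
  cbn [occs_rec map]. destruct (occ u s) eqn:E.
  - cbn [prodf fold_right fst snd]. fold (prodf (fun o => Ex (fst o) (snd (snd o))) (occs_rec u (pin u true s :: P) C)).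
    fold (prodf (fun o => Ex (fst o) (fst (snd o))) (occs_rec u (pin u true s :: P) C)).
    assert (H1 : wfc ((pin u true s :: P) ++ C)).
    { apply wfc_cons. split; [|easy]. apply (wfc_pin u true [s] Hs). }
    specialize (IH _ H1). cbn [app] in IH.
    rewrite !Zc_middle. rewrite (Ex_Zc (P ++ map (pin u false) C) (pin u true s)) in IH
      by (apply Happ; [easy|now apply wfc_pin]).
    rewrite (Ex_Zc (P ++ map (pin u false) C) (pin u false s))
      by (apply Happ; [easy|now apply wfc_pin]).
    set (a := Ex _ (pin u false s)). set (b := Ex _ (pin u true s)) in *.
    set (z := Zc (P ++ map (pin u false) C)) in *. set (y := Zc (pin u true s :: P ++ map (pin u true) C)) in *.
    set (B := prodf (fun o => Ex (fst o) (snd (snd o))) _) in *.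
    set (A := prodf (fun o => Ex (fst o) (fst (snd o))) _) in *.
    replace (y * (a * B)) with (a * (y * B)) by ring. rewrite IH. ring.
  - rewrite !pin_notin by easy. rewrite !Zc_middle. apply (IH (s :: P)).
    now apply wfc_cons.
Qed.

(** [kappa] collects the denominators, which enter both odds alike and cancel in [rm]. *)
Lemma marg_fold (e1 e0 : list clause * (clause * clause) -> N * N) L m :
  (forall o, In o L -> 0 < nr (snd (e1 o)) /\ 0 < nr (snd (e0 o))) ->
  exists kappa, 0 < kappa /\
    nr (fst (fold_left (fun m o => combine_marg m (e1 o) (e0 o)) L m)) =
      kappa * (nr (fst m) * prodf (fun o => rv (e1 o)) L) /\
    nr (snd (fold_left (fun m o => combine_marg m (e1 o) (e0 o)) L m)) =
      kappa * (nr (snd m) * prodf (fun o => rv (e0 o)) L).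
Proof.
  revert m. induction L as [|o L IH]; intros m H.
  - exists 1. simpl. split; [lra|]. split; ring.
  - destruct (H o (or_introl eq_refl)) as [H1 H0].
    destruct (IH (combine_marg m (e1 o) (e0 o))) as (kappa & K & E1 & E2).
    { intros; apply H; now right. }
    exists (kappa * (nr (snd (e1 o)) * nr (snd (e0 o)))). split.
    + apply Rmult_lt_0_compat; [easy|]. now apply Rmult_lt_0_compat.
    + cbn [fold_left prodf fold_right]. rewrite E1, E2. unfold combine_marg. cbn [fst snd].
      rewrite !nr_mul. unfold rv, prodf. split; field; lra.
Qed.

Lemma marg_error l : marg_ok (marg w g k l) (((INR d - 1) * (INR k - 1) * (rho - 1) / 2) ^ l).
Proof.
  induction l as [|l IH]; intros C u HM.
  - simpl. rewrite nr_1. split; [lra|]. unfold rm. simpl. rewrite nr_1.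
    destruct HM as (HC & Hu & _). pose proof (Pm_bounds C u HC Hu). apply Rabs_le. lra.
  - set (delta := ((INR d - 1) * (INR k - 1) * (rho - 1) / 2) ^ l) in *.
    assert (Hd1 : 1 <= INR d).
    { destruct HM as (_ & _ & _ & Hd). change 1 with (INR 1). apply le_INR. lia. }
    cbn [marg].
    set (e1 := fun o : list clause * (clause * clause) => evalc g k (marg w g k l) (fst o) (fst (snd o))).
    set (e0 := fun o : list clause * (clause * clause) => evalc g k (marg w g k l) (fst o) (snd (snd o))).
    set (L := occs u C).
    assert (HL : forall o, In o L -> In o (occs_rec u [] C)).
    { intros o. unfold L. rewrite occs_rev. now rewrite <- in_rev. }
    assert (Hdelta : 0 <= delta).
    { assert (H := proj2 (IH C u HM)). pose proof (Rabs_pos (rm (marg w g k l C u) - Pm C u)). lra. }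
    assert (Hgood := fun o Ho => occs_good C u o HM (HL o Ho)).
    assert (Hb1 : forall o, In o L -> 0 < nr (snd (e1 o)) /\ lam <= rv (e1 o) <= lam * rho).
    { intros o Ho. destruct (Hgood o Ho) as (G1 & G2 & G3 & G4 & G5).
      apply (evalc_bounds _ _ IH); [easy|lia]. }
    assert (Hb0 : forall o, In o L -> 0 < nr (snd (e0 o)) /\ lam <= rv (e0 o) <= lam * rho).
    { intros o Ho. destruct (Hgood o Ho) as (G1 & G2 & G3 & G4 & G5).
      apply (evalc_bounds _ _ IH); [easy|lia]. }
    destruct (marg_fold e1 e0 L (w u)) as (kappa & Hk & E1 & E2).
    { intros o Ho. split; [now apply Hb1|now apply Hb0]. }
    set (F := fold_left _ L (w u)) in *.
    set (A' := fun o => rv (e1 o)) in *. set (B' := fun o => rv (e0 o)) in *.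
    set (A := fun o : list clause * (clause * clause) => Ex (fst o) (fst (snd o))).
    set (B := fun o : list clause * (clause * clause) => Ex (fst o) (snd (snd o))).
    assert (PA' : 0 < prodf A' L) by (apply prodf_pos; intros o Ho; destruct (Hb1 o Ho); unfold A'; lra).
    assert (PB' : 0 < prodf B' L) by (apply prodf_pos; intros o Ho; destruct (Hb0 o Ho); unfold B'; lra).
    pose proof (w_pos u) as Wp. pose proof (nr_ge0 (fst (w u))) as W1. pose proof (nr_ge0 (snd (w u))) as W0.
    assert (Dp : 0 < nr (fst (w u)) * prodf A' L + nr (snd (w u)) * prodf B' L) by now apply wsum_pos.
    split.
    { rewrite E1, E2. nra. }
    assert (Erm : rm F = nr (fst (w u)) * prodf A' L / (nr (fst (w u)) * prodf A' L + nr (snd (w u)) * prodf B' L)).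
    { unfold rm. rewrite E1, E2. field. split; [lra|]. nra. }
    assert (EA : forall o, In o L -> lam <= A o /\ lam <= B o).
    { intros o Ho. destruct (Hgood o Ho) as (G1 & G2 & _). split; apply Ex_bounds; [apply G1|apply G2]. }
    assert (PA : 0 < prodf A L) by (apply prodf_pos; intros o Ho; destruct (EA o Ho); lra).
    assert (PB : 0 < prodf B L) by (apply prodf_pos; intros o Ho; destruct (EA o Ho); lra).
    destruct HM as (HC & Hu & Hdeg & Hdu).
    (* Telescoping brings the exact marginal into the form of the computed one, with exact
       expectations in place of the approximate ones. *)
    assert (EPm : Pm C u = nr (fst (w u)) * prodf A L / (nr (fst (w u)) * prodf A L + nr (snd (w u)) * prodf B L)).
    { pose proof (telescope u C [] HC) as T. cbn [app] in T.
      assert (EL : forall f, prodf f (occs_rec u [] C) = prodf f L)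
        by (intros f; unfold L; now rewrite occs_rev, prodf_rev).
      rewrite !EL in T. fold A B in T.
      pose proof (Zc_pos C HC) as Z. pose proof (Zc_pos _ (wfc_pin u true C HC)) as Z1.
      pose proof (Zc_pos _ (wfc_pin u false C HC)) as Z0.
      unfold Pm. rewrite (Zc_split C u Hu) in *. unfold q in *.
      set (z1 := Zc (map (pin u true) C)) in *. set (z0 := Zc (map (pin u false) C)) in *.
      set (n1 := nr (fst (w u))) in *. set (n0 := nr (snd (w u))) in *.
      assert (Ez : z1 = z0 * prodf A L / prodf B L) by (rewrite <- T; field; lra).
      rewrite Ez.
      assert (0 < n1 * prodf A L + n0 * prodf B L) by now apply wsum_pos.
      field. repeat split; try lra; nra. }
    rewrite Erm, EPm, Rabs_minus_sym.
    (* At most k - 1 marginals with error [delta], each weighted by the relative spread rho - 1.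
       [ratio_hybrid] contributes the remaining (d - 1) / 2. *)
    set (tau := (INR k - 1) * delta * (rho - 1)).
    assert (Hlen : length L = deg C u) by (unfold L; rewrite occs_rev, length_rev; apply length_occs_rec).
    assert (Hk1 : 1 <= INR k) by (change 1 with (INR 1); now apply le_INR).
    assert (Htau : 0 <= tau) by (unfold tau; apply Rmult_le_pos; [apply Rmult_le_pos|]; lra).
    eapply Rle_trans; [apply (ratio_hybrid A B A' B' lam tau L)|]; try easy; try lra.
    + intros o Ho. destruct (Hgood o Ho) as (G1 & G2 & G3 & G4 & G5).
      destruct (EA o Ho) as [HA HB]. destruct (Hb1 o Ho) as [_ HA']. destruct (Hb0 o Ho) as [_ HB'].
      fold (A' o) in HA'. fold (B' o) in HB'.
      assert (Hn : INR (length (vars (fst (snd o)))) <= INR k - 1).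
      { apply Rle_trans with (INR (k - 1)); [apply le_INR; lia|]. rewrite minus_INR by lia. simpl. lra. }
      assert (Herr : forall alpha beta, 0 <= alpha -> 0 <= beta ->
        Rabs ((beta * A' o - alpha * B' o) - (beta * A o - alpha * B o)) <= tau * lam * (alpha + beta)).
      { intros alpha beta Ha Hb. eapply Rle_trans.
        - apply (evalc_error _ _ IH Hdelta k (fst o) (fst (snd o)) (snd (snd o)) alpha beta); try easy. lia.
        - unfold tau.
          assert (0 <= delta * (lam * (rho - 1) * (alpha + beta))).
          { apply Rmult_le_pos; [easy|]. apply Rmult_le_pos; [|lra]. apply Rmult_le_pos; lra. }
          replace ((INR k - 1) * delta * (rho - 1) * lam * (alpha + beta))
            with ((INR k - 1) * (delta * (lam * (rho - 1) * (alpha + beta)))) by ring.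
          now apply Rmult_le_compat_r. }
      repeat split; try easy; try lra.
      * specialize (Herr (A o) (B o) ltac:(lra) ltac:(lra)).
        replace (B o * A' o - A o * B' o - (B o * A o - A o * B o)) with (- (A o * B' o - A' o * B o)) in Herr by ring.
        now rewrite Rabs_Ropp in Herr.
      * specialize (Herr (A' o) (B' o) ltac:(lra) ltac:(lra)).
        replace (B' o * A' o - A' o * B' o - (B' o * A o - A' o * B o)) with (- (A o * B' o - A' o * B o)) in Herr by ring.
        now rewrite Rabs_Ropp in Herr.
    + rewrite Hlen. cbn [pow]. fold delta.
      assert (INR (deg C u) <= INR d - 1).
      { apply Rle_trans with (INR (d - 1)); [apply le_INR; lia|]. rewrite minus_INR by lia. simpl. lra. }
      unfold tau in *.
      replace ((INR d - 1) * (INR k - 1) * (rho - 1) / 2 * delta)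
        with ((INR d - 1) * ((INR k - 1) * delta * (rho - 1) / 2)) by field.
      apply Rmult_le_compat_r; lra.
Qed.

(** Each clause is evaluated against the clauses that come after it. *)
Definition est (l : nat) : list clause -> list (N * N) :=
  fix est C := match C with [] => [] | s :: C => evalc g k (marg w g k l) C s :: est C end.

(** All expectations are at least [lam], so an absolute error of [lam] times [eta] is a relative
    error of [eta], and 1 + eta <= exp eta. The factor k counts the variables of a whole clause,
    none of them being pinned yet. *)
Lemma est_spec l C :
  let eta := INR k * ((INR d - 1) * (INR k - 1) * (rho - 1) / 2) ^ l * (rho - 1) in
  wfc C -> (forall v, (deg C v <= d)%nat) ->
  (forall e, In e (est l C) -> 0 < nr (snd e)) /\
  Zc C * exp (- (INR (length C) * eta)) <= prodf rv (est l C) <= Zc C * exp (INR (length C) * eta).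
Proof.
  intros eta. induction C as [|s C IH]; intros HC HD.
  - split; [easy|]. simpl. rewrite Zc_nil, Rmult_0_l, Ropp_0, exp_0. lra.
  - assert (HD' : forall v, (deg C v <= d)%nat).
    { intros v. specialize (HD v). rewrite deg_cons in HD. lia. }
    assert (HC' : wfc C) by now apply wfc_cons in HC.
    destruct (IH HC' HD') as [I1 [I2 I3]].
    assert (Hs : goodE C s).
    { split; [easy|]. split; [easy|]. intros v Hv. specialize (HD v). rewrite deg_cons in HD.
      apply occ_spec in Hv. rewrite Hv in HD. lia. }
    set (delta := ((INR d - 1) * (INR k - 1) * (rho - 1) / 2) ^ l) in *.
    assert (Hd1 : 1 <= INR d) by (change 1 with (INR 1); now apply le_INR).
    assert (Hk1 : 1 <= INR k) by (change 1 with (INR 1); now apply le_INR).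
    assert (Hdelta : 0 <= delta).
    { apply pow_le. unfold Rdiv. apply Rmult_le_pos; [|lra]. apply Rmult_le_pos; [|lra].
      apply Rmult_le_pos; lra. }
    pose proof (marg_error l) as Hm. fold delta in Hm.
    assert (Hlen : (length (vars s) <= k)%nat).
    { pose proof (vars_length s). destruct (HC s (or_introl eq_refl)). lia. }
    destruct (evalc_bounds _ _ Hm k C s Hs Hlen) as [E1 E2].
    (* With weights 0 and 1 the signed combination reduces to the plain error. *)
    pose proof (evalc_error _ _ Hm Hdelta k C s s 0 1 Hs Hs) as Herr.
    assert (Hsh : Forall2 shape s s) by (clear; induction s; constructor; [now left|easy]).
    specialize (Herr Hsh Hlen ltac:(lra) ltac:(lra)).
    cbn [est]. set (e := evalc g k (marg w g k l) C s) in *.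
    replace (1 * rv e - 0 * rv e - (1 * Ex C s - 0 * Ex C s)) with (rv e - Ex C s) in Herr by ring.
    replace (lam * (rho - 1) * (0 + 1)) with (lam * (rho - 1)) in Herr by ring.
    assert (Heta : 0 <= eta).
    { unfold eta. fold delta. apply Rmult_le_pos; [|lra]. apply Rmult_le_pos; lra. }
    assert (Hle : Rabs (rv e - Ex C s) <= lam * eta).
    { eapply Rle_trans; [exact Herr|]. unfold eta. fold delta.
      replace (lam * (INR k * delta * (rho - 1))) with (INR k * (delta * (lam * (rho - 1)))) by ring.
      apply Rmult_le_compat_r; [|now apply le_INR].
      apply Rmult_le_pos; [easy|]. apply Rmult_le_pos; lra. }
    pose proof (Ex_bounds C s HC) as HE. pose proof (Zc_pos C HC') as HZ.
    assert (Hexp : 1 + eta <= exp eta).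
    { destruct (Req_dec eta 0) as [->|]; [rewrite exp_0; lra|]. left. apply exp_ineq1. lra. }
    assert (Hup : rv e <= Ex C s * exp eta).
    { apply Rle_trans with (Ex C s * (1 + eta)); [|apply Rmult_le_compat_l; lra].
      pose proof (Rle_abs (rv e - Ex C s)). nra. }
    (* The computed value is at least [lam] as well, so the two roles can be exchanged. *)
    assert (Hlo : Ex C s * exp (- eta) <= rv e).
    { assert (Ex C s <= rv e * exp eta).
      { apply Rle_trans with (rv e * (1 + eta)); [|apply Rmult_le_compat_l; lra].
        pose proof (Rle_abs (- (rv e - Ex C s))) as Ha. rewrite Rabs_Ropp in Ha. nra. }
      rewrite exp_Ropp. pose proof (exp_pos eta).
      apply Rmult_le_reg_r with (exp eta); [easy|]. rewrite Rmult_assoc, Rinv_l by lra. lra. }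
    split.
    + intros e' [<-|He]; [easy|now apply I1].
    + cbn [prodf fold_right length]. fold (prodf rv (est l C)). rewrite S_INR.
      rewrite Ex_Zc by easy.
      replace (- ((INR (length C) + 1) * eta)) with (- eta + - (INR (length C) * eta)) by ring.
      replace ((INR (length C) + 1) * eta) with (eta + INR (length C) * eta) by ring.
      rewrite !exp_plus.
      pose proof (exp_pos eta). pose proof (exp_pos (- eta)).
      pose proof (exp_pos (- (INR (length C) * eta))). pose proof (exp_pos (INR (length C) * eta)).
      split.
      * replace (Ex C s * Zc C * (exp (- eta) * exp (- (INR (length C) * eta))))
          with ((Ex C s * exp (- eta)) * (Zc C * exp (- (INR (length C) * eta)))) by ring.
        apply Rmult_le_compat; try easy; apply Rmult_le_pos; lra.
      * replace (Ex C s * Zc C * (exp eta * exp (INR (length C) * eta)))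
          with ((Ex C s * exp eta) * (Zc C * exp (INR (length C) * eta))) by ring.
        apply Rmult_le_compat; try easy; [lra|].
        eapply Rle_trans; [|exact I2]. apply Rmult_le_pos; lra.
Qed.

End Gibbs.

(** * The partition function *)

Lemma sumR_app l l' : sumR (l ++ l') = sumR l + sumR l'.
Proof. induction l; simpl; [lra|]. rewrite IHl. lra. Qed.

Lemma sumR_scal {A} c (f : A -> R) l : sumR (map (fun x => c * f x) l) = c * sumR (map f l).
Proof. induction l; simpl; [lra|]. rewrite IHl. lra. Qed.

Fixpoint assign (off : nat) (y : list bool) (x : key -> bool) : key -> bool :=
  match y with [] => x | b :: y => assign (S off) y (setv x (nat_bits off) b) end.

Lemma nat_bits_inj m n : nat_bits m = nat_bits n -> m = n.
Proof. intros H. apply bits_inj in H. lia. Qed.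

Lemma assign_below y : forall off x v, (v < off)%nat -> assign off y x (nat_bits v) = x (nat_bits v).
Proof.
  induction y as [|b y IH]; intros off x v Hv; simpl; [easy|]. rewrite IH by lia. unfold setv.
  destruct (eqbl (nat_bits v) (nat_bits off)) eqn:E; [|easy].
  apply eqbl_spec, nat_bits_inj in E. lia.
Qed.

Lemma assign_nth y : forall off x v, (off <= v < off + length y)%nat ->
  assign off y x (nat_bits v) = nth (v - off) y false.
Proof.
  induction y as [|b y IH]; intros off x v Hv; simpl in *; [lia|].
  destruct (Nat.eq_dec v off) as [->|Hn].
  - rewrite assign_below by lia. unfold setv. rewrite (proj2 (eqbl_spec _ _) eq_refl).
    now rewrite Nat.sub_diag.
  - rewrite IH by lia. replace (v - off)%nat with (S (v - S off)) by lia. reflexivity.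
Qed.

Lemma length_assignments n y : In y (assignments n) -> length y = n.
Proof.
  revert y. induction n as [|n IH]; intros y; simpl; [intros [<-|[]]; easy|].
  rewrite in_app_iff, !in_map_iff. intros [(z & <- & Hz)|(z & <- & Hz)]; simpl; now rewrite IH.
Qed.

(** A weight is the probability [q] times the total weight of its variable; taking out the totals
    leaves an iterated expectation. *)
Lemma sum_integ w (wv : nat -> bool -> R) n : forall off x phi,
  (forall v b, (off <= v < off + n)%nat -> wv v b = q w (nat_bits v) b * (wv v false + wv v true)) ->
  sumR (map (fun y => prodR (map (fun i => wv (off + i)%nat (nth i y false)) (seq 0 n)) *
                      phi (assign off y x)) (assignments n)) =
  prodR (map (fun v => wv v false + wv v true) (seq off n)) *
  integ w (map nat_bits (seq off n)) phi x.
Proof.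
  induction n as [|n IH]; intros off x phi H; [simpl; lra|].
  cbn [assignments]. rewrite map_app, sumR_app, !map_map.
  assert (E : forall b, sumR (map (fun y => wv (off + 0)%nat b *
     prodR (map (fun i => wv (off + i)%nat (nth i (b :: y) false)) (seq 1 n)) *
     phi (assign (S off) y (setv x (nat_bits off) b))) (assignments n)) =
     wv off b * (prodR (map (fun v => wv v false + wv v true) (seq (S off) n)) *
       integ w (map nat_bits (seq (S off) n)) phi (setv x (nat_bits off) b))).
  { intros b. rewrite <- IH by (intros; apply H; lia). rewrite <- sumR_scal. f_equal.
    apply map_ext. intros y. rewrite Nat.add_0_r, Rmult_assoc. f_equal. f_equal. f_equal.
    rewrite <- seq_shift, map_map. apply map_ext. intros i. cbn [nth]. f_equal. lia. }
  etransitivity; [exact (f_equal2 Rplus (E false) (E true))|].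
  pose proof (H off false ltac:(lia)) as F0. pose proof (H off true ltac:(lia)) as F1.
  cbn [seq map prodR fold_right integ].
  fold (prodR (map (fun v => wv v false + wv v true) (seq (S off) n))).
  set (P := prodR _). set (I1 := integ w _ phi (setv x (nat_bits off) true)).
  set (I0 := integ w _ phi (setv x (nat_bits off) false)).
  set (W := wv off false + wv off true) in *. set (q1 := q w (nat_bits off) true) in *.
  set (q0 := q w (nat_bits off) false) in *.
  transitivity ((q0 * W) * (P * I0) + (q1 * W) * (P * I1)); [now rewrite <- F0, <- F1|ring].
Qed.

Section Instance.
Variables (k d : nat) (I : instance).
Hypothesis Hval : valid k d I.

(* Weights of the values 1 and 0, in this order, over a common denominator. *)
Definition nweight (p : (nat * nat) * (nat * nat)) : N * N :=
  ((N.of_nat (fst (snd p)) * N.of_nat (snd (fst p)))%N,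
   (N.of_nat (fst (fst p)) * N.of_nat (snd (snd p)))%N).

Definition to_clause (s : list nat) : clause := map (fun v => (true, nat_bits v)) s.

(** The keys are binary numerals of consecutive numbers, the names that variables have in
    clauses. *)
Fixpoint number {A} (i : N) (l : list A) : list (key * A) :=
  match l with [] => [] | a :: l => (bits i, a) :: number (i + 1) l end.

Definition wtab : list (key * (N * N)) := number 0 (map nweight (wts I)).

Lemma number_keys {A} (l : list A) : forall i, map fst (number (N.of_nat i) l) = map nat_bits (seq i (length l)).
Proof.
  induction l as [|a l IH]; intros i; simpl; [easy|]. f_equal.
  rewrite <- IH. f_equal. f_equal. lia.
Qed.

Lemma number_in {A} (l : list A) d0 : forall i v, (v < length l)%nat ->
  In (nat_bits (i + v), nth v l d0) (number (N.of_nat i) l).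
Proof.
  induction l as [|a l IH]; intros i v Hv; simpl in *; [lia|].
  destruct v as [|v]; [left; now rewrite Nat.add_0_r|]. right.
  replace (N.of_nat i + 1)%N with (N.of_nat (S i)) by lia.
  replace (i + S v)%nat with (S i + v)%nat by lia. apply IH. lia.
Qed.

Lemma NoDup_keys n : forall i, NoDup (map nat_bits (seq i n)).
Proof.
  induction n as [|n IH]; intros i; simpl; constructor; [|apply IH].
  rewrite in_map_iff. intros (v & E & Hv). apply nat_bits_inj in E. apply in_seq in Hv. lia.
Qed.

Lemma nr_of_nat n : nr (N.of_nat n) = INR n.
Proof. unfold nr. now rewrite nat_N_Z, <- INR_IZR_INZ. Qed.

Notation dflt := ((0%nat, 1%nat), (0%nat, 1%nat)).
(** The default concerns keys outside the instance and is chosen so that their total weight is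
    nonzero too, as demanded of all keys. *)
Definition wI (u : key) : N * N := assoc u wtab (1%N, 1%N).

Lemma wI_find v : (v < nv I)%nat -> wI (nat_bits v) = nweight (nth v (wts I) dflt).
Proof.
  intros Hv. destruct Hval as (Hlen & _). apply assoc_in.
  - unfold wtab. rewrite (number_keys _ 0). apply NoDup_keys.
  - unfold wtab. rewrite <- map_nth. apply (number_in _ _ 0). rewrite length_map. lia.
Qed.

Definition wv (v : nat) (b : bool) : R := wt (nth v (wts I) dflt) b.

Lemma wv_ge0 v b : 0 <= wv v b.
Proof.
  unfold wv, wt, frac. set (p := nth v (wts I) dflt).
  destruct b; apply Rmult_le_pos; try apply pos_INR.
  - destruct (Nat.eq_dec (snd (snd p)) 0) as [->|H]; [simpl; rewrite Rinv_0; lra|].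
    left. apply Rinv_0_lt_compat, lt_0_INR. lia.
  - destruct (Nat.eq_dec (snd (fst p)) 0) as [->|H]; [simpl; rewrite Rinv_0; lra|].
    left. apply Rinv_0_lt_compat, lt_0_INR. lia.
Qed.

Lemma den_pos v : (v < nv I)%nat ->
  0 < INR (snd (fst (nth v (wts I) dflt))) /\ 0 < INR (snd (snd (nth v (wts I) dflt))).
Proof.
  intros Hv. destruct Hval as (Hlen & Hden & _).
  destruct (Hden (nth v (wts I) dflt)) as [H1 H2]; [apply nth_In; lia|].
  split; now apply lt_0_INR.
Qed.

Lemma wv_nr v : (v < nv I)%nat ->
  let p := nth v (wts I) dflt in
  let D := INR (snd (fst p)) * INR (snd (snd p)) in
  nr (fst (wI (nat_bits v))) = wv v true * D /\ nr (snd (wI (nat_bits v))) = wv v false * D.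
Proof.
  intros Hv p D. destruct (den_pos v Hv) as [D1 D2]. rewrite wI_find by easy.
  unfold nweight, wv, wt, frac. cbn [fst snd]. rewrite !nr_mul, !nr_of_nat. fold p.
  unfold D. fold p in D1, D2. split; field; lra.
Qed.

Definition CI : list clause := map to_clause (cstr I).
Definition VI : list key := map nat_bits (seq 0 (nv I)).

Lemma wf_CI : wfc k VI CI.
Proof.
  destruct Hval as (_ & _ & Hc & _). intros s Hs. apply in_map_iff in Hs.
  destruct Hs as (t & <- & Ht). destruct (Hc t Ht) as [H1 H2]. unfold to_clause.
  rewrite length_map. split; [easy|]. intros u Hu. apply in_map_iff in Hu.
  destruct Hu as (v & [= <-] & Hv). apply in_map, in_seq. specialize (H2 v Hv). lia.
Qed.

(** The clauses that contain a variable are at most as many as the positions it fills; a key that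
    names no variable has degree 0. *)
Lemma deg_CI u : (deg CI u <= d)%nat.
Proof.
  destruct Hval as (_ & _ & Hc & Hdeg). unfold CI.
  destruct (deg (map to_clause (cstr I)) u) eqn:E; [lia|].
  assert (Hu : exists v, u = nat_bits v /\ (v < nv I)%nat).
  { unfold deg in E. destruct (filter (occ u) (map to_clause (cstr I))) as [|s l] eqn:F; [easy|].
    assert (Hs : In s (filter (occ u) (map to_clause (cstr I)))) by (rewrite F; now left).
    apply filter_In in Hs. destruct Hs as [Hs Ho]. apply occ_spec in Ho.
    apply in_map_iff in Hs. destruct Hs as (t & <- & Ht). unfold to_clause in Ho.
    apply in_map_iff in Ho. destruct Ho as (v & [= <-] & Hv). exists v. split; [easy|].
    now apply (Hc t Ht). }
  destruct Hu as (v & -> & Hv). rewrite <- E. etransitivity; [|apply (Hdeg v Hv)].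
  unfold degree. clear. induction (cstr I) as [|s l IH]; simpl; [unfold deg; simpl; lia|].
  rewrite deg_cons. destruct (occ (nat_bits v) (to_clause s)) eqn:Eo; [|lia].
  apply occ_spec in Eo. unfold to_clause in Eo. apply in_map_iff in Eo.
  destruct Eo as (v' & [= E] & Hv'). apply nat_bits_inj in E. subst.
  apply (count_occ_In Nat.eq_dec) in Hv'. lia.
Qed.

(** Positive totals are what makes [q] a probability. *)
Lemma Zfun_Zc g :
  (forall v, (v < nv I)%nat -> 0 < wv v false + wv v true) ->
  Zfun (fun x => nr (g x)) I =
  prodR (map (fun v => wv v false + wv v true) (seq 0 (nv I))) * Zc wI g VI CI.
Proof.
  intros Hpos. unfold Zc, VI.
  rewrite <- (sum_integ wI wv (nv I) 0 (x0) (Phi g CI)).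
  - unfold Zfun. f_equal. apply map_ext_in. intros y Hy. apply length_assignments in Hy.
    f_equal. unfold Phi, CI, prodR, prodf. destruct Hval as (_ & _ & Hc & _).
    revert Hc. induction (cstr I) as [|s l IH]; intros Hc; simpl; [easy|].
    rewrite <- IH by (intros; apply Hc; now right). f_equal. f_equal. f_equal.
    unfold to_clause. rewrite map_map. apply map_ext_in. intros v Hv.
    destruct (Hc s (or_introl eq_refl)) as [_ H]. specialize (H v Hv).
    unfold aval. cbn [fst snd]. rewrite assign_nth by lia. now rewrite Nat.sub_0_r.
  - intros v b Hv. destruct (wv_nr v ltac:(lia)) as [E1 E0]. destruct (den_pos v ltac:(lia)) as [D1 D2].
    specialize (Hpos v ltac:(lia)). unfold q. rewrite E1, E0.
    set (D := INR _ * INR _). assert (0 < D) by (unfold D; now apply Rmult_lt_0_compat).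
    destruct b; field; nra.
Qed.

Lemma prodR_pos l : (forall x, In x l -> 0 < x) -> 0 < prodR l.
Proof.
  induction l; simpl; intros H; [lra|]. apply Rmult_lt_0_compat; [apply H; auto|apply IHl; auto].
Qed.

Lemma prodR_ge0 l : (forall x, In x l -> 0 <= x) -> 0 <= prodR l.
Proof.
  induction l; simpl; intros H; [lra|]. apply Rmult_le_pos; [apply H; auto|apply IHl; auto].
Qed.

Lemma prodR_0 l : In 0 l -> prodR l = 0.
Proof. induction l; simpl; [easy|]. intros [->|H]; [lra|]. rewrite IHl by easy. lra. Qed.

(** The case complementary to [Zfun_Zc]: some variable has two vanishing weights. *)
Lemma Zfun_zero F v : (v < nv I)%nat -> wv v false + wv v true = 0 -> Zfun F I = 0.
Proof.
  intros Hv H0. unfold Zfun. pose proof (wv_ge0 v false). pose proof (wv_ge0 v true).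
  induction (assignments (nv I)) as [|y l IH]; simpl; [easy|]. rewrite IH.
  rewrite prodR_0; [lra|]. apply in_map_iff. exists v. split; [|apply in_seq; lia].
  fold (wv v (nth v y false)). destruct (nth v y false); lra.
Qed.

(** Serves in both directions between [F] and its truncation, at the price of one factor [c] per
    constraint. *)
Lemma Zfun_mono F G c : 0 <= c ->
  (forall x, length x = k -> 0 <= F x <= c * G x) ->
  Zfun F I <= c ^ length (cstr I) * Zfun G I.
Proof.
  intros Hc0 HFG. unfold Zfun. rewrite <- sumR_scal.
  induction (assignments (nv I)) as [|y l IH]; simpl; [lra|].
  apply Rplus_le_compat; [|exact IH].
  set (W := prodR (map (fun v => wt _ (nth v y false)) _)).
  assert (HW : 0 <= W).
  { apply prodR_ge0. intros z Hz. apply in_map_iff in Hz. destruct Hz as (v & <- & _). apply wv_ge0. }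
  rewrite <- Rmult_assoc, (Rmult_comm _ W), Rmult_assoc. apply Rmult_le_compat_l; [easy|].
  destruct Hval as (_ & _ & Hc & _). clear - Hc Hc0 HFG. revert Hc.
  induction (cstr I) as [|s l IH]; intros Hc; simpl; [lra|].
  destruct (Hc s (or_introl eq_refl)) as [Hl _].
  pose proof (HFG (map (fun v => nth v y false) s) ltac:(now rewrite length_map)) as H.
  specialize (IH ltac:(intros; apply Hc; now right)).
  assert (0 <= prodR (map (fun s0 => F (map (fun v => nth v y false) s0)) l)).
  { apply prodR_ge0. intros z Hz. apply in_map_iff in Hz. destruct Hz as (t & <- & Ht).
    apply HFG. rewrite length_map. now apply (Hc t (or_intror Ht)). }
  replace (c * c ^ length l * (G (map (fun v => nth v y false) s) * prodR (map (fun s0 => G (map (fun v => nth v y false) s0)) l)))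
    with ((c * G (map (fun v => nth v y false) s)) * (c ^ length l * prodR (map (fun s0 => G (map (fun v => nth v y false) s0)) l))) by ring.
  apply Rmult_le_compat; lra.
Qed.

End Instance.

Open Scope nat_scope.

(** * The algorithm runs in polynomial time *)

Lemma PT_filter {X A} {EX : Enc X} {EA : Enc A} (mu : X -> nat) (f : X -> A -> bool) (l : X -> list A) :
  PT mu l -> PT (fun z => mu (fst z)) (fun z => f (fst z) (snd z)) ->
  PT mu (fun x => filter (f x) (l x)).
Proof.
  intros Hl Hf. apply (PT_ext mu (fun x => concat (map (fun a => if f x a then [a] else []) (l x)))).
  { intros x. induction (l x) as [|a m IH]; simpl; [easy|]. rewrite IH. now destruct (f x a). }
  apply PT_concat. apply (PT_map mu (fun x a => if f x a then [a] else []) l Hl). pt.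
Qed.

Lemma PT_pin {X} {EX : Enc X} (mu : X -> nat) u b s :
  PT mu u -> PT mu b -> PT mu s -> PT mu (fun x => pin (u x) (b x) (s x)).
Proof.
  intros Hu Hb Hs.
  apply (PT0_comp mu (fun x => (u x, (b x, s x))) (fun z => pin (fst z) (fst (snd z)) (snd (snd z)))); [|pt].
  unfold pin.
  apply (PT_map _ (fun (z : key * (bool * clause)) a => if is_var (fst z) a then cst (fst (snd z)) else a)); [pt|].
  unfold is_var, cst. pt.
Qed.

Lemma PT_map_pin {X} {EX : Enc X} (mu : X -> nat) u b C :
  PT mu u -> PT mu b -> PT mu C -> PT mu (fun x => map (pin (u x) (b x)) (C x)).
Proof.
  intros Hu Hb HC.
  apply (PT0_comp mu (fun x => (u x, (b x, C x))) (fun z => map (pin (fst z) (fst (snd z))) (snd (snd z)))); [|pt].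
  apply (PT_map _ (fun (z : key * (bool * list clause)) s => pin (fst z) (fst (snd z)) s)); [pt|].
  apply PT_pin; pt.
Qed.

Lemma PT_vars {X} {EX : Enc X} (mu : X -> nat) s : PT mu s -> PT mu (fun x => vars (s x)).
Proof.
  intros Hs. apply (PT0_comp mu s (fun s => vars s)); [|pt]. unfold vars.
  apply (PT_filter _ (fun _ => fst)); pt.
Qed.

Lemma PT_occ {X} {EX : Enc X} (mu : X -> nat) u s : PT mu u -> PT mu s -> PT mu (fun x => occ (u x) (s x)).
Proof.
  intros Hu Hs. apply (PT0_comp mu (fun x => (u x, s x)) (fun z => occ (fst z) (snd z))); [|pt].
  unfold occ. pt. apply (PT_filter _ (fun (z : key * clause) a => is_var (fst z) a)); [pt|].
  unfold is_var. pt.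
Qed.

Lemma sz_cst b v : sz (cst b) <= sz (true, v : list bool).
Proof.
  unfold cst. rewrite !sz_pair, sz_true, sz_false. pose proof (sz_pos v).
  destruct b; rewrite ?sz_cons, (@sz_nil bool), ?sz_false; lia.
Qed.

Lemma sz_pin u b s : sz (pin u b s) <= sz s.
Proof.
  induction s as [|a s IH]; [easy|]. change (pin u b (a :: s)) with ((if is_var u a then cst b else a) :: pin u b s).
  rewrite !sz_cons. destruct (is_var u a) eqn:E; [|lia]. apply is_var_spec in E. subst.
  pose proof (sz_cst b u). lia.
Qed.

Lemma sz_map_pin u b C : sz (map (pin u b) C) <= sz C.
Proof.
  induction C as [|s C IH]; [easy|]. cbn [map]. rewrite !sz_cons. pose proof (sz_pin u b s). lia.
Qed.

Lemma sz_occ_step u s C P acc :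
  let st := occ_step u s C (P, acc) in
  sz (fst st) <= S (sz s + sz P) /\
  sz (snd st) <= sz acc + (sz P + sz C + 2 * sz s + 3).
Proof.
  unfold occ_step. cbv zeta. pose proof (sz_pin u true s). pose proof (sz_pin u false s).
  destruct (occ u s); cbn [fst snd]; rewrite ?sz_cons; [|lia].
  rewrite !sz_pair. pose proof (sz_app P (map (pin u false) C)). pose proof (sz_map_pin u false C).
  split; lia.
Qed.

Lemma PT_occs {X} {EX : Enc X} (mu : X -> nat) u C : PT mu u -> PT mu C -> PT mu (fun x => occs (u x) (C x)).
Proof.
  intros Hu HC. apply (PT0_comp mu (fun x => (u x, C x)) (fun z => occs (fst z) (snd z))); [|pt].
  unfold occs. apply PT_snd.
  (* The most that one clause can add to the output; the invariant reserves this much for every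
     clause still to come. *)
  set (B := fun z : key * list clause => 4 * sz (snd z) + 6).
  apply (PT_loop _ (fun z : key * list clause => snd z) (fun _ => ([], [])) (fun z => occ_step (fst z))
    (fun z l st => sz (fst st) + sz l <= sz (snd z) + 1 /\
       sz (snd st) + length l * B z <= 1 + length (snd z) * B z)
    (fun z => 3 + sz (snd z) + sz (snd z) * B z)).
  - pt.
  - pt.
  - unfold occ_step. pt.
    + apply PT_occ; pt.
    + apply PT_pin; pt.
    + apply PT_map_pin; pt.
    + apply PT_pin; pt.
    + apply PT_pin; pt.
  - intros z. cbn [fst snd]. rewrite (@sz_nil clause), (@sz_nil (list clause * (clause * clause))). lia.
  - intros z s l [P acc] [H1 H2]. cbn [fst snd] in *.
    destruct (sz_occ_step (fst z) s l P acc) as [S1 S2]. rewrite sz_cons in H1. cbn [length] in H2.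
    split; [lia|]. unfold B in *. nia.
  - intros z l [P acc] [H1 H2]. cbn [fst snd] in *. rewrite sz_pair.
    pose proof (length_sz (snd z)). nia.
  - unfold B.
    assert (pb (fun z : key * list clause => sz (snd z)) (fun z => sz z + 0)).
    { apply (pb_le _ (fun z => sz z)); [|apply pb_addl]. intros [a b]. cbn [snd]. rewrite sz_pair. lia. }
    pb.
Qed.

Lemma length_occs u C : length (occs u C) <= length C.
Proof.
  rewrite occs_rev, length_rev, length_occs_rec. unfold deg.
  induction C as [|s C IH]; simpl; [lia|]. destruct (occ u s); simpl; lia.
Qed.

Lemma sz_occs u C o : In o (occs u C) ->
  sz (fst o) <= sz C /\ sz (fst (snd o)) <= sz C /\ sz (snd (snd o)) <= sz C.
Proof.
  rewrite occs_rev, <- in_rev.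
  assert (G : forall C P, In o (occs_rec u P C) ->
    sz (fst o) + 1 <= sz P + sz C /\ sz (fst (snd o)) <= sz C /\ sz (snd (snd o)) <= sz C).
  { clear. induction C as [|s C IH]; intros P Ho; [easy|]. cbn [occs_rec] in Ho. rewrite sz_cons.
    pose proof (sz_pin u true s) as S1. pose proof (sz_pin u false s) as S2. destruct (occ u s).
    - destruct Ho as [<-|Ho]; cbn [fst snd].
      + pose proof (sz_app P (map (pin u false) C)). pose proof (sz_map_pin u false C). lia.
      + specialize (IH _ Ho). rewrite sz_cons in IH. lia.
    - specialize (IH _ Ho). rewrite sz_cons in IH. lia. }
  intros Ho. specialize (G _ _ Ho). rewrite (@sz_nil clause) in G. lia.
Qed.

(* Tasks: kind, recursion depth, clauses, clause, variable.  Kinds 0 and 1 are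
   calls of [evalc] and [marg]; kinds 2 and 3 combine three values from the stack. *)
Notation task := (nat * (nat * (list clause * (clause * key))))%type.
Notation tables := (list (key * (N * N)) * list (list bool * N))%type.
Notation tstate := (list task * list (N * N))%type.

Definition tE (l : nat) (C : list clause) (s : clause) : task := (0, (l, (C, (s, [])))).
Definition tM (l : nat) (C : list clause) (u : key) : task := (1, (l, (C, ([], u)))).
Definition tKE : task := (2, (0, ([], ([], [])))).
Definition tKM : task := (3, (0, ([], ([], [])))).

Definition ctx_w (c : tables) (u : key) : N * N := assoc u (fst c) (1%N, 1%N).
Definition ctx_g (c : tables) (x : list bool) : N := assoc x (snd c) 0%N.

Definition do_eval (c : tables) (l : nat) (C : list clause) (s : clause) (st : tstate) : tstate :=
  match vars s with
  | [] => (fst st, (ctx_g c (map (aval (fun _ => false)) s), 1%N) :: snd st)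
  | a :: _ =>
      (tM l C (snd a) :: tE l (map (pin (snd a) true) C) (pin (snd a) true s)
         :: tE l (map (pin (snd a) false) C) (pin (snd a) false s) :: tKE :: fst st, snd st)
  end.

Definition do_marg (c : tables) (l : nat) (C : list clause) (u : key) (st : tstate) : tstate :=
  match l with
  | O => (fst st, (1%N, 1%N) :: snd st)
  | S l => (concat (map (fun o => [tE l (fst o) (fst (snd o)); tE l (fst o) (snd (snd o)); tKM])
                        (occs u C)) ++ fst st, ctx_w c u :: snd st)
  end.

Definition v0 : N * N := (0%N, 0%N).
(** Results are stacked in the order of computation, so [e0] is on top and the marginal lies
    deepest. *)
Definition do_combine (ev : bool) (st : tstate) : tstate :=
  let V := snd st in
  let e0 := List.hd v0 V in let e1 := List.hd v0 (tl V) in let m := List.hd v0 (tl (tl V)) in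
  (fst st, (if ev then combine_eval m e1 e0 else combine_marg m e1 e0) :: tl (tl (tl V))).

Definition tstep (c : tables) (st : tstate) : tstate :=
  match fst st with
  | [] => st
  | t :: ts =>
      let l := fst (snd t) in let C := fst (snd (snd t)) in
      if fst t =? 0 then do_eval c l C (fst (snd (snd (snd t)))) (ts, snd st)
      else if fst t =? 1 then do_marg c l C (snd (snd (snd (snd t)))) (ts, snd st)
      else do_combine (fst t =? 2) (ts, snd st)
  end.

Lemma PT_do_eval : PT0 (fun z : tables * (nat * (list clause * (clause * tstate))) =>
  do_eval (fst z) (fst (snd z)) (fst (snd (snd z))) (fst (snd (snd (snd z)))) (snd (snd (snd (snd z))))).
Proof.
  unfold do_eval.
  apply (PT_list_case _ (fun z : tables * (nat * (list clause * (clause * tstate))) => vars (fst (snd (snd (snd z)))))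
    (fun z => (fst (snd (snd (snd (snd z)))),
        (ctx_g (fst z) (map (aval (fun _ => false)) (fst (snd (snd (snd z))))), 1%N) :: snd (snd (snd (snd (snd z))))))
    (fun z a _ => let l := fst (snd z) in let C := fst (snd (snd z)) in
       let s := fst (snd (snd (snd z))) in let st := snd (snd (snd (snd z))) in
      (tM l C (snd a) :: tE l (map (pin (snd a) true) C) (pin (snd a) true s)
         :: tE l (map (pin (snd a) false) C) (pin (snd a) false s) :: tKE :: fst st, snd st))).
  - apply PT_vars. pt.
  - unfold ctx_g. pt. apply PT_assoc; pt. apply (PT_map _ (fun _ => aval (fun _ => false))); [pt|].
    unfold aval. pt.
  - unfold tM, tE, tKE. cbv zeta. pt; first [apply PT_map_pin|apply PT_pin]; pt.
Qed.

Lemma PT_do_marg : PT0 (fun z : tables * (nat * (list clause * (key * tstate))) =>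
  do_marg (fst z) (fst (snd z)) (fst (snd (snd z))) (fst (snd (snd (snd z)))) (snd (snd (snd (snd z))))).
Proof.
  unfold do_marg.
  apply (PT_nat_case _ (fun z : tables * (nat * (list clause * (key * tstate))) => fst (snd z))
    (fun z => (fst (snd (snd (snd (snd z)))), (1%N, 1%N) :: snd (snd (snd (snd (snd z))))))
    (fun z l => let C := fst (snd (snd z)) in
       let u := fst (snd (snd (snd z))) in let st := snd (snd (snd (snd z))) in
      (concat (map (fun o => [tE l (fst o) (fst (snd o)); tE l (fst o) (snd (snd o)); tKM])
                        (occs u C)) ++ fst st, ctx_w (fst z) u :: snd st))).
  - pt.
  - pt.
  - cbv zeta. unfold ctx_w. pt.
    + apply (PT_map _ (fun (z : (tables * (nat * (list clause * (key * tstate)))) * nat) o =>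
        [tE (snd z) (fst o) (fst (snd o)); tE (snd z) (fst o) (snd (snd o)); tKM])).
      * apply PT_occs; pt.
      * unfold tE, tKM. pt.
    + apply PT_assoc; pt.
Qed.

Lemma PT_do_combine ev : PT0 (do_combine ev).
Proof.
  change (PT0 (fun st => do_combine ev st)). unfold do_combine. cbv zeta.
  destruct ev; unfold combine_eval, combine_marg; pt.
Qed.

Lemma PT_tstep : PT0 (fun z : tables * tstate => tstep (fst z) (snd z)).
Proof.
  unfold tstep.
  apply (PT_list_case _ (fun z : tables * tstate => fst (snd z)) (fun z => snd z)
    (fun z t ts => let l := fst (snd t) in let C := fst (snd (snd t)) in
      if fst t =? 0 then do_eval (fst z) l C (fst (snd (snd (snd t)))) (ts, snd (snd z))
      else if fst t =? 1 then do_marg (fst z) l C (snd (snd (snd (snd t)))) (ts, snd (snd z))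
      else do_combine (fst t =? 2) (ts, snd (snd z)))).
  - pt.
  - pt.
  - cbv zeta. pt.
    + apply (PT0_comp _ (fun z : tables * tstate * (task * list task) =>
        (fst (fst z), (fst (snd (fst (snd z))), (fst (snd (snd (fst (snd z)))),
         (fst (snd (snd (snd (fst (snd z))))), (snd (snd z), snd (snd (fst z)))))))) _ PT_do_eval). pt.
    + apply (PT0_comp _ (fun z : tables * tstate * (task * list task) =>
        (fst (fst z), (fst (snd (fst (snd z))), (fst (snd (snd (fst (snd z)))),
         (snd (snd (snd (snd (fst (snd z))))), (snd (snd z), snd (snd (fst z)))))))) _ PT_do_marg). pt.
    + apply (PT_ext _ (fun z : tables * tstate * (task * list task) =>
        if fst (fst (snd z)) =? 2 then do_combine true (snd (snd z), snd (snd (fst z)))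
        else do_combine false (snd (snd z), snd (snd (fst z))))).
      { intros z. now destruct (fst (fst (snd z)) =? 2). }
      pt.
      * apply (PT0_comp _ (fun z : tables * tstate * (task * list task) => (snd (snd z), snd (snd (fst z)))) _ (PT_do_combine true)). pt.
      * apply (PT0_comp _ (fun z : tables * tstate * (task * list task) => (snd (snd z), snd (snd (fst z)))) _ (PT_do_combine false)). pt.
Qed.

Definition bv (v : N * N) : nat := Nat.max (blen (fst v)) (blen (snd v)).
(** Combining three values yields one about as long as the three together, so the quantity to
    control is the total over the stack. *)
Definition vweight (V : list (N * N)) : nat := list_sum (map (fun v => S (bv v)) V).

Lemma bv_combine (ev : bool) m e1 e0 :
  bv (if ev then combine_eval m e1 e0 else combine_marg m e1 e0) <= S (bv m + bv e1 + bv e0).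
Proof.
  destruct m as [m1 m2], e1 as [a1 a2], e0 as [b1 b2]. unfold bv.
  destruct ev; unfold combine_eval, combine_marg; cbn [fst snd].
  - pose proof (blen_add (m1 * a1 * b2) (m2 * b1 * a2)). pose proof (blen_mul (m1 * a1) b2).
    pose proof (blen_mul m1 a1). pose proof (blen_mul (m2 * b1) a2). pose proof (blen_mul m2 b1).
    pose proof (blen_mul (m1 + m2) (a2 * b2)). pose proof (blen_mul a2 b2). pose proof (blen_add m1 m2).
    lia.
  - pose proof (blen_mul (m1 * a1) b2). pose proof (blen_mul m1 a1).
    pose proof (blen_mul (m2 * b1) a2). pose proof (blen_mul m2 b1). lia.
Qed.

Lemma vweight_hd V : bv (List.hd v0 V) + vweight (tl V) <= vweight V.
Proof. unfold vweight. destruct V as [|v V]; simpl; [easy|lia]. Qed.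

Lemma vweight_cons v V : vweight (v :: V) = S (bv v) + vweight V.
Proof. reflexivity. Qed.

(** A single bound fits all tasks that ever arise, since pinning and [occs] never enlarge an
    instance. *)
Definition tbound (s : nat) (t : task) : Prop :=
  fst t <= s /\ fst (snd t) <= s /\ sz (fst (snd (snd t))) <= s /\
  sz (fst (snd (snd (snd t)))) <= s /\ sz (snd (snd (snd (snd t)))) <= s.

Lemma tbound_E s l C cl : 3 <= s -> l <= s -> sz C <= s -> sz cl <= s -> tbound s (tE l C cl).
Proof. intros. repeat split; cbn [tE fst snd]; rewrite ?(@sz_nil bool); lia. Qed.

Lemma tbound_M s l C u : 3 <= s -> l <= s -> sz C <= s -> sz u <= s -> tbound s (tM l C u).
Proof. intros. repeat split; cbn [tM fst snd]; rewrite ?(@sz_nil atom); lia. Qed.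

Lemma tbound_K s : 3 <= s -> tbound s tKE /\ tbound s tKM.
Proof.
  intros. repeat split; cbn [tKE tKM fst snd];
    rewrite ?(@sz_nil atom), ?(@sz_nil bool), ?(@sz_nil clause); lia.
Qed.

(** Only the number of tasks and the total length of the values grow, each by a fixed amount per
    step; polynomially many steps thus need polynomial space. *)
Lemma tstep_bound s b c st : 3 <= s -> 1 <= b ->
  (forall u, bv (ctx_w c u) <= b) -> (forall x, blen (ctx_g c x) <= b) ->
  Forall (tbound s) (fst st) ->
  Forall (tbound s) (fst (tstep c st)) /\
  length (fst (tstep c st)) <= length (fst st) + (3 + 3 * s) /\
  vweight (snd (tstep c st)) <= vweight (snd st) + (b + 2).
Proof.
  intros Hs Hb Hw Hg Ht. destruct st as [[|t ts] V]; unfold tstep; cbn [fst snd] in *.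
  { split; [easy|]. lia. }
  inversion Ht as [|? ? Ht1 Ht2]; subst. destruct t as [i [l [C [cl u]]]].
  unfold tbound in Ht1. cbn [fst snd] in *. destruct Ht1 as (T1 & T2 & T3 & T4 & T5).
  destruct (i =? 0); [|destruct (i =? 1)].
  - unfold do_eval. destruct (vars cl) as [|a r] eqn:E; cbn [fst snd].
    + split; [easy|]. split; [cbn [length]; lia|]. rewrite vweight_cons.
      specialize (Hg (map (aval (fun _ => false)) cl)).
      assert (bv (ctx_g c (map (aval (fun _ => false)) cl), 1%N) <= b).
      { unfold bv. cbn [fst snd]. change (blen 1) with 1. lia. }
      lia.
    + assert (Ha : sz (snd a) <= s).
      { apply vars_in in E. apply in_sz in E. rewrite sz_pair in E. lia. }
      split; [|cbn [length]; lia].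
      pose proof (sz_map_pin (snd a) true C). pose proof (sz_map_pin (snd a) false C).
      pose proof (sz_pin (snd a) true cl). pose proof (sz_pin (snd a) false cl).
      constructor; [apply tbound_M; lia|]. constructor; [apply tbound_E; lia|].
      constructor; [apply tbound_E; lia|]. constructor; [now apply tbound_K|easy].
  - unfold do_marg. destruct l as [|l]; cbn [fst snd].
    + split; [easy|]. split; [cbn [length]; lia|]. rewrite vweight_cons.
      change (bv (1%N, 1%N)) with 1. lia.
    + split; [|split].
      * apply Forall_app. split; [|easy]. apply Forall_concat. apply Forall_map.
        apply Forall_forall. intros o Ho. apply sz_occs in Ho.
        constructor; [apply tbound_E; lia|]. constructor; [apply tbound_E; lia|].
        constructor; [now apply tbound_K|constructor].
      * rewrite length_app. pose proof (length_occs u C). pose proof (length_sz C).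
        assert (E : forall L, length (concat (map (fun o : list clause * (clause * clause) =>
          [tE l (fst o) (fst (snd o)); tE l (fst o) (snd (snd o)); tKM]) L)) = 3 * length L).
        { induction L as [|o L IH]; simpl; [easy|]. rewrite IH. lia. }
        rewrite E. cbn [length]. lia.
      * rewrite vweight_cons. specialize (Hw u). lia.
  - unfold do_combine. cbv zeta. cbn [fst snd]. split; [easy|]. split; [cbn [length]; lia|].
    set (r := if i =? 2 then _ else _).
    assert (bv r <= S (bv (List.hd v0 (tl (tl V))) + bv (List.hd v0 (tl V)) + bv (List.hd v0 V))).
    { unfold r. apply (bv_combine (i =? 2)). }
    pose proof (vweight_hd V). pose proof (vweight_hd (tl V)). pose proof (vweight_hd (tl (tl V))).
    rewrite vweight_cons. lia.
Qed.

Lemma sz_vweight V : sz V <= 1 + 8 * vweight V.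
Proof.
  induction V as [|[a b] V IH]; [rewrite sz_nil; lia|]. rewrite sz_cons, sz_pair.
  pose proof (sz_blen a). pose proof (sz_blen b).
  rewrite vweight_cons. unfold bv. cbn [fst snd]. lia.
Qed.

Lemma sz_tasks s ts : Forall (tbound s) ts -> sz ts <= 1 + length ts * (7 * s + 10).
Proof.
  induction 1 as [|[i [l [C [cl u]]]] ts (T1 & T2 & T3 & T4 & T5) _ IH]; [rewrite sz_nil; lia|].
  cbn [fst snd] in *. rewrite sz_cons, !sz_pair, !sz_nat. cbn [length]. lia.
Qed.

Lemma blen_sz n : blen n <= sz n.
Proof. pose proof (sz_blen n). lia. Qed.

Lemma PT_run : PT0 (fun z : tables * (nat * list task) =>
  Nat.iter (fst (snd z)) (tstep (fst z)) (snd (snd z), [])).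
Proof.
  apply (PT_iter _ (fun z : tables * (nat * list task) => fst (snd z)) (fun z => (snd (snd z), []))
    (fun z => tstep (fst z))
    (fun z => 3 + (sz z + sz z * (3 + 3 * (sz z + 3))) * (7 * (sz z + 3) + 10) + 8 * (sz z * (sz z + 3)))).
  - pt.
  - pt.
  - apply (PT0_comp _ (fun z : tables * (nat * list task) * tstate => (fst (fst z), snd z)) _ PT_tstep). pt.
  - intros [c [n ts]] m Hm. cbn [fst snd] in *. set (s := sz (c, (n, ts))).
    assert (Hsz : sz c + n + sz ts + 2 <= s).
    { unfold s. rewrite !sz_pair, sz_nat. lia. }
    assert (Hw : forall u, bv (ctx_w c u) <= s + 1).
    { intros u. unfold ctx_w. apply assoc_prop; [change (bv (1%N, 1%N)) with 1; lia|].
      intros p Hp. apply in_sz in Hp. destruct p as [k' [a b]], c as [W T]. rewrite !sz_pair in *.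
      unfold bv. cbn [fst snd] in *. pose proof (blen_sz a). pose proof (blen_sz b). lia. }
    assert (Hg : forall x, blen (ctx_g c x) <= s + 1).
    { intros x. unfold ctx_g. apply (assoc_prop (fun a => blen a <= s + 1)); [change (0 <= s + 1); lia|].
      intros p Hp. apply in_sz in Hp. destruct p as [k' a], c as [W T]. rewrite !sz_pair in *.
      cbn [fst snd] in *. pose proof (blen_sz a). lia. }
    assert (Ht : Forall (tbound (s + 3)) ts).
    { apply Forall_forall. intros t Ht. apply in_sz in Ht. destruct t as [i [l [C [cl u]]]].
      rewrite !sz_pair, !sz_nat in Ht. unfold tbound. cbn [fst snd]. lia. }
    assert (G : Forall (tbound (s + 3)) (fst (Nat.iter m (tstep c) (ts, []))) /\
      length (fst (Nat.iter m (tstep c) (ts, []))) <= length ts + m * (3 + 3 * (s + 3)) /\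
      vweight (snd (Nat.iter m (tstep c) (ts, []))) <= m * (s + 3)).
    { clear Hm. induction m as [|m (I1 & I2 & I3)].
      - simpl. split; [easy|]. split; [lia|]. unfold vweight. simpl. lia.
      - rewrite Nat.iter_succ.
        destruct (tstep_bound (s + 3) (s + 1) c _ ltac:(lia) ltac:(lia) Hw Hg I1) as (J1 & J2 & J3).
        split; [easy|]. lia. }
    destruct G as (G1 & G2 & G3). destruct (Nat.iter m (tstep c) (ts, [])) as [ts' V'].
    cbn [fst snd] in *. rewrite sz_pair. pose proof (sz_tasks _ _ G1). pose proof (sz_vweight V').
    pose proof (length_sz ts).
    assert (length ts' <= s + s * (3 + 3 * (s + 3))) by nia.
    assert (vweight V' <= s * (s + 3)) by nia.
    nia.
  - pb.
Qed.

Definition runs (c : tables) (n : nat) (st st' : tstate) : Prop :=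
  exists m, m <= n /\ Nat.iter m (tstep c) st = st'.

Lemma runs_refl c n st : runs c n st st.
Proof. exists 0. split; [lia|easy]. Qed.

Lemma runs_trans c n n' st st' st'' : runs c n st st' -> runs c n' st' st'' -> runs c (n + n') st st''.
Proof.
  intros (m & Hm & E) (m' & Hm' & E'). exists (m' + m). split; [lia|].
  now rewrite Nat.iter_add, E.
Qed.

Lemma runs_step c n st st' : runs c n (tstep c st) st' -> runs c (S n) st st'.
Proof. intros (m & Hm & E). exists (S m). split; [lia|]. now rewrite Nat.iter_succ_r. Qed.

Lemma runs_le c n n' st st' : n <= n' -> runs c n st st' -> runs c n' st st'.
Proof. intros H (m & Hm & E). exists m. split; [lia|easy]. Qed.

(** The empty task list is a fixed point of [tstep], so overestimating the number of steps does no
    harm. *)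
Lemma runs_end c n V st N : runs c n st ([], V) -> n <= N -> Nat.iter N (tstep c) st = ([], V).
Proof.
  intros (m & Hm & E) Hn. replace N with ((N - m) + m) by lia. rewrite Nat.iter_add, E.
  induction (N - m) as [|j IH]; [easy|]. now rewrite Nat.iter_succ, IH.
Qed.

(** Steps for a clause with [f] variables when one marginal costs [x]. *)
Fixpoint costE (f x : nat) : nat := match f with O => 1 | S f => 2 + x + 2 * costE f x end.
Fixpoint costM (d k l : nat) : nat :=
  match l with O => 1 | S l => 1 + d * (2 * costE k (costM d k l) + 1) end.

Lemma costE_le f x : costE f x + (x + 2) <= 2 ^ f * (x + 3).
Proof. induction f as [|f IH]; simpl; lia. Qed.

(** A level multiplies the cost by a constant depending on d and k only. The shift by 3 absorbs the
    additive terms of the recursion. *)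
Lemma costM_le d k l : costM d k l + 3 <= 4 * (d * 2 ^ (k + 1) + d + 4) ^ l.
Proof.
  induction l as [|l IH]; [simpl; lia|]. cbn [costM]. rewrite Nat.pow_succ_r'.
  pose proof (costE_le k (costM d k l)) as H. set (x := costM d k l) in *.
  replace (2 ^ (k + 1)) with (2 * 2 ^ k) in * by (rewrite Nat.pow_add_r; simpl; lia).
  set (K := d * (2 * 2 ^ k) + d + 4) in *.
  assert (4 + d * (2 * (2 ^ k * (x + 3)) + 1) <= K * (x + 3)) by (unfold K; nia).
  assert (d * (2 * costE k x + 1) <= d * (2 * (2 ^ k * (x + 3)) + 1)) by (apply Nat.mul_le_mono_l; lia).
  assert (K * (x + 3) <= K * (4 * K ^ l)) by (apply Nat.mul_le_mono_l; lia).
  lia.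
Qed.

(** The part of well-formedness on which the running time depends; all instances arising in the
    recursion inherit it. *)
Definition small (d k : nat) (C : list clause) : Prop :=
  (forall v, deg C v <= d) /\ (forall s, In s C -> length s <= k).

Lemma small_pin d k u b C : small d k C -> small d k (map (pin u b) C).
Proof.
  intros [H1 H2]. split.
  - intros v. etransitivity; [apply deg_pin|easy].
  - intros s Hs. apply in_map_iff in Hs. destruct Hs as (t & <- & Ht). rewrite length_pin. auto.
Qed.

Section Run.
Variables (c : tables) (d k : nat).

Lemma runs_eval l :
  (forall C u ts V, small d k C ->
     runs c (costM d k l) (tM l C u :: ts, V) (ts, marg (ctx_w c) (ctx_g c) k l C u :: V)) ->
  forall f C s ts V, small d k C -> length (vars s) <= f ->
    runs c (costE f (costM d k l)) (tE l C s :: ts, V)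
      (ts, evalc (ctx_g c) f (marg (ctx_w c) (ctx_g c) k l) C s :: V).
Proof.
  intros HM. induction f as [|f IH]; intros C s ts V HC Hf.
  - assert (E : vars s = []) by (destruct (vars s); [easy|simpl in Hf; lia]).
    apply runs_step. unfold tstep, tE. cbn [fst snd Nat.eqb]. unfold do_eval. simpl evalc.
    rewrite E. apply runs_refl.
  - cbn [costE]. apply (runs_step c (1 + costM d k l + 2 * costE f (costM d k l))).
    unfold tstep, tE at 1. cbn [fst snd Nat.eqb]. unfold do_eval.
    cbn [evalc]. destruct (vars s) as [|a r] eqn:E; [apply runs_refl|]. cbv zeta. cbn [fst snd].
    assert (Hv : forall b, length (vars (pin (snd a) b s)) <= f).
    { intros b. pose proof (vars_pin_lt (snd a) b s (vars_in _ _ _ E)) as H. rewrite E in H. simpl in *. lia. }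
    apply (runs_le c (costM d k l + (costE f (costM d k l) + (costE f (costM d k l) + 1)))); [lia|].
    eapply runs_trans; [now apply HM|].
    eapply runs_trans; [apply IH; [now apply small_pin|apply Hv]|].
    eapply runs_trans; [apply IH; [now apply small_pin|apply Hv]|].
    apply runs_step. apply runs_refl.
Qed.

Lemma runs_marg l : forall C u ts V, small d k C ->
  runs c (costM d k l) (tM l C u :: ts, V) (ts, marg (ctx_w c) (ctx_g c) k l C u :: V).
Proof.
  induction l as [|l IH]; intros C u ts V HC.
  - apply runs_step. apply runs_refl.
  - cbn [costM]. apply runs_step. unfold tstep, tM at 1. cbn [fst snd Nat.eqb]. unfold do_marg.
    cbn [fst snd marg].
    assert (Hlen : length (occs u C) <= d).
    { rewrite occs_rev, length_rev, length_occs_rec. apply HC. }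
    assert (Hs : forall o, In o (occs u C) -> small d k (fst o) /\
      length (vars (fst (snd o))) <= k /\ length (vars (snd (snd o))) <= k).
    { intros o Ho. rewrite occs_rev, <- in_rev in Ho.
      pose proof (occs_rec_deg u o C [] Ho) as Hd.
      destruct (occs_rec_in u o C [] Ho) as [(s & H1 & _ & E1 & E2) H2]. destruct HC as [HC1 HC2].
      split; [split|].
      - intros v. specialize (Hd v). specialize (HC1 v). unfold deg in *. simpl in *. lia.
      - intros t Ht. destruct (H2 t Ht) as [[]|(s' & b & Hs' & [->| ->])]; rewrite ?length_pin; auto.
      - rewrite E1, E2. pose proof (vars_length (pin u true s)). pose proof (vars_length (pin u false s)).
        rewrite !length_pin in *. specialize (HC2 s H1). lia. }
    apply (runs_le c (length (occs u C) * (2 * costE k (costM d k l) + 1)));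
      [now apply Nat.mul_le_mono_r|].
    revert Hs. generalize (ctx_w c u) as m. clear Hlen. revert ts V.
    induction (occs u C) as [|o L IHL]; intros ts V m Hs; [apply runs_refl|].
    destruct (Hs o (or_introl eq_refl)) as (S1 & S2 & S3). cbn [map concat app length fold_left].
    apply (runs_le c (costE k (costM d k l) + (costE k (costM d k l) + (1 + length L * (2 * costE k (costM d k l) + 1))))); [lia|].
    eapply runs_trans; [apply (runs_eval l IH); easy|].
    eapply runs_trans; [apply (runs_eval l IH); easy|].
    eapply runs_trans; [apply runs_step, runs_refl|].
    apply IHL. intros; apply Hs; now right.
Qed.

Lemma runs_E l C s ts V : small d k C -> length s <= k ->
  runs c (costE k (costM d k l)) (tE l C s :: ts, V)
    (ts, evalc (ctx_g c) k (marg (ctx_w c) (ctx_g c) k l) C s :: V).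
Proof.
  intros HC Hs. apply runs_eval; [intros; now apply runs_marg|easy|].
  pose proof (vars_length s). lia.
Qed.
End Run.

Open Scope nat_scope.

(** * Input and output *)

Definition bsy (b : bool) : sy := if b then Nd else Lf.

(** Bits are consed as they come in, so the word arrives reversed; [Enc_input] reverses it for this
    reason. Reading ends at the [#] before the random bits. *)
Definition reader : prog :=
  Seq (Push K0 Lf) (Loop Inp isEn (fun a =>
    match a with
    | Nd => Seq (Push K0 Lf) (Seq (Push K0 Lf) (Seq (Push K0 Nd) (Push K0 Nd)))
    | _ => Seq (Push K0 Lf) (Push K0 Nd)
    end)).

Lemma run_reader wd r :
  run reader (Mst [] [] [] (Reading 0 (map bsy wd ++ En :: r))) (2 + 5 * length wd)
      (Mst (ser (enc (rev wd)) ++ []) [] [] (Reading (S (length wd)) r)).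
Proof.
  assert (H : forall wd c acc, run (Loop Inp isEn (fun a =>
    match a with
    | Nd => Seq (Push K0 Lf) (Seq (Push K0 Lf) (Seq (Push K0 Nd) (Push K0 Nd)))
    | _ => Seq (Push K0 Lf) (Push K0 Nd)
    end)) (Mst (ser (enc acc)) [] [] (Reading c (map bsy wd ++ En :: r))) (1 + 5 * length wd)
      (Mst (ser (enc (rev wd ++ acc))) [] [] (Reading (S (c + length wd)) r))).
  { clear. induction wd as [|b wd IH]; intros c acc.
    - simpl. rewrite Nat.add_0_r. eapply run_exit; reflexivity.
    - cbn [map length app]. simpl rev. rewrite <- app_assoc.
      replace (c + S (length wd)) with (S c + length wd) by lia.
      eapply run_slack.
      + eapply run_loop; [reflexivity|now destruct b| |exact (IH (S c) (b :: acc))].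
        eapply run_slack with (t := 4); [|apply Nat.le_refl]. destruct b.
        * apply (run_seq _ _ _ 1 _ 3 _ (run_push _ _ _)). apply (run_seq _ _ _ 1 _ 2 _ (run_push _ _ _)).
          apply (run_seq _ _ _ 1 _ 1 _ (run_push _ _ _)). apply (run_push K0).
        * eapply run_slack; [eapply run_seq; apply run_push|lia].
      + lia. }
  rewrite app_nil_r. eapply run_slack.
  - eapply run_seq; [apply run_push|]. specialize (H wd 0 []). rewrite app_nil_r in H. exact H.
  - lia.
Qed.

Definition writer : prog :=
  Loop (Stk K0) notNd (fun _ => Case (Stk K0) (fun a =>
    match a with Nd => Seq (Pop K0) (Seq (Pop K0) (Emit true)) | _ => Emit false end)).

(** Writing begins only with a first bit and on a consumed cell, hence the nonempty list and the
    [S c]. *)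
Lemma run_writer b o c r :
  run writer (Mst (ser (enc (b :: o)) ++ []) [] [] (Reading (S c) r)) (1 + 5 * length (b :: o))
      (Mst [] [] [] (Writing (b :: o))).
Proof.
  assert (Hbody : forall b s p p', emit b (Mst s [] [] p) = Some (Mst s [] [] p') ->
    run (Case (Stk K0) (fun a =>
      match a with Nd => Seq (Pop K0) (Seq (Pop K0) (Emit true)) | _ => Emit false end))
      (Mst (ser (enc b) ++ s) [] [] p) 4 (Mst s [] [] p')).
  { clear. intros b s p p' H. destruct b.
    - eapply run_case; [reflexivity|]. apply (run_seq _ _ _ 1 (Mst (Lf :: s) [] [] p) 2);
        [eapply run_exit; reflexivity|].
      apply (run_seq _ _ _ 1 (Mst s [] [] p) 1); [eapply run_exit; reflexivity|]. now apply run_emit.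
    - eapply run_slack; [eapply run_case; [reflexivity|]; now apply run_emit|lia]. }
  assert (H : forall o o', run writer (Mst (ser (enc o) ++ []) [] [] (Writing o')) (1 + 5 * length o)
      (Mst [] [] [] (Writing (o' ++ o)))).
  { clear b o. induction o as [|b o IH]; intros o'.
    - rewrite (app_nil_r o'). eapply run_exit; reflexivity.
    - cbn [length]. replace (o' ++ b :: o) with ((o' ++ [b]) ++ o) by now rewrite <- app_assoc.
      eapply run_slack.
      + eapply (run_loop _ _ _ _ Nd (Mst (ser (enc b) ++ ser (enc o) ++ []) [] [] (Writing o')));
          [simpl; now rewrite <- app_assoc|reflexivity|now apply Hbody|apply IH].
      + lia. }
  cbn [length]. eapply run_slack.
  - eapply (run_loop _ _ _ _ Nd (Mst (ser (enc b) ++ ser (enc o) ++ []) [] [] (Reading (S c) r)));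
      [simpl; now rewrite <- app_assoc|reflexivity|now apply Hbody|exact (H o [b])].
  - lia.
Qed.

Lemma map_sym l : map sym l = map code (map bsy l).
Proof. rewrite map_map. apply map_ext. now intros []. Qed.

Lemma NoDup_assignments n : NoDup (assignments n).
Proof.
  induction n as [|n IH]; simpl; [repeat constructor; easy|].
  assert (Hm : forall b, NoDup (map (cons b) (assignments n))).
  { intros b. induction IH as [|y l Hy _ IHl]; simpl; constructor; [|easy].
    rewrite in_map_iff. intros (z & [= ->] & Hz). easy. }
  revert IH. intros _. generalize (Hm false) (Hm true). intros H0 H1.
  assert (Hd : forall y, In y (map (cons false) (assignments n)) -> ~ In y (map (cons true) (assignments n))).
  { intros y Hy Hy'. apply in_map_iff in Hy, Hy'. destruct Hy as (z & <- & _), Hy' as (z' & [=] & _). }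
  revert H0 Hd. induction (map (cons false) (assignments n)) as [|y l IHl]; intros H0 Hd; simpl; [easy|].
  inversion H0; subst. constructor.
  - rewrite in_app_iff. intros [H|H]; [easy|]. apply (Hd y); [now left|easy].
  - apply IHl; [easy|]. intros z Hz. apply Hd. now right.
Qed.

Lemma card_assignments n : length (assignments n) = 2 ^ n.
Proof. induction n as [|n IH]; simpl; [easy|]. rewrite length_app, !length_map, IH. lia. Qed.

Lemma in_assignments y : In y (assignments (length y)).
Proof.
  induction y as [|b y IH]; simpl; [now left|]. apply in_app_iff.
  destruct b; [right|left]; now apply in_map.
Qed.

(** [X] packs a valid instance together with its accuracy, so that [out] has to be correct and fast
    on such inputs only. The set of good random strings consists of all strings of length [T]. *)
Lemma FPRAS_of_PT {X} {EX : Enc X} (k d : nat) (F : list bool -> R)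
    (word : X -> list bool) (mu : X -> nat) (out : X -> list bool)
    (inst : X -> instance) (en ed : X -> nat) :
  (forall I e e', valid k d I -> 0 < e -> e < e' -> exists x, inst x = I /\ en x = e /\ ed x = e') ->
  (forall x, word x = enc_inst (inst x) ++ enc_nat (en x) ++ enc_nat (ed x)) ->
  (forall x, mu x = ed x / en x) ->
  (forall x, enc x = enc (rev (word x))) ->
  PT mu out ->
  (forall x, exists a b, 0 < b /\ out x = enc_nat a ++ enc_nat b /\
     (let eps := INR (en x) / INR (ed x) in
      exp (- eps) * Zfun F (inst x) <= INR a / INR b <= exp eps * Zfun F (inst x))%R) ->
  has_FPRAS k d F.
Proof.
  intros Hex Hword Hmu Henc HPT Hout. pose proof (PT_size _ _ HPT) as Hsz.
  destruct HPT as (p & t & Hp & Ht).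
  set (tt := fun x => 3 + 5 * length (word x) + t x + 5 * sz (out x)).
  assert (Hlen : pb (fun x => sz x + mu x) (fun x => length (word x) + mu x)).
  { apply (pb_le _ (fun x => 4 * length (word x) + 1 + mu x)); [|pb].
    intros x. rewrite sz_enc, Henc, <- sz_enc, sz_rev. pose proof (sz_bits (word x)). lia. }
  assert (Hb : pb (fun x => 2 + tt x * (2 * tt x + 5)) (fun x => length (word x) + mu x)).
  { assert (pb t (fun x => length (word x) + mu x)) by (eapply pb_trans; eassumption).
    assert (pb (fun x => sz (out x)) (fun x => length (word x) + mu x)) by (eapply pb_trans; eassumption).
    unfold tt. pb. }
  destruct Hb as [c Hc]. exists (machine (Seq reader (Seq p writer))), c.
  intros I Hval e e' He He'. destruct (Hex I e e' Hval He He') as (x & <- & <- & <-).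
  rewrite <- Hword, <- Hmu. cbv zeta. set (w := map sym (word x)).
  assert (Hw : length w = length (word x)) by apply length_map. rewrite Hw.
  set (T := c * (length (word x) + mu x + 1) ^ c).
  destruct (Hout x) as (a & b & Hb & Eo & HZ).
  assert (Hrun : forall r, exists s0 s1 s2,
     run (Seq reader (Seq p writer)) (Mst [] [] [] (Reading 0 (map bsy (word x) ++ En :: map bsy r)))
        (tt x) (Mst s0 s1 s2 (Writing (out x)))).
  { intros r. destruct (out x) as [|b0 o] eqn:E.
    { exfalso. unfold enc_nat in Eo. destruct (concat (map (fun b => [true; b]) (nat_bits a))); discriminate. }
    exists [], [], []. eapply run_slack.
    - eapply run_seq; [apply run_reader|]. rewrite <- Henc. eapply run_seq; [apply Hp|].
      rewrite E. apply run_writer.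
    - unfold tt. rewrite E. pose proof (length_sz (b0 :: o)). lia. }
  assert (Htape : forall r, w ++ [3] ++ map sym r = map code (map bsy (word x) ++ En :: map bsy r)).
  { intros r. rewrite map_app. cbn [map]. unfold w. now rewrite !map_sym. }
  assert (Hm : forall r len, halted (machine (Seq reader (Seq p writer)))
        (exec (machine (Seq reader (Seq p writer))) T (init (w ++ [3] ++ map sym r))) /\
      output (exec (machine (Seq reader (Seq p writer))) T (init (w ++ [3] ++ map sym r))) len T = out x).
  { intros r len. rewrite Htape. destruct (Hrun r) as (s0 & s1 & s2 & H).
    eapply machine_run; [exact H|]. apply Hc. }
  split; [intros r _; apply (Hm r 0)|].
  exists (assignments T). split; [apply NoDup_assignments|]. split; [|rewrite card_assignments; lia].
  intros r Hr. split; [now apply length_assignments|].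
  unfold good_run. exists a, b. split; [easy|]. split; [|exact HZ]. now rewrite <- Eo; apply Hm.
Qed.

Open Scope nat_scope.

(** * Parsing an instance, tables, and the numerical parts of the output *)

Definition pairp {A B : Type} (p : list bool -> A * list bool) (q : list bool -> B * list bool)
    (r : list bool) : (A * B) * list bool :=
  ((fst (p r), fst (q (snd (p r)))), snd (q (snd (p r)))).

Section Pairp.
Context {A B : Type} {EA : Enc A} {EB : Enc B}.
Variables (p : list bool -> A * list bool) (q : list bool -> B * list bool).

Lemma PT_pairp : PT0 p -> PT0 q -> PT0 (pairp p q).
Proof.
  intros Hp Hq. assert (Hq' : PT0 (fun r => q (snd (p r)))).
  { apply (PT0_comp _ (fun r => snd (p r)) q Hq). pt. }
  change (PT0 (fun r => pairp p q r)). unfold pairp. pt.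
Qed.

Lemma growth_pairp c c' : growth p c -> growth q c' -> growth (pairp p q) (c + c' + 1).
Proof.
  intros Hp Hq r. unfold pairp. cbn [fst snd]. rewrite sz_pair.
  specialize (Hp r). specialize (Hq (snd (p r))). lia.
Qed.

End Pairp.

Definition parse_weight := pairp (pairp parse_N parse_N) (pairp parse_N parse_N).
Definition parse_input :=
  pairp parse_N (pairp (parse_list parse_weight)
    (pairp (parse_list (parse_list parse_N)) (pairp parse_N parse_N))).

Lemma growth_parse_weight : growth parse_weight 7.
Proof. exact (growth_pairp _ _ 3 3 (growth_pairp _ _ 1 1 growth_parse_N growth_parse_N)
                                   (growth_pairp _ _ 1 1 growth_parse_N growth_parse_N)). Qed.

Lemma PT_parse_input : PT0 parse_input.
Proof.
  pose proof PT_parse_N as H.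
  assert (Hw : PT0 (parse_list parse_weight)).
  { apply (PT_parse_list parse_weight 7 growth_parse_weight). apply PT_pairp; apply PT_pairp; exact H. }
  assert (Hc : PT0 (parse_list (parse_list parse_N))).
  { apply (PT_parse_list (parse_list parse_N) 1 (growth_parse_list parse_N 1 growth_parse_N ltac:(lia))).
    now apply (PT_parse_list parse_N 1 growth_parse_N). }
  apply PT_pairp; [exact H|]. apply PT_pairp; [exact Hw|]. apply PT_pairp; [exact Hc|].
  now apply PT_pairp.
Qed.

Definition weightN (p : (nat * nat) * (nat * nat)) : (N * N) * (N * N) :=
  ((N.of_nat (fst (fst p)), N.of_nat (snd (fst p))), (N.of_nat (fst (snd p)), N.of_nat (snd (snd p)))).

Lemma parse_input_spec I en ed :
  fst (parse_input (enc_inst I ++ enc_nat en ++ enc_nat ed)) =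
  (N.of_nat (nv I), (map weightN (wts I), (map (map N.of_nat) (cstr I), (N.of_nat en, N.of_nat ed)))).
Proof.
  rewrite <- (app_nil_r (enc_inst I ++ _)). unfold enc_inst. rewrite <- !app_assoc.
  unfold parse_input, pairp. rewrite parse_N_spec. cbn [fst snd].
  rewrite (parse_list_spec parse_weight _ weightN).
  2:{ intros b rest _. rewrite <- !app_assoc. unfold parse_weight, pairp.
      repeat (rewrite parse_N_spec; cbn [fst snd]). reflexivity. }
  cbn [fst snd].
  rewrite (parse_list_spec (parse_list parse_N) (enc_list enc_nat) (map N.of_nat)).
  2:{ intros b rest _. apply (parse_list_spec parse_N enc_nat N.of_nat). intros; apply parse_N_spec. }
  cbn [fst snd]. rewrite parse_N_spec. cbn [fst snd]. rewrite parse_N_spec. reflexivity.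
Qed.

Definition nweightN (p : (N * N) * (N * N)) : N * N :=
  ((fst (snd p) * snd (fst p))%N, (fst (fst p) * snd (snd p))%N).

Lemma fold_number {A} (l : list A) : forall i acc,
  fold_left (fun st a => (S (fst st), (bits (N.of_nat (fst st)), a) :: snd st)) l (i, acc) =
  (i + length l, rev (number (N.of_nat i) l) ++ acc).
Proof.
  induction l as [|a l IH]; intros i acc; cbn [fold_left length]; [now rewrite Nat.add_0_r|].
  cbn [fst snd]. rewrite IH. f_equal; [lia|]. cbn [number rev].
  replace (N.of_nat (S i)) with (N.of_nat i + 1)%N by lia. now rewrite <- app_assoc.
Qed.

Lemma blen_of_nat n : blen (N.of_nat n) <= n.
Proof.
  apply blen_lt. change 2%N with (N.of_nat 2). rewrite <- Nat2N.inj_pow.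
  pose proof (Nat.pow_gt_lin_r 2 n). lia.
Qed.

Lemma sz_number {A} {EA : Enc A} (l : list A) : forall i,
  sz (number (N.of_nat i) l) <= 1 + length l * (4 * (i + length l) + 3) + sz l.
Proof.
  induction l as [|a l IH]; intros i; cbn [number length]; [rewrite sz_nil; lia|].
  rewrite !sz_cons, sz_pair. specialize (IH (S i)).
  replace (N.of_nat (S i)) with (N.of_nat i + 1)%N in IH by lia.
  pose proof (sz_bits (bits (N.of_nat i))). pose proof (blen_of_nat i). unfold blen in *. nia.
Qed.

Lemma PT_number {X A} {EX : Enc X} {EA : Enc A} (mu : X -> nat) (l : X -> list A) :
  PT mu l -> PT mu (fun x => number 0 (l x)).
Proof.
  intros Hl. apply (PT0_comp mu l (fun l => number 0 l)); [|exact Hl]. clear mu l Hl.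
  apply (PT_ext _ (fun l : list A => rev (snd (fold_left (fun st a => (S (fst st), (bits (N.of_nat (fst st)), a) :: snd st))
           l (0, []))))).
  { intros l. rewrite fold_number. cbn [snd]. now rewrite app_nil_r, rev_involutive. }
  apply PT_rev, PT_snd.
  apply (PT_fold _ (fun l : list A => l) (fun _ => (0, []))
    (fun _ st a => (S (fst st), (bits (N.of_nat (fst st)), a) :: snd st))
    (fun l => 10 + 4 * sz l + sz l * (4 * sz l + 3))).
  - pt.
  - pt.
  - pt. apply PT_Nof_nat. pt.
  - intros l l1 l2 El. rewrite fold_number. rewrite sz_pair, sz_nat, app_nil_r, sz_rev.
    pose proof (sz_number l1 0) as H. pose proof (length_sz l1). pose proof (sz_app l1 l2) as H2.
    rewrite <- El in H2. pose proof (sz_pos l2). simpl (0 + length l1) in *. nia.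
  - pb.
Qed.

Definition prodN (l : list N) : N := fold_left N.mul l 1%N.

Lemma blen_prodN l : forall m, blen (fold_left N.mul l m) <= blen m + sz l.
Proof.
  induction l as [|n l IH]; intros m; cbn [fold_left]; [lia|]. rewrite sz_cons.
  specialize (IH (m * n)%N). pose proof (blen_mul m n). pose proof (blen_sz n). lia.
Qed.

Lemma PT_prodN {X} {EX : Enc X} (mu : X -> nat) (l : X -> list N) :
  PT mu l -> PT mu (fun x => prodN (l x)).
Proof.
  intros Hl. apply (PT0_comp mu l prodN); [|exact Hl]. clear mu l Hl. unfold prodN.
  apply (PT_fold _ (fun l : list N => l) (fun _ => 1%N) (fun _ => N.mul) (fun l => 4 * sz l + 5)).
  - pt.
  - pt.
  - pt.
  - intros l l1 l2 El. pose proof (blen_prodN l1 1%N) as H. change (blen 1) with 1 in H.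
    pose proof (sz_blen (fold_left N.mul l1 1%N)). pose proof (sz_app l1 l2) as H2.
    rewrite <- El in H2. pose proof (sz_pos l2). lia.
  - pb.
Qed.

Lemma nr_prodN l : nr (prodN l) = prodf nr l.
Proof.
  assert (H : forall m, nr (fold_left N.mul l m) = (nr m * prodf nr l)%R).
  { induction l as [|n l IH]; intros m; simpl; [ring|]. rewrite IH, nr_mul. ring. }
  unfold prodN. rewrite H, nr_1. ring.
Qed.

Definition pow2 (n : nat) : N := ofbits (map (fun _ => false) (repeat tt n) ++ [true]).

Lemma nr_pow2 n : nr (pow2 n) = (2 ^ n)%R.
Proof.
  unfold pow2. induction n as [|n IH]; [reflexivity|].
  cbn [repeat map app]. set (l := map _ _ ++ _) in *.
  change (ofbits (false :: l)) with (N.double (ofbits l)). rewrite N.double_spec, nr_mul, IH. reflexivity.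
Qed.

Lemma PT_pow2 {X} {EX : Enc X} (mu : X -> nat) (n : X -> nat) : PT mu n -> PT mu (fun x => pow2 (n x)).
Proof. intros Hn. unfold pow2. pt. apply (PT_map mu (fun _ _ => false)); pt. Qed.

Definition encN (n : N) : list bool := concat (map (fun b => [true; b]) (bits n)) ++ [false; false].

Lemma encN_spec n : encN n = enc_nat (N.to_nat n).
Proof. unfold encN, enc_nat, nat_bits. now rewrite N2Nat.id. Qed.

Lemma PT_encN {X} {EX : Enc X} (mu : X -> nat) (n : X -> N) : PT mu n -> PT mu (fun x => encN (n x)).
Proof. intros Hn. unfold encN. pt. apply (PT_map mu (fun _ b => [true; b])); pt. Qed.

(** Consing puts the last clause first in line; its value then ends up deepest on the stack, which
    finally reads like [est]. *)
Definition tasks0 (l : nat) (C : list clause) : list task :=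
  floop (fun s C' acc => tE l C' s :: acc) C [].

Lemma PT_tasks0 {X} {EX : Enc X} (mu : X -> nat) l C :
  PT mu l -> PT mu C -> PT mu (fun x => tasks0 (l x) (C x)).
Proof.
  intros Hl HC. apply (PT0_comp mu (fun x => (l x, C x)) (fun z => tasks0 (fst z) (snd z))); [|pt].
  unfold tasks0.
  set (B := fun z : nat * list clause => sz z + 10).
  apply (PT_loop _ (fun z : nat * list clause => snd z) (fun _ => []) (fun z s C' acc => tE (fst z) C' s :: acc)
    (fun z C' acc => sz C' <= sz (snd z) /\ sz acc + length C' * B z <= 1 + length (snd z) * B z)
    (fun z => 1 + sz z + sz z * B z)).
  - pt.
  - pt.
  - unfold tE. pt.
  - intros z. cbn [fst snd]. rewrite (@sz_nil task). lia.
  - intros [l' C0] s C' acc [H1 H2]. cbn [fst snd] in *. rewrite sz_cons in H1. rewrite sz_cons. cbn [length] in H2.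
    split; [lia|].
    assert (Ht : S (sz (tE l' C' s)) <= B (l', C0)).
    { unfold B, tE. rewrite !sz_pair, (@sz_nil bool), !sz_nat. lia. }
    cbn [Nat.mul] in H2. lia.
  - intros [l' C0] C' acc [H1 H2]. cbn [fst snd] in *. unfold B in *.
    pose proof (length_sz C0). rewrite sz_pair in *. nia.
  - unfold B. pb.
Qed.

Lemma runs_tasks0 c d k l C ts V : small d k C ->
  runs c (length C * costE k (costM d k l)) (tasks0 l C ++ ts, V)
    (ts, est (ctx_w c) (ctx_g c) k l C ++ V).
Proof.
  assert (E : forall C acc, floop (fun s C' acc => tE l C' s :: acc) C acc = tasks0 l C ++ acc).
  { clear. unfold tasks0. induction C as [|s C IH]; intros acc; cbn [floop]; [easy|].
    rewrite IH, (IH [_]). now rewrite <- app_assoc. }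
  revert ts V. induction C as [|s C IH]; intros ts V HC; [apply runs_refl|].
  assert (HC' : small d k C).
  { destruct HC as [H1 H2]. split.
    - intros v. specialize (H1 v). rewrite deg_cons in H1. lia.
    - intros t Ht. apply H2. now right. }
  unfold tasks0. cbn [floop]. rewrite E, <- app_assoc. cbn [app length].
  apply (runs_le c (length C * costE k (costM d k l) + costE k (costM d k l))); [lia|].
  eapply runs_trans; [now apply IH|]. cbn [est app]. apply (runs_E c d k); [easy|].
  apply HC. now left.
Qed.

Lemma assoc_match {A} k (l : list (list bool * A)) a : In k (map fst l) -> In (k, assoc k l a) l.
Proof.
  unfold assoc. revert a. induction l as [|[k' b] l IH] using rev_ind; intros a Hk; [easy|].
  rewrite fold_left_app. cbn [fold_left fst snd]. rewrite map_app, in_app_iff in Hk.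
  apply in_app_iff. destruct (eqbl k' k) eqn:E.
  - apply eqbl_spec in E. subst. right. now left.
  - left. apply IH. destruct Hk as [Hk|[Hk|[]]]; [easy|]. simpl in Hk. subst.
    now rewrite (proj2 (eqbl_spec k k) eq_refl) in E.
Qed.

(** Finitely many values of [F] are involved, so the machines for all of them can be built into one
    program. *)
Lemma table_PT (F : list bool -> R) L : (forall y, In y L -> in_Rp (F y)) ->
  exists tab : nat -> list (list bool * N), PT0 tab /\
    forall n, map fst (tab n) = L /\
      forall y a, In (y, a) (tab n) -> (nr a <= F y * 2 ^ n < nr a + 1)%R.
Proof.
  induction L as [|y L IH]; intros H.
  - exists (fun _ => []). split; [pt|]. intros n. split; [easy|]. now intros.
  - destruct IH as (tab & Ht & Hs); [intros; apply H; now right|].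
    destruct (in_Rp_PT (F y) (H y (or_introl eq_refl))) as (f & Hf & Hfs).
    exists (fun n => (y, f n) :: tab n). split; [pt|]. intros n. destruct (Hs n) as [H1 H2].
    split; [simpl; now rewrite H1|]. intros z a [[= <- <-]|Hz]; [|now apply H2].
    specialize (Hfs n). unfold nr. rewrite <- N_nat_Z, <- INR_IZR_INZ. exact Hfs.
Qed.

(** Finitely many values leave a gap below the open end of the interval; the gap makes the
    contraction factor less than 1. *)
Lemma max_below (F : list bool -> R) (b : R) L : (1 < b)%R ->
  (forall y, In y L -> F y < b)%R -> exists rho, (1 <= rho < b)%R /\ forall y, In y L -> (F y <= rho)%R.
Proof.
  intros Hb. induction L as [|y L IH]; intros H.
  - exists 1%R. split; [lra|easy].
  - destruct IH as (rho & H1 & H2); [intros; apply H; now right|].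
    exists (Rmax rho (F y)). specialize (H y (or_introl eq_refl)). split.
    + split; [apply Rle_trans with rho; [lra|apply Rmax_l]|apply Rmax_lub_lt; lra].
    + intros z [<-|Hz]; [apply Rmax_r|]. apply Rle_trans with rho; [auto|apply Rmax_l].
Qed.

Open Scope nat_scope.

(** * Choice of parameters *)

Lemma blen_nat_gt n : n < 2 ^ blen (N.of_nat n).
Proof.
  pose proof (lt_pow_blen (N.of_nat n)) as H. change 2%N with (N.of_nat 2) in H.
  rewrite <- Nat2N.inj_pow in H. lia.
Qed.

Lemma blen_nat_le n : n <> 0 -> 2 ^ blen (N.of_nat n) <= 2 * n.
Proof.
  intros Hn. pose proof (blen_le_pow (N.of_nat n) ltac:(lia)) as H.
  change 2%N with (N.of_nat 2) in H. rewrite <- Nat2N.inj_pow, <- Nat2N.inj_mul in H. lia.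
Qed.

(** The difference of bit lengths yields a power of two equal to 1/eps up to a factor of 2, without
    a division. *)
Lemma pow2_ratio en ed : 0 < en -> en < ed ->
  let r := 2 ^ (blen (N.of_nat ed) - blen (N.of_nat en)) in
  r <= 2 * (ed / en) + 2 /\ ed <= 2 * (r * en).
Proof.
  intros H0 H1. set (a := blen (N.of_nat ed)). set (b := blen (N.of_nat en)). cbv zeta.
  pose proof (blen_nat_gt en) as E1. pose proof (blen_nat_le en ltac:(lia)) as E2.
  pose proof (blen_nat_gt ed) as D1. pose proof (blen_nat_le ed ltac:(lia)) as D2.
  fold a in D1, D2. fold b in E1, E2.
  assert (Hab : b <= a).
  { apply blen_lt. change 2%N with (N.of_nat 2). rewrite <- Nat2N.inj_pow. fold a. lia. }
  assert (E : 2 ^ a = 2 ^ (a - b) * 2 ^ b) by (rewrite <- Nat.pow_add_r; f_equal; lia).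
  set (r := 2 ^ (a - b)) in *. split; [|nia].
  assert (en * r <= 2 * ed) by nia.
  pose proof (Nat.div_mod ed en ltac:(lia)). pose proof (Nat.mod_upper_bound ed en ltac:(lia)). nia.
Qed.

Lemma length_enc_nat n : length (enc_nat n) = 2 * blen (N.of_nat n) + 2.
Proof.
  unfold enc_nat. rewrite length_app. unfold blen. change (bits (N.of_nat n)) with (nat_bits n).
  induction (nat_bits n) as [|b l IH]; simpl in *; lia.
Qed.

Lemma length_enc_list {A} (f : A -> list bool) l : length l <= length (enc_list f l).
Proof.
  unfold enc_list. rewrite length_app. induction l as [|a l IH]; simpl in *; [lia|].
  rewrite length_app. lia.
Qed.

Definition word (I : instance) (en ed : nat) : list bool := enc_inst I ++ enc_nat en ++ enc_nat ed.

Lemma length_word I en ed :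
  length (cstr I) + 2 * blen (N.of_nat ed) + 2 <= length (word I en ed).
Proof.
  unfold word, enc_inst. rewrite !length_app, (length_enc_nat ed).
  pose proof (length_enc_list (enc_list enc_nat) (cstr I)). lia.
Qed.

(** Roughly the logarithm of the input length over eps. It is large enough to bring m k / 2^width
    below eps / 4 for m constraints, and small enough for 2^width to be polynomial; k + 3 is there
    because 8 k <= 2^(k + 3). *)
Definition width (k : nat) (I : instance) (en ed : nat) : nat :=
  blen (N.of_nat (length (word I en ed))) + (blen (N.of_nat ed) - blen (N.of_nat en)) + (k + 3).

Lemma width_upper k I en ed : 0 < en -> en < ed ->
  2 ^ width k I en ed <= 2 * length (word I en ed) * (2 * (ed / en) + 2) * 2 ^ (k + 3).
Proof.
  intros H0 H1. unfold width. rewrite !Nat.pow_add_r.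
  pose proof (length_word I en ed). pose proof (blen_nat_le (length (word I en ed)) ltac:(lia)).
  destruct (pow2_ratio en ed H0 H1) as [Hr _].
  apply Nat.mul_le_mono; [|rewrite <- Nat.pow_add_r; easy]. now apply Nat.mul_le_mono.
Qed.

Lemma width_lower k I en ed : 0 < en -> en < ed ->
  4 * length (cstr I) * k * ed <= 2 ^ width k I en ed * en.
Proof.
  intros H0 H1. unfold width. rewrite 2!Nat.pow_add_r.
  pose proof (length_word I en ed). pose proof (blen_nat_gt (length (word I en ed))).
  destruct (pow2_ratio en ed H0 H1) as [_ Hr].
  set (X := 2 ^ blen (N.of_nat (length (word I en ed)))) in *.
  set (r := 2 ^ (blen (N.of_nat ed) - blen (N.of_nat en))) in *.
  assert (Hk : 8 * k <= 2 ^ (k + 3)).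
  { rewrite Nat.pow_add_r. pose proof (Nat.pow_gt_lin_r 2 k ltac:(lia)). simpl (2 ^ 3). lia. }
  set (m := length (cstr I)) in *.
  transitivity (m * (r * en) * (8 * k)).
  - transitivity (4 * m * k * (2 * (r * en))); [now apply Nat.mul_le_mono_l|]. lia.
  - replace (X * r * 2 ^ (k + 3) * en) with (X * (r * en) * 2 ^ (k + 3)) by ring.
    apply Nat.mul_le_mono; [|easy]. apply Nat.mul_le_mono_r. lia.
Qed.

(** The length of the input can serve as the number of bits taken from [F]: it exceeds the number of
    constraints plus the bit length of the denominator of eps. *)
Lemma word_lower I en ed : 0 < en ->
  2 * length (cstr I) * ed <= 2 ^ length (word I en ed) * en.
Proof.
  intros H0. pose proof (length_word I en ed) as H. pose proof (blen_nat_gt ed) as Hb.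
  set (m := length (cstr I)) in *. set (b := blen (N.of_nat ed)) in *.
  assert (Hp : 2 ^ (m + b + 1) <= 2 ^ length (word I en ed)) by (apply Nat.pow_le_mono_r; lia).
  rewrite !Nat.pow_add_r in Hp. simpl (2 ^ 1) in Hp.
  pose proof (Nat.pow_gt_lin_r 2 m ltac:(lia)) as Hm.
  transitivity (2 ^ m * 2 ^ b * 2); [|nia].
  replace (2 * m * ed) with (m * ed * 2) by lia. apply Nat.mul_le_mono_r, Nat.mul_le_mono; lia.
Qed.

(** * The estimator *)

Section Estimator.
Variables (k d h kap : nat) (tab : nat -> list (list bool * N)).
Hypothesis Htab : PT0 tab.

Record input := Input {
  inI : instance; ien : nat; ied : nat;
  ival : valid k d inI; ipos : 0 < ien; ilt : ien < ied }.

Definition iword (x : input) : list bool := word (inI x) (ien x) (ied x).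
#[local] Instance Enc_input : Enc input := fun x => enc (rev (iword x)).
Definition allow (x : input) : nat := ied x / ien x.

Definition iwidth (x : input) : nat := width k (inI x) (ien x) (ied x).
Definition icontext (x : input) : tables := (wtab (inI x), tab (length (iword x))).
(** A computable bound on the steps of the task machine: if the branching constant K is at most
    2^kap, then K^(h width) <= (2^width)^(kap h). *)
Definition isteps (x : input) : nat := length (iword x) * 2 ^ (k + 2) * (2 ^ iwidth x) ^ (kap * h).
Definition ivalues (x : input) : list (N * N) :=
  snd (Nat.iter (isteps x) (tstep (icontext x)) (tasks0 (h * iwidth x) (CI (inI x)), [])).

Definition inum (x : input) : N :=
  (prodN (map fst (ivalues x)) *
   prodN (map (fun p => fst (nweight p) + snd (nweight p)) (wts (inI x))))%N.
(** The power of two undoes the scaling of [F] by 2^n, once per constraint. *)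
Definition iden (x : input) : N :=
  (prodN (map snd (ivalues x)) *
   prodN (map (fun p => N.of_nat (snd (fst p)) * N.of_nat (snd (snd p))) (wts (inI x))) *
   pow2 (length (iword x) * length (cstr (inI x))))%N.
(** A zero numerator signals a variable of total weight 0. The denominator may then vanish as well,
    so the fraction 0/1 is written instead. *)
Definition iout (x : input) : list bool :=
  if N.eqb (inum x) 0 then encN 0 ++ encN 1 else encN (inum x) ++ encN (iden x).

Lemma PT_iout : PT allow iout.
Proof.
  assert (Hword : PT allow iword).
  { apply (PT_ext allow (fun x => rev (rev (iword x)))); [intros; apply rev_involutive|].
    apply PT_rev. apply (PT_cast allow (fun x => x)); [reflexivity|apply PT_id]. }
  (* A program receives an [input] only as its word, so the components are recovered by parsing. *)
  set (P := fun x => fst (parse_input (iword x))).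
  assert (HP : PT allow P) by (apply PT_fst, (PT0_comp _ iword _ PT_parse_input); pt).
  assert (EP : forall x, P x = (N.of_nat (nv (inI x)), (map weightN (wts (inI x)),
     (map (map N.of_nat) (cstr (inI x)), (N.of_nat (ien x), N.of_nat (ied x)))))).
  { intros x. apply parse_input_spec. }
  assert (Hws : PT allow (fun x => map weightN (wts (inI x)))).
  { apply (PT_ext allow (fun x => fst (snd (P x)))); [intros x; now rewrite EP|]. pt. }
  assert (Hcs : PT allow (fun x => map (map N.of_nat) (cstr (inI x)))).
  { apply (PT_ext allow (fun x => fst (snd (snd (P x))))); [intros x; now rewrite EP|]. pt. }
  assert (Hen : PT allow (fun x => N.of_nat (ien x))).
  { apply (PT_ext allow (fun x => fst (snd (snd (snd (P x)))))); [intros x; now rewrite EP|]. pt. }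
  assert (Hed : PT allow (fun x => N.of_nat (ied x))).
  { apply (PT_ext allow (fun x => snd (snd (snd (snd (P x)))))); [intros x; now rewrite EP|]. pt. }
  assert (HC : PT allow (fun x => CI (inI x))).
  { apply (PT_ext allow (fun x => map (map (fun v => (true, bits v))) (map (map N.of_nat) (cstr (inI x))))).
    { intros x. unfold CI, to_clause. rewrite map_map. apply map_ext. intros s. now rewrite map_map. }
    apply (PT0_comp allow (fun x => map (map N.of_nat) (cstr (inI x))) (fun l => map (map (fun v => (true, bits v))) l)); [|exact Hcs].
    apply (PT_map _ (fun _ => map (fun v => (true, bits v)))); [pt|].
    apply (PT_map _ (fun _ v => (true, bits v))); pt. }
  assert (Hm : PT allow (fun x => length (cstr (inI x)))).
  { apply (PT_ext allow (fun x => length (CI (inI x)))); [intros x; apply length_map|]. pt. }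
  assert (Hn : PT allow (fun x => length (iword x))) by pt.
  assert (Hwidth : PT allow iwidth).
  { change (PT allow (fun x => iwidth x)). unfold iwidth, width, blen. pt. now apply PT_Nof_nat. }
  (* Needed because 2^width is computed in unary, to count the rounds of the main loop. *)
  assert (Hpow : pb (fun x => 2 ^ iwidth x) (fun x => sz x + allow x)).
  { apply (pb_le _ (fun x => 2 * sz x * (2 * allow x + 2) * 2 ^ (k + 3))); [|pb].
    intros x. etransitivity; [apply (width_upper k (inI x) (ien x) (ied x) (ipos x) (ilt x))|].
    apply Nat.mul_le_mono_r, Nat.mul_le_mono_r, Nat.mul_le_mono_l.
    assert (E : sz x = sz (rev (iword x))) by (rewrite !sz_enc; reflexivity).
    rewrite E, sz_rev. apply length_sz. }
  assert (HU : PT allow (fun x => 2 ^ iwidth x)).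
  { assert (E : forall m, Nat.iter m (fun u => u + u) 1 = 2 ^ m).
    { induction m as [|m IH]; [easy|]. rewrite Nat.iter_succ, IH. simpl. lia. }
    apply (PT_ext allow (fun x => Nat.iter (iwidth x) (fun u => u + u) 1)); [intros; apply E|].
    apply (PT_iter allow iwidth (fun _ => 1) (fun _ u => u + u) (fun x => 2 * 2 ^ iwidth x + 1)); [pt|pt|pt| |pb].
    intros x m Hm'. rewrite E, sz_nat. pose proof (Nat.pow_le_mono_r 2 m (iwidth x) ltac:(lia) Hm'). lia. }
  assert (Hctx : PT allow icontext).
  { change (PT allow (fun x => icontext x)). unfold icontext. apply PT_pair.
    - apply (PT_ext allow (fun x => number 0 (map nweightN (map weightN (wts (inI x)))))).
      { intros x. unfold wtab. now rewrite map_map. }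
      apply PT_number. apply (PT_map allow (fun _ => nweightN)); [exact Hws|]. unfold nweightN. pt.
    - now apply (PT0_comp allow (fun x => length (iword x)) tab Htab). }
  assert (HV : PT allow ivalues).
  { change (PT allow (fun x => ivalues x)). unfold ivalues. apply PT_snd.
    apply (PT0_comp allow (fun x => (icontext x, (isteps x, tasks0 (h * iwidth x) (CI (inI x)))))
      (fun z => Nat.iter (fst (snd z)) (tstep (fst z)) (snd (snd z), []))); [exact PT_run|].
    apply PT_pair; [exact Hctx|]. apply PT_pair; [unfold isteps; pt|]. apply PT_tasks0; pt. }
  assert (Hnum : PT allow inum).
  { change (PT allow (fun x => inum x)). unfold inum. apply PT_Nmul; apply PT_prodN.
    - apply (PT_map allow (fun _ => fst)); pt.
    - apply (PT_ext allow (fun x => map (fun p => fst (nweightN p) + snd (nweightN p))%N (map weightN (wts (inI x))))).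
      { intros x. now rewrite map_map. }
      apply (PT_map allow (fun _ p => fst (nweightN p) + snd (nweightN p))%N); [exact Hws|].
      unfold nweightN. cbn [fst snd]. pt. }
  assert (Hden : PT allow iden).
  { change (PT allow (fun x => iden x)). unfold iden. apply PT_Nmul; [apply PT_Nmul; apply PT_prodN|].
    - apply (PT_map allow (fun _ => snd)); pt.
    - apply (PT_ext allow (fun x => map (fun p => snd (fst p) * snd (snd p))%N (map weightN (wts (inI x))))).
      { intros x. now rewrite map_map. }
      apply (PT_map allow (fun _ p => snd (fst p) * snd (snd p))%N); [exact Hws|]. pt.
    - apply PT_pow2. pt. }
  change (PT allow (fun x => iout x)). unfold iout. pt; apply PT_encN; pt.
Qed.

Lemma ivalues_est x :
  d * 2 ^ (k + 1) + d + 4 <= 2 ^ kap ->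
  ivalues x = est (ctx_w (icontext x)) (ctx_g (icontext x)) k (h * iwidth x) (CI (inI x)).
Proof.
  intros Hkap. set (l := h * iwidth x).
  assert (Hs : small d k (CI (inI x))).
  { split; [apply (deg_CI k d), ival|]. intros s Hs. apply (wf_CI k d _ (ival x)) in Hs. lia. }
  unfold ivalues. fold l.
  assert (Hr := runs_tasks0 (icontext x) d k l (CI (inI x)) [] [] Hs). rewrite !app_nil_r in Hr.
  rewrite (runs_end _ _ _ _ (isteps x) Hr); [easy|].
  unfold isteps.
  assert (Hm : length (CI (inI x)) <= length (iword x)).
  { unfold CI. rewrite length_map. pose proof (length_word (inI x) (ien x) (ied x)). unfold iword. lia. }
  rewrite <- Nat.mul_assoc. apply Nat.mul_le_mono; [easy|].
  pose proof (costE_le k (costM d k l)) as H1. pose proof (costM_le d k l) as H2.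
  set (K := d * 2 ^ (k + 1) + d + 4) in *.
  assert (H3 : K ^ l <= (2 ^ iwidth x) ^ (kap * h)).
  { etransitivity; [apply Nat.pow_le_mono_l; exact Hkap|]. rewrite <- !Nat.pow_mul_r.
    apply Nat.pow_le_mono_r; [lia|]. unfold l. lia. }
  rewrite Nat.pow_add_r. change (2 ^ 2) with 4.
  assert (2 ^ k * (costM d k l + 3) <= 2 ^ k * (4 * (2 ^ iwidth x) ^ (kap * h)))
    by (apply Nat.mul_le_mono_l; lia).
  lia.
Qed.

End Estimator.

Open Scope R_scope.

(** * Accuracy of the output *)

Lemma INR_to_nat n : INR (N.to_nat n) = nr n.
Proof. unfold nr. now rewrite <- N_nat_Z, <- INR_IZR_INZ. Qed.

Lemma nr_le_of_lt m n : nr m < nr n + 1 -> nr m <= nr n.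
Proof.
  unfold nr. intros H. rewrite <- (plus_IZR _ 1) in H. apply lt_IZR in H. apply IZR_le. lia.
Qed.

Lemma prodf_map {A B} (f : B -> R) (h : A -> B) l : prodf f (map h l) = prodf (fun a => f (h a)) l.
Proof. induction l as [|a l IH]; simpl; [easy|]. now rewrite IH. Qed.

Lemma prodf_ext_in {A} (f f' : A -> R) l : (forall a, In a l -> f a = f' a) -> prodf f l = prodf f' l.
Proof.
  induction l as [|a l IH]; intros H; simpl; [easy|].
  rewrite IH by (intros; apply H; now right). now rewrite (H a) by now left.
Qed.

Lemma prodf_mul {A} (f f' : A -> R) l : prodf (fun a => f a * f' a) l = prodf f l * prodf f' l.
Proof. induction l as [|a l IH]; simpl; [lra|]. rewrite IH. ring. Qed.

Lemma prodR_nth {A} (f : A -> R) (l : list A) a0 :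
  prodR (map (fun v => f (nth v l a0)) (seq 0 (length l))) = prodf f l.
Proof.
  induction l as [|a l IH]; [easy|]. cbn [length seq map nth].
  change (f a * prodR (map (fun v => f (nth v (a :: l) a0)) (seq 1 (length l))) = f a * prodf f l).
  rewrite <- IH, <- seq_shift, map_map. easy.
Qed.

Lemma number_snd {A} (l : list A) : forall i p, In p (number i l) -> In (snd p) l.
Proof.
  induction l as [|a l IH]; intros i p; simpl; [easy|]. intros [<-|H]; [now left|right; eauto].
Qed.

Lemma prodN_zero l : prodN l = 0%N -> In 0%N l.
Proof.
  intros H. assert (E : prodf nr l = 0) by (rewrite <- nr_prodN, H; reflexivity). clear H.
  induction l as [|n l IH]; simpl in *; [lra|].
  apply Rmult_integral in E. destruct E as [E|E]; [left|right; now apply IH].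
  destruct (N.eq_dec n 0) as [|Hn]; [easy|]. apply nr_pos in Hn. lra.
Qed.

Lemma pow_le_exp x m : 0 <= x -> (1 + x) ^ m <= exp (INR m * x).
Proof.
  intros Hx. induction m as [|m IH]; [simpl; rewrite Rmult_0_l, exp_0; lra|].
  rewrite S_INR, Rmult_plus_distr_r, exp_plus, Rmult_1_l. simpl. rewrite Rmult_comm.
  apply Rmult_le_compat; [apply pow_le; lra|lra|easy|].
  destruct (Req_dec x 0) as [->|]; [rewrite exp_0; lra|]. left. apply exp_ineq1. lra.
Qed.

Lemma pow_inv_le x y m : 0 < y -> 0 <= x -> x <= / y -> x ^ m <= / y ^ m.
Proof.
  intros Hy Hx H. rewrite <- pow_inv. apply pow_incr. lra.
Qed.

Section Correct.
Variables (k d h kap : nat) (F : list bool -> R) (tab : nat -> list (list bool * N)) (rho : R).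
Hypothesis Hd : (2 <= d)%nat.
Hypothesis Hk : (2 <= k)%nat.
Hypothesis Hrho : 1 <= rho <= 3.
Hypothesis HF : forall y, length y = k -> 1 <= F y <= rho.
Hypothesis Hgamma : ((INR d - 1) * (INR k - 1) * (rho - 1) / 2) ^ h <= / 2.
Hypothesis Hkap : (d * 2 ^ (k + 1) + d + 4 <= 2 ^ kap)%nat.
Hypothesis Htab : forall n, map fst (tab n) = assignments k /\
  forall y a, In (y, a) (tab n) -> nr a <= F y * 2 ^ n < nr a + 1.

Variable x : input k d.
Let I := inI k d x.
Let n := length (iword k d x).
Let m := length (cstr I).
Let c := icontext k d tab x.
Let eps := INR (ien k d x) / INR (ied k d x).

(** Since F >= 1 and 2^n is an integer, rounding down never goes below 2^n; so the truncated
    function lies in [lam, lam rho] with lam = 2^n. *)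
Lemma table_bounds y : length y = k ->
  2 ^ n <= nr (ctx_g c y) /\ nr (ctx_g c y) <= 2 ^ n * F y /\ 2 ^ n * F y <= nr (ctx_g c y) + 1.
Proof.
  intros Hy. destruct (Htab n) as [H1 H2].
  assert (Hin : In (y, ctx_g c y) (tab n)).
  { apply assoc_match. change (In y (map fst (tab n))). rewrite H1, <- Hy. apply in_assignments. }
  specialize (H2 _ _ Hin). pose proof (HF y Hy). assert (0 < 2 ^ n) by (apply pow_lt; lra).
  split; [|lra]. rewrite <- nr_pow2. apply nr_le_of_lt. rewrite nr_pow2. nra.
Qed.

Lemma eps_pos : 0 < INR (ien k d x) /\ 0 < INR (ied k d x).
Proof. destruct x as [? ? ? ? ? ?]; cbn in *. split; apply lt_0_INR; lia. Qed.

(** One half of eps pays for cutting off the recursion, the other half for truncating [F]. *)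
Lemma error_bounds :
  let eta := INR k * ((INR d - 1) * (INR k - 1) * (rho - 1) / 2) ^ (h * iwidth k d x) * (rho - 1) in
  0 <= eta /\ INR m * eta <= eps / 2 /\ INR m * / 2 ^ n <= eps / 2.
Proof.
  intros eta. destruct eps_pos as [P1 P2].
  assert (Hd1 : 1 <= INR d) by (change 1 with (INR 1); apply le_INR; lia).
  assert (Hk1 : 1 <= INR k) by (change 1 with (INR 1); apply le_INR; lia).
  set (gam := (INR d - 1) * (INR k - 1) * (rho - 1) / 2) in *.
  assert (Hg0 : 0 <= gam).
  { unfold gam, Rdiv. apply Rmult_le_pos; [|lra]. apply Rmult_le_pos; [|lra]. apply Rmult_le_pos; lra. }
  set (j := iwidth k d x) in *.
  (* Every [h] levels halve the error. *)
  assert (Hg : 0 <= gam ^ (h * j) <= / 2 ^ j).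
  { split; [now apply pow_le|]. rewrite pow_mult. apply pow_inv_le; [lra|now apply pow_le|easy]. }
  assert (Hj : 0 < 2 ^ j) by (apply pow_lt; lra). assert (Hn : 0 < 2 ^ n) by (apply pow_lt; lra).
  assert (Hij : 0 < / 2 ^ j) by now apply Rinv_0_lt_compat.
  assert (E2 : forall i, 2 ^ i = INR (2 ^ i)) by (intros i; rewrite pow_INR; f_equal).
  pose proof (pos_INR m) as Hm.
  split; [|split].
  - unfold eta. apply Rmult_le_pos; [|lra]. apply Rmult_le_pos; lra.
  (* The last factor bounds rho - 1. *)
  - assert (eta <= INR k * / 2 ^ j * 2).
    { unfold eta. apply Rmult_le_compat; [apply Rmult_le_pos; lra|lra| |lra].
      apply Rmult_le_compat_l; lra. }
    apply Rle_trans with (INR m * (INR k * / 2 ^ j * 2)); [now apply Rmult_le_compat_l|].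
    pose proof (width_lower k I (ien k d x) (ied k d x) (ipos k d x) (ilt k d x)) as W.
    apply le_INR in W. rewrite !mult_INR, <- E2 in W. fold m in W.
    change (width k I (ien k d x) (ied k d x)) with j in W.
    simpl (INR 4) in W.
    unfold eps. apply Rmult_le_reg_r with (2 ^ j * (2 * INR (ied k d x))); [nra|].
    replace (INR m * (INR k * / 2 ^ j * 2) * (2 ^ j * (2 * INR (ied k d x))))
      with (4 * INR m * INR k * INR (ied k d x)) by (field; lra).
    replace (INR (ien k d x) / INR (ied k d x) / 2 * (2 ^ j * (2 * INR (ied k d x))))
      with (2 ^ j * INR (ien k d x)) by (field; lra).
    lra.
  - pose proof (word_lower I (ien k d x) (ied k d x) (ipos k d x)) as W.
    apply le_INR in W. rewrite !mult_INR, <- E2 in W. fold m in W.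
    change (length (word I (ien k d x) (ied k d x))) with n in W. change (INR 2) with (1 + 1) in W.
    unfold eps. apply Rmult_le_reg_r with (2 ^ n * (2 * INR (ied k d x))); [nra|].
    replace (INR m * / 2 ^ n * (2 ^ n * (2 * INR (ied k d x)))) with (2 * INR m * INR (ied k d x)) by (field; lra).
    replace (INR (ien k d x) / INR (ied k d x) / 2 * (2 ^ n * (2 * INR (ied k d x))))
      with (2 ^ n * INR (ien k d x)) by (field; lra).
    lra.
Qed.

Lemma estimator_correct : exists a b, (0 < b)%nat /\
  iout k d h kap tab x = enc_nat a ++ enc_nat b /\
  exp (- eps) * Zfun F I <= INR a / INR b <= exp eps * Zfun F I.
Proof.
  assert (Hval : valid k d I) by apply ival.
  destruct error_bounds as (Heta & E1 & E2).
  set (eta := INR k * _ * (rho - 1)) in *.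
  set (dflt := ((0%nat, 1%nat), (0%nat, 1%nat))).
  set (Wn := prodN (map (fun p => (fst (nweight p) + snd (nweight p))%N) (wts I))).
  set (Wd := prodN (map (fun p => (N.of_nat (snd (fst p)) * N.of_nat (snd (snd p)))%N) (wts I))).
  (* Either some variable has total weight 0 and the partition function is exactly 0, or [q] is a
     probability for every variable. *)
  destruct (N.eq_dec Wn 0) as [Z0|Hne].
  { assert (Hin := prodN_zero _ Z0). apply in_map_iff in Hin. destruct Hin as (p & Ep & Hp). cbv beta in Ep.
    apply (In_nth _ _ dflt) in Hp. destruct Hp as (v & Hv & Ev).
    assert (Hv' : (v < nv I)%nat) by (destruct Hval as (Hl & _); lia).
    assert (Hz : Zfun F I = 0).
    { apply (Zfun_zero I F v Hv'). destruct (wv_nr k d I Hval v Hv') as [N1 N0].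
      destruct (den_pos k d I Hval v Hv') as [D1 D2]. fold dflt in D1, D2, N1, N0.
      rewrite (wI_find k d I Hval v Hv') in N1, N0. fold dflt in N1, N0. rewrite Ev in *.
      assert (Hs : nr (fst (nweight p)) + nr (snd (nweight p)) = 0) by (rewrite <- nr_add, Ep; reflexivity).
      rewrite N1, N0 in Hs.
      set (D := INR _ * INR _) in Hs. assert (HD : 0 < D) by (unfold D; now apply Rmult_lt_0_compat).
      apply Rmult_eq_reg_r with D; lra. }
    exists 0%nat, 1%nat. split; [lia|]. split.
    - unfold iout. assert (E : inum k d h kap tab x = 0%N) by (unfold inum; fold I; fold Wn; rewrite Z0; apply N.mul_0_r).
      rewrite E. cbn [N.eqb]. now rewrite !encN_spec.
    - rewrite Hz. simpl. lra. }
  assert (Hsum : forall p, In p (wts I) -> (fst (nweight p) + snd (nweight p) <> 0)%N).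
  { intros p Hp E. apply Hne. apply N2Z.inj. apply eq_IZR. change (nr Wn = 0). unfold Wn.
    rewrite nr_prodN, prodf_map. clear - Hp E. induction (wts I) as [|p' l IH]; [easy|].
    cbn [prodf fold_right]. destruct Hp as [->|Hp]; [rewrite E; change (nr 0) with 0; lra|]. unfold prodf in IH. rewrite IH by easy. lra. }
  set (w := ctx_w c). set (g := ctx_g c).
  assert (Hw : forall u, (fst (w u) + snd (w u) <> 0)%N).
  { intros u. unfold w, ctx_w. apply (assoc_prop (fun v => fst v + snd v <> 0)%N); [easy|].
    intros p Hp. apply number_snd in Hp. apply in_map_iff in Hp. destruct Hp as (p' & <- & Hp).
    now apply Hsum. }
  assert (Hpos : forall v, (v < nv I)%nat -> 0 < wv I v false + wv I v true).
  { intros v Hv. destruct (wv_nr k d I Hval v Hv) as [N1 N0].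
    destruct (den_pos k d I Hval v Hv) as [D1 D2].
    set (D := INR _ * INR _) in *. assert (HD : 0 < D) by (unfold D; now apply Rmult_lt_0_compat).
    assert (Hs : 0 < nr (fst (wI I (nat_bits v))) + nr (snd (wI I (nat_bits v)))).
    { rewrite <- nr_add. apply nr_pos. apply Hw. }
    rewrite N1, N0 in Hs. apply Rmult_lt_reg_r with D; lra. }
  set (lam := 2 ^ n). assert (Hlam : 0 < lam) by (apply pow_lt; lra).
  assert (Hg : forall y, length y = k -> lam <= nr (g y) <= lam * rho).
  { intros y Hy. destruct (table_bounds y Hy) as (G1 & G2 & _). pose proof (HF y Hy).
    fold lam in G1, G2. assert (lam * F y <= lam * rho) by (apply Rmult_le_compat_l; lra). unfold g. lra. }
  (* Correlation decay is applied to the integer-valued [g], with lam = 2^n and the [rho] of [F]. *)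
  destruct (est_spec w g k d (VI I) lam rho ltac:(lia) ltac:(lia) Hw Hlam ltac:(lra) Hg
     (NoDup_keys (nv I) 0) (h * iwidth k d x) (CI I) (wf_CI k d I Hval) (deg_CI k d I Hval)) as [S1 S2].
  pose proof (ivalues_est k d h kap tab x Hkap) as EV. fold I c w g in EV.
  rewrite <- EV in S1, S2. set (V := ivalues k d h kap tab x) in *.
  fold eta in S2.
  assert (Elen : length (CI I) = m) by (unfold CI, m; apply length_map). rewrite Elen in S2.
  set (Z := Zc w g (VI I) (CI I)) in *.
  assert (HZ : 0 < Z) by exact (Zc_pos w g k (VI I) lam rho Hw Hlam Hg (CI I) (wf_CI k d I Hval)).
  set (PW := prodR (map (fun v => wv I v false + wv I v true) (seq 0 (nv I)))).
  assert (HPW : 0 < PW).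
  { apply prodR_pos. intros y Hy. apply in_map_iff in Hy. destruct Hy as (v & <- & Hv).
    apply in_seq in Hv. apply Hpos. lia. }
  assert (EZ : Zfun (fun y => nr (g y)) I = PW * Z) by (apply (Zfun_Zc k d I Hval g Hpos)).
  assert (EPW : PW = prodf (fun p => wt p false + wt p true) (wts I)).
  { unfold PW. rewrite <- (proj1 Hval). apply (prodR_nth (fun p => wt p false + wt p true) (wts I) dflt). }
  assert (HWd : 0 < nr Wd).
  { unfold Wd. rewrite nr_prodN, prodf_map. apply prodf_pos. intros p Hp.
    destruct Hval as (_ & Hden & _). destruct (Hden p Hp). apply nr_pos. lia. }
  assert (EWn : nr Wn = PW * nr Wd).
  { rewrite EPW. unfold Wn, Wd. rewrite !nr_prodN, !prodf_map, <- prodf_mul. apply prodf_ext_in.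
    intros p Hp. destruct Hval as (_ & Hden & _). destruct (Hden p Hp) as [D1 D2].
    apply lt_INR in D1, D2. simpl (INR 0) in *. unfold nweight, wt, frac. cbn [fst snd].
    rewrite nr_add, !nr_mul, !nr_of_nat. field. lra. }
  set (num := inum k d h kap tab x). set (den := iden k d h kap tab x).
  assert (Enum : nr num = prodf (fun e => nr (fst e)) V * nr Wn).
  { unfold num, inum. fold I Wn V. now rewrite nr_mul, nr_prodN, prodf_map. }
  assert (Eden : nr den = prodf (fun e => nr (snd e)) V * nr Wd * lam ^ m).
  { unfold den, iden. fold I Wd V. rewrite !nr_mul, nr_prodN, prodf_map, nr_pow2. fold n m.
    unfold lam. now rewrite pow_mult. }
  assert (HSV : 0 < prodf (fun e => nr (snd e)) V) by (apply prodf_pos; exact S1).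
  set (Lm := lam ^ m) in *. assert (HLm : 0 < Lm) by now apply pow_lt.
  assert (ERV : prodf rv V = prodf (fun e => nr (fst e)) V / prodf (fun e => nr (snd e)) V).
  { clear - S1. induction V as [|e V IH]; simpl; [lra|].
    rewrite IH by (intros; apply S1; now right). unfold rv.
    assert (0 < nr (snd e)) by (apply S1; now left).
    assert (0 < prodf (fun e => nr (snd e)) V) by (apply prodf_pos; intros; apply S1; now right).
    field. lra. }
  assert (Hden : 0 < nr den) by (rewrite Eden; repeat apply Rmult_lt_0_compat; easy).
  assert (Eq : nr num / nr den = prodf rv V * PW / Lm).
  { rewrite Enum, Eden, EWn, ERV. field. lra. }
  pose proof (exp_pos (- (INR m * eta))) as X1. pose proof (exp_pos (INR m * eta)) as X2.
  assert (HA : 0 < prodf rv V) by (apply Rlt_le_trans with (Z * exp (- (INR m * eta))); [now apply Rmult_lt_0_compat|lra]).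
  assert (Hnum : num <> 0%N).
  { apply nr_pos_inv. assert (0 < nr num / nr den).
    { rewrite Eq. apply Rmult_lt_0_compat; [now apply Rmult_lt_0_compat|now apply Rinv_0_lt_compat]. }
    replace (nr num) with (nr num / nr den * nr den) by (field; lra). now apply Rmult_lt_0_compat. }
  exists (N.to_nat num), (N.to_nat den). split; [|split].
  { apply nr_pos_inv in Hden. lia. }
  { unfold iout. fold num den. destruct (N.eqb_spec num 0); [easy|]. now rewrite !encN_spec. }
  rewrite !INR_to_nat, Eq.
  (* Truncation can only decrease a factor. *)
  assert (M1 : PW * Z <= Lm * Zfun F I).
  { rewrite <- EZ. apply (Zfun_mono k d I Hval); [lra|]. intros y Hy.
    destruct (table_bounds y Hy) as (G1 & G2 & _). fold lam in G1, G2. unfold g. lra. }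
  set (t := / 2 ^ n) in *. assert (Ht : 0 < t) by now apply Rinv_0_lt_compat.
  assert (Hlt : lam * t = 1) by (unfold lam, t; field; unfold lam in Hlam; lra).
  (* F <= t (g + 1), and 1 <= t g turns the summand 1 into a factor 1 + t. *)
  assert (M2 : Zfun F I <= ((1 + t) * t) ^ m * (PW * Z)).
  { rewrite <- EZ. apply (Zfun_mono k d I Hval); [nra|]. intros y Hy.
    destruct (table_bounds y Hy) as (G1 & _ & G3). fold lam in G1, G3. pose proof (HF y Hy).
    split; [lra|]. fold (g y) in *.
    assert (1 <= t * nr (g y)) by nra.
    apply Rmult_le_reg_l with lam; [easy|].
    replace (lam * ((1 + t) * t * nr (g y))) with ((lam * t) * (nr (g y) + t * nr (g y))) by ring.
    rewrite Hlt. lra. }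
  assert (M3 : Zfun F I <= exp (INR m * t) * (PW * Z / Lm)).
  { eapply Rle_trans; [exact M2|]. rewrite Rpow_mult_distr.
    assert (Et : t ^ m = / Lm).
    { unfold Lm. rewrite <- pow_inv. f_equal. }
    rewrite Et. replace ((1 + t) ^ m * / Lm * (PW * Z)) with ((1 + t) ^ m * (PW * Z / Lm)) by (field; lra).
    apply Rmult_le_compat_r; [|apply pow_le_exp; lra].
    left. apply Rmult_lt_0_compat; [now apply Rmult_lt_0_compat|now apply Rinv_0_lt_compat]. }
  assert (HiL : 0 < / Lm) by now apply Rinv_0_lt_compat.
  assert (HZF : 0 < Zfun F I).
  { apply Rmult_lt_reg_l with Lm; [easy|]. rewrite Rmult_0_r.
    apply Rlt_le_trans with (PW * Z); [now apply Rmult_lt_0_compat|easy]. }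
  assert (Hme : 0 <= INR m * eta) by (apply Rmult_le_pos; [apply pos_INR|easy]).
  assert (Hexp : forall a b, a <= b -> exp a <= exp b).
  { intros a b [Hab| ->]; [left; now apply exp_increasing|lra]. }
  split.
  - apply Rle_trans with (Z * exp (- (INR m * eta)) * PW / Lm).
    + replace (Z * exp (- (INR m * eta)) * PW / Lm) with (exp (- (INR m * eta)) * (PW * Z / Lm)) by (field; lra).
      apply Rle_trans with (exp (- (INR m * t) + - (INR m * eta)) * Zfun F I).
      * apply Rmult_le_compat_r; [lra|]. apply Hexp. lra.
      * rewrite exp_plus.
        replace (exp (- (INR m * t)) * exp (- (INR m * eta)) * Zfun F I)
          with (exp (- (INR m * eta)) * (exp (- (INR m * t)) * Zfun F I)) by ring.
        apply Rmult_le_compat_l; [lra|]. pose proof (exp_pos (INR m * t)). rewrite exp_Ropp.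
        apply Rmult_le_reg_l with (exp (INR m * t)); [easy|].
        rewrite <- Rmult_assoc, Rinv_r, Rmult_1_l by lra. exact M3.
    + unfold Rdiv. apply Rmult_le_compat_r; [lra|]. apply Rmult_le_compat_r; lra.
  - apply Rle_trans with (Z * exp (INR m * eta) * PW / Lm).
    + unfold Rdiv. apply Rmult_le_compat_r; [lra|]. apply Rmult_le_compat_r; lra.
    + replace (Z * exp (INR m * eta) * PW / Lm) with (exp (INR m * eta) * (PW * Z / Lm)) by (field; lra).
      apply Rmult_le_compat; [lra| |apply Hexp; lra|].
      * left. apply Rmult_lt_0_compat; [now apply Rmult_lt_0_compat|easy].
      * apply Rmult_le_reg_r with Lm; [easy|]. unfold Rdiv. rewrite Rmult_assoc, Rinv_l by lra. lra.
Qed.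

End Correct.

Theorem theorem5 (d k : nat) (Hd : (2 <= d)%nat) (Hk : (2 <= k)%nat)
  (F : list bool -> R)
  (HF : forall x : list bool, length x = k ->
          in_Rp (F x) /\
          1 <= F x < (INR d * (INR k - 1) + 1) / (INR d * (INR k - 1) - 1)) :
  has_FPRAS k d F.
Proof.
  assert (Hd2 : 2 <= INR d) by (change 2 with (INR 2); now apply le_INR).
  assert (Hk2 : 2 <= INR k) by (change 2 with (INR 2); now apply le_INR).
  set (D := INR d * (INR k - 1)) in *.
  assert (HD : 2 <= D) by (unfold D; nra).
  assert (Hb : (D + 1) / (D - 1) = 1 + 2 / (D - 1)) by (field; lra).
  assert (Hi : 0 < / (D - 1)) by (apply Rinv_0_lt_compat; lra).
  destruct (max_below F ((D + 1) / (D - 1)) (assignments k)) as (rho & Hr & HFr).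
  { rewrite Hb. unfold Rdiv. lra. }
  { intros y Hy. apply length_assignments in Hy. now apply HF. }
  (* The upper end 1 + 2 / (D - 1) is at most 3, as D >= 2. *)
  assert (Hrho3 : rho <= 3).
  { rewrite Hb in Hr. assert (2 / (D - 1) <= 2); [|lra].
    apply Rmult_le_reg_r with (D - 1); [lra|]. unfold Rdiv. rewrite Rmult_assoc, Rinv_l by lra. lra. }
  set (gam := (INR d - 1) * (INR k - 1) * (rho - 1) / 2).
  assert (Hg0 : 0 <= gam).
  { unfold gam, Rdiv. apply Rmult_le_pos; [|lra]. apply Rmult_le_pos; [|lra]. apply Rmult_le_pos; lra. }
  assert (Hg1 : gam < 1).
  { assert (H1 : (rho - 1) * (D - 1) < 2).
    { apply Rmult_lt_reg_r with (/ (D - 1)); [easy|]. rewrite Rmult_assoc, Rinv_r by lra.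
      rewrite Hb in Hr. unfold Rdiv in Hr. lra. }
    (* The two sides differ by k - 2. *)
    assert (H2 : (INR d - 1) * (INR k - 1) <= D - 1) by (unfold D; nra).
    unfold gam. assert ((INR d - 1) * (INR k - 1) * (rho - 1) <= (D - 1) * (rho - 1))
      by (apply Rmult_le_compat_r; lra). lra. }
  (* [h] is a number of levels that halves the error. *)
  destruct (pow_lt_1_zero gam) with (y := / 2) as [h Hh]; [rewrite Rabs_pos_eq; lra|lra|].
  assert (Hgh : gam ^ h <= / 2).
  { specialize (Hh h (Nat.le_refl h)). rewrite Rabs_pos_eq in Hh by now apply pow_le. lra. }
  destruct (table_PT F (assignments k)) as (tab & Htab & Hspec).
  { intros y Hy. apply length_assignments in Hy. now apply HF. }
  (* Any [kap] with K <= 2^kap will do, and K itself is one. *)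
  set (kap := (d * 2 ^ (k + 1) + d + 4)%nat).
  assert (Hkap : (kap <= 2 ^ kap)%nat) by (pose proof (Nat.pow_gt_lin_r 2 kap); lia).
  apply (FPRAS_of_PT (EX := Enc_input k d) k d F (iword k d) (allow k d) (iout k d h kap tab)
           (inI k d) (ien k d) (ied k d)).
  - intros I e e' Hv He He'. now exists (Input k d I e e' Hv He He').
  - easy.
  - easy.
  - easy.
  - now apply PT_iout.
  - intros x. apply (estimator_correct k d h kap F tab rho); try easy; try lra.
    intros y Hy. split; [now apply HF|]. apply HFr. rewrite <- Hy. apply in_assignments.
Qed.
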